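(* Let $X$ be a complex Banach space. Then: (i) $X$ has type $2$ if and only if $X$ has the $\mathcal H_2$ random convergence property ($\mathcal H_2$-RCP); (ii) $X$ has cotype $2$ if and only if $X$ has the $\mathcal H_2$ random divergence property ($\mathcal H_2$-RDP).
   Context: $\mathbb N=\{1,2,\dots\}$, $\mathbb T=\{z\in\mathbb C:|z|=1\}$; $\mathbb T$ and $\mathbb T^{\mathbb N}$ carry normalized Haar measure. $\mathbb Z^{(\mathbb N)}$ and $\mathbb N_0^{(\mathbb N)}$ are the sets of eventually null sequences of integers and of non-negative integers, respectively; $z^\alpha=\prod_i z_i^{\alpha_i}$. Let $p_1<p_2<\cdots$ be the primes; for $\alpha\in\mathbb N_0^{(\mathbb N)}$ put $n(\alpha)=\prod_i p_i^{\alpha_i}$ (a bijection onto $\mathbb N$). Hardy spaces. For $1\le p<\infty$ and $f\in L_p(\mathbb T^{\mathbb N},X)$ (Bochner space), $\hat f(\alpha)=\int_{\mathbb T^{\mathbb N}}f(w)w^{-\alpha}\,dw$. $H_p(\mathbb T^{\mathbb N},X)$ is the closed subspace of those $f\in L_p(\mathbb T^{\mathbb N},X)$ with $\hat f(\alpha)=0$ for all $\alpha\in\mathbb Z^{(\mathbb N)}\setminus\mathbb N_0^{(\mathbb N)}$. A formal Dirichlet series $D=\sum_n x_n n^{-s}$ with $x_n\in X$ belongs to $\mathcal H_p(X)$ if there is $f\in H_p(\mathbb T^{\mathbb N},X)$ with $\hat f(\alpha)=x_{n(\alpha)}$ for all $\alpha\in\mathbb N_0^{(\mathbb N)}$, and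 then $\|D\|_{\mathcal H_p(X)}=\|f\|_{L_p(\mathbb T^{\mathbb N},X)}$. $\mathcal H^{rad}_p(X)$ is the set of formal Dirichlet series $\sum_n x_n n^{-s}$ with $x_n\in X$ such that $\sum_n\varepsilon_n x_n n^{-s}\in\mathcal H_p(X)$ for almost every $(\varepsilon_n)_n\in\{-1,+1\}^{\mathbb N}$ (Haar probability measure). It is normed by $\|\sum_n x_n n^{-s}\|_{\mathcal H^{rad}_p(X)}=\mathbb E\|\sum_n\varepsilon_n x_n n^{-s}\|_{\mathcal H_p(X)}$, where $\mathbb E$ is the expectation over independent uniform signs $\varepsilon_n=\pm1$. RUC and RUD. A sequence $(y_n)_n$ in a Banach space is RUC (respectively RUD) if there is a constant $C$ such that, for every $m\in\mathbb N$ and all scalars $(a_n)_{n=1}^m\subset\mathbb C$, $\mathbb E\|\sum_{n=1}^m\varepsilon_n a_n y_n\|\le C\|\sum_{n=1}^m a_n y_n\|$ (respectively $\|\sum_{n=1}^m a_n y_n\|\le C\,\mathbb E\|\sum_{n=1}^m\varepsilon_n a_n y_n\|$). $X$ has the $\mathcal H_p$-RCP ($2\le p<\infty$) if it satisfies any of the following equivalent conditions: (a) $(x_n n^{-s})_n$ is RUC in $\mathcal H_p(X)$ for every $(x_n)_n\subset X$; (b) there is $C\ge1$ with $\|\sum_{n=1}^N x_n n^{-s}\|_{\mathcal H^{rad}_p(X)}\le C\|\sum_{n=1}^N x_n n^{-s}\|_{\mathcal H_p(X)}$ for all $N$ and $(x_n)_{n=1}^N\subset X$; (c) $\mathcal H_p(X)\subseteq\mathcal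 H^{rad}_p(X)$; (d) there is $C\ge1$ with $\mathbb E\|\sum_{n=1}^N\varepsilon_n x_n\|\le C(\int_{\mathbb T}\|\sum_{n=1}^N x_n z^n\|^p\,dz)^{1/p}$ for all $N$ and $(x_n)_{n=1}^N\subset X$. $X$ has the $\mathcal H_p$-RDP ($1\le p\le2$) if it satisfies any of the following equivalent conditions: (a) $(x_n n^{-s})_n$ is RUD in $\mathcal H_p(X)$ for every $(x_n)_n\subset X$; (b) there is $C\ge1$ with $\|\sum_{n=1}^N x_n n^{-s}\|_{\mathcal H_p(X)}\le C\|\sum_{n=1}^N x_n n^{-s}\|_{\mathcal H^{rad}_p(X)}$ for all $N$ and $(x_n)_{n=1}^N\subset X$; (c) $\mathcal H^{rad}_p(X)\subseteq\mathcal H_p(X)$; (d) there is $C\ge1$ with $(\int_{\mathbb T}\|\sum_{n=1}^N x_n z^n\|^p\,dz)^{1/p}\le C\,\mathbb E\|\sum_{n=1}^N\varepsilon_n x_n\|$ for all $N$ and $(x_n)_{n=1}^N\subset X$. $X$ has type $2$ (respectively cotype $2$) if there is $C$ with $(\mathbb E\|\sum_{n=1}^N\varepsilon_n x_n\|^2)^{1/2}\le C(\sum_{n=1}^N\|x_n\|^2)^{1/2}$ (respectively $(\sum_{n=1}^N\|x_n\|^2)^{1/2}\le C(\mathbb E\|\sum_{n=1}^N\varepsilon_n x_n\|^2)^{1/2}$) for all $N$ and all $x_1,\dots,x_N\in X$. *)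

(* Defs.v *)
From HB Require Import structures.
From mathcomp Require Import all_boot all_order all_algebra.
From mathcomp Require Import finmap complex.
From mathcomp Require Import all_classical all_reals all_analysis.

Set Implicit Arguments.
Unset Strict Implicit.
Unset Printing Implicit Defensive.

Import Order.TTheory GRing.Theory Num.Theory.
Import numFieldNormedType.Exports.

Local Open Scope classical_set_scope.
Local Open Scope ring_scope.
Local Open Scope complex_scope.

(* A norm over [R[i]] takes values in [R[i]]; [cnorm] is the same norm with
   values in [R]. *)
Definition cnorm (R : realType) (X : normedModType R[i]) (x : X) : R :=
  complex.Re `|x|.

(** * Primes and multi-indices *)

Lemma ex_prime_gt (m : nat) : exists p, prime p && (m < p)%N.
Proof. by have [p mp pp] := prime_above m; exists p; rewrite pp mp. Qed.

(* Indexed from 0: [nth_prime 0 = 2], [nth_prime 1 = 3], and so on. *)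
Fixpoint nth_prime (i : nat) : nat :=
  ex_minn (ex_prime_gt (if i is j.+1 then nth_prime j else 0%N)).

(* Eventually null sequences of integers; coordinates are indexed from 0. *)
Definition multi_index := {fsfun nat -> int with 0%R}.

Definition nonneg_index (a : multi_index) : Prop := forall i, 0 <= a i.

(* Only meaningful for [nonneg_index a]. *)
Definition index_nat (a : multi_index) : nat :=
  (\prod_(i <- finsupp a) nth_prime i ^ `|a i|)%N.

(** * The circle, the infinite torus and its Haar measure *)

Record circle (R : realType) := Circle {
  circle_val :> R[i];
  circle_valP : `|circle_val| == 1 }.

HB.instance Definition _ (R : realType) := [isSub for @circle_val R].
HB.instance Definition _ (R : realType) := [Choice of circle R by <:].
HB.instance Definition _ (R : realType) :=
  isPointed.Build (circle R) (Circle (introT eqP (normr1 R[i]))).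

Lemma circle_mul_subproof (R : realType) (z w : circle R) :
  `|(z : R[i]) * w| == 1.
Proof.
by rewrite normrM (eqP (circle_valP z)) (eqP (circle_valP w)) mulr1.
Qed.

Definition circle_mul (R : realType) (z w : circle R) : circle R :=
  Circle (circle_mul_subproof z w).

Definition torus_cylinders (R : realType) : set (set (nat -> circle R)) :=
  [set A | exists i (U : set R[i]^o),
     open U /\ A = [set z : nat -> circle R | U (z i : R[i])]].

(* [T^N] with the product of the Borel sigma-algebras of the circles; it is the
   Borel sigma-algebra of [T^N], as the product is countable. *)
Definition torus (R : realType) := g_sigma_algebraType (@torus_cylinders R).

Definition torus_mul (R : realType) (w z : torus R) : torus R :=
  fun i => circle_mul (w i) (z i).

Definition is_haar (R : realType) (mu : probability (torus R) R) : Prop :=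
  forall (w : torus R) (A : set (torus R)), measurable A ->
    mu [set z | A (torus_mul w z)] = mu A.

Definition monomial (R : realType) (a : multi_index) (z : torus R) : R[i] :=
  \prod_(i <- finsupp a) (z i : R[i]) ^ a i.

(** * Bochner integral *)

Section Bochner.
Context {d : measure_display} {T : measurableType d} {R : realType}.
Variable X : normedModType R[i].

Definition is_simple (s : T -> X) : Prop :=
  finite_set (range s) /\ forall x, measurable (s @^-1` [set x]).

Definition simple_integral (mu : probability T R) (s : T -> X) : X :=
  \sum_(x \in range s) (fine (mu (s @^-1` [set x])))%:C *: x.

Definition strongly_measurable (f : T -> X) : Prop :=
  exists2 s : nat -> T -> X, forall k, is_simple (s k) &
    forall t, (fun k => s k t) @ \oo --> f t.

Definition is_bochner_integral (mu : probability T R) (f : T -> X) (v : X) :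
    Prop :=
  strongly_measurable f /\
  exists s : nat -> T -> X,
    [/\ forall k, is_simple (s k),
        (fun k => \int[mu]_t (cnorm (f t - s k t))%:E)%E @ \oo --> 0%E &
        (fun k => simple_integral mu (s k)) @ \oo --> v].

Definition Lp_norm (mu : probability T R) (p : R) (f : T -> X) : \bar R :=
  Lnorm mu p%:E (fun t => (cnorm (f t))%:E).

(* Functions rather than almost everywhere classes: every class has a
   representative that is a pointwise limit of simple functions. *)
Definition in_Lp (mu : probability T R) (p : R) (f : T -> X) : Prop :=
  strongly_measurable f /\ (Lp_norm mu p f < +oo)%E.

End Bochner.

(** * Hardy spaces *)

Section Hardy.
Context {R : realType}.
Variables (mu : probability (torus R) R) (p : R) (X : normedModType R[i]).

Definition is_fourier_coef (f : torus R -> X) (a : multi_index) (v : X) :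
    Prop :=
  is_bochner_integral mu (fun w => (monomial a w)^-1 *: f w) v.

Definition in_Hp (f : torus R -> X) : Prop :=
  in_Lp mu p f /\
  forall a, ~ nonneg_index a -> is_fourier_coef f a 0.

(* A formal Dirichlet series [sum_(n >= 1) D n * n^-s] is its sequence of
   coefficients; the value [D 0] is ignored. *)
Definition represents (f : torus R -> X) (D : nat -> X) : Prop :=
  in_Hp f /\ forall a, nonneg_index a -> is_fourier_coef f a (D (index_nat a)).

(* The function that represents [D] is unique up to almost everywhere equality,
   so the infimum is over one value if [D] is represented; it is [+oo]
   otherwise. *)
Definition dirichlet_Hp_norm (D : nat -> X) : \bar R :=
  ereal_inf [set Lp_norm mu p f | f in [set f | represents f D]].

End Hardy.

(** * Random signs *)

Definition sign_seq (N : nat) := {ffun 'I_N -> bool}.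

Definition esign (R : realType) (X : normedModType R[i]) (N : nat)
    (e : sign_seq N) (x : 'I_N -> X) : 'I_N -> X :=
  fun i => (-1) ^+ e i *: x i.

Definition expect_signs (R : realType) (N : nat) (F : sign_seq N -> R) : R :=
  (2 ^+ N)^-1 * \sum_(e : sign_seq N) F e.

Definition expect_signs_ereal (R : realType) (N : nat)
    (F : sign_seq N -> \bar R) : \bar R :=
  (((2 ^+ N)^-1)%:E * \sum_(e : sign_seq N) F e)%E.

Definition has_type2 (R : realType) (X : normedModType R[i]) : Prop :=
  exists C : R, forall (N : nat) (x : 'I_N -> X),
    Num.sqrt (expect_signs (fun e => cnorm (\sum_i esign e x i) ^+ 2))
    <= C * Num.sqrt (\sum_i cnorm (x i) ^+ 2).

Definition has_cotype2 (R : realType) (X : normedModType R[i]) : Prop :=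
  exists C : R, forall (N : nat) (x : 'I_N -> X),
    Num.sqrt (\sum_i cnorm (x i) ^+ 2)
    <= C * Num.sqrt (expect_signs (fun e => cnorm (\sum_i esign e x i) ^+ 2)).

(** * Random convergence and random divergence properties *)

(* The Dirichlet polynomial [sum_(1 <= n <= N) x_n * n^-s], where the vector
   [x_n] is [x i] for [i = n - 1]. *)
Definition dirichlet_poly (R : realType) (X : normedModType R[i]) (N : nat)
    (x : 'I_N -> X) : nat -> X :=
  fun n => \sum_(i < N | i.+1 == n) x i.

(* Norm of a Dirichlet polynomial in the randomized space: only the first [N]
   signs matter. *)
Definition dirichlet_poly_rad_norm (R : realType) (mu : probability (torus R) R)
    (p : R) (X : normedModType R[i]) (N : nat) (x : 'I_N -> X) : \bar R :=
  expect_signs_ereal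
    (fun e => dirichlet_Hp_norm mu p (dirichlet_poly (esign e x))).

Definition Hp_RCP (R : realType) (mu : probability (torus R) R) (p : R)
    (X : normedModType R[i]) : Prop :=
  exists2 C : R, 1 <= C & forall (N : nat) (x : 'I_N -> X),
    (dirichlet_poly_rad_norm mu p x
     <= C%:E * dirichlet_Hp_norm mu p (dirichlet_poly x))%E.

Definition Hp_RDP (R : realType) (mu : probability (torus R) R) (p : R)
    (X : normedModType R[i]) : Prop :=
  exists2 C : R, 1 <= C & forall (N : nat) (x : 'I_N -> X),
    (dirichlet_Hp_norm mu p (dirichlet_poly x)
     <= C%:E * dirichlet_poly_rad_norm mu p x)%E.

(* Main.v *)
Require Import Defs.
From mathcomp Require Import all_boot all_order all_algebra.
From mathcomp Require Import complex.
From mathcomp Require Import all_classical all_reals all_analysis.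
From mathcomp Require Import finmap measurable_realfun ring lra zify.
Import numFieldNormedType.Exports.
Import Order.TTheory GRing.Theory Num.Theory.
Local Open Scope ring_scope.
Local Open Scope complex_scope.

Set Implicit Arguments.
Unset Strict Implicit.
Unset Printing Implicit Defensive.

(** Both equivalences compare, up to constants, the norm of a Dirichlet polynomial
    [sum_n x_n n^-s], the mean [Rad x] of [|sum_n e_n x_n|] over random signs, and
    quadratic means [sqsum] of families of vectors. Kahane's inequality ([kahane])
    lets type 2 and cotype 2 be stated with [Rad].

    The randomized norm is equivalent to [Rad x] in every space
    ([Rad_le_mean_hp], [mean_hp_le_Rad]). To compare the norm of the polynomial with
    finite sums, it is evaluated along the powers of one point of the torus whose
    first coordinates are [u, u^q, u^(q^2), ...], for a root of unity [u]: the values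
    are a finite Fourier transform of the family of coefficients, placed at
    distinct frequencies. The mean over translates of these points
    ([sum_sqr_hp_le]) bounds the norm from above. The bound from below
    ([sum_dft_le]) is a convolution estimate with a kernel of bounded mean that is
    constant on the spectrum, and it is deduced from a Schur test for Fourier
    coefficients ([schur_test]).

    Type 2 and cotype 2 are then needed only for finite Fourier transforms:
    [type2_dft] bounds [Rad x] by the quadratic mean of the transform of [x], and
    [cotype2_dft] bounds the latter by [Rad x]. The reason is the invariance of Gaussian
    sums under unitary maps. Gaussian variables are replaced by sums of many
    independent signs: the average over [K] copies of a Hadamard transform is that of
    the family itself, up to an error that is small compared to the square root
    of [K] ([copies_hadamard_asymp]); the fast Fourier transform composes such steps
    with phases, under which the averages are invariant if the copies carry all
    the phases already ([fft]). Replacing the vectors by copies costs a constant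
    factor from below in every space ([Rad_copies_ge]), and from above if the
    cotype is at most 3 ([Rad_copies_le]).

    For the converse implications, the polynomials [tpoly x] have coefficients
    [c_hj x_h], multiples of the given vectors: on the torus they are
    [sum_h x_h phi_h], where the [phi_h] have disjoint spectra and absolute values
    that are translates of a Fejer kernel. Hence their norm is comparable to
    [sqsum x] in every space ([hp_tpoly_le], [hp_tpoly_ge]), while the mean over signs
    is that of copies of [x]. For cotype 2 the upper bound for the copies needs some
    cotype to begin with; this comes from the cruder bound [Rad_copies_le_max],
    which loses the sixth root of the number of vectors. *)

(** * Norms and averages *)

Definition cmod (R : realType) (z : R[i]) : R := complex.Re `|z|.

Definition avg (R : realType) (T : finType) (F : T -> R) : R :=
  #|T|%:R^-1 * \sum_t F t.

Section CNorm.
Context {R : realType} {X : normedModType R[i]}.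
Implicit Types (x y : X) (a : R[i]) (r : R).

Lemma cnormE x : `|x| = (cnorm x)%:C.
Proof. by rewrite /cnorm RRe_real // normr_real. Qed.

Lemma cmodE a : `|a| = (cmod a)%:C.
Proof. by rewrite /cmod RRe_real // normr_real. Qed.

Lemma cnorm_ge0 x : 0 <= cnorm x.
Proof. by rewrite -lecR -cnormE normr_ge0. Qed.

Lemma cmod_ge0 a : 0 <= cmod a.
Proof. by rewrite -lecR -cmodE normr_ge0. Qed.

Lemma cnorm0 : cnorm (0 : X) = 0.
Proof. by rewrite /cnorm normr0. Qed.

Lemma ler_cnormD x y : cnorm (x + y) <= cnorm x + cnorm y.
Proof. by rewrite -lecR rmorphD /= -!cnormE ler_normD. Qed.

Lemma cnormN x : cnorm (- x) = cnorm x.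
Proof. by rewrite /cnorm normrN. Qed.

Lemma ler_cnormB x y : cnorm (x - y) <= cnorm x + cnorm y.
Proof. by rewrite -(cnormN y) ler_cnormD. Qed.

Lemma cnormZ a x : cnorm (a *: x) = cmod a * cnorm x.
Proof. by apply: complexI; rewrite rmorphM /= -cmodE -!cnormE normrZ. Qed.

Lemma cmodM a b : cmod (a * b) = cmod a * cmod b.
Proof. by apply: complexI; rewrite rmorphM /= -!cmodE normrM. Qed.

Lemma cmodX a n : cmod (a ^+ n) = cmod a ^+ n.
Proof. by apply: complexI; rewrite rmorphXn /= -!cmodE normrX. Qed.

Lemma cmodV a : cmod a^-1 = (cmod a)^-1.
Proof. by apply: complexI; rewrite fmorphV /= -!cmodE normfV. Qed.

Lemma cmodD a b : cmod (a + b) <= cmod a + cmod b.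
Proof. by rewrite -lecR rmorphD /= -!cmodE ler_normD. Qed.

Lemma cmodN a : cmod (- a) = cmod a.
Proof. by rewrite /cmod normrN. Qed.

Lemma cmodr r : cmod r%:C = `|r|.
Proof. by rewrite /cmod normc_def /= expr0n addr0 sqrtr_sqr. Qed.

Lemma cmod1 : cmod (1 : R[i]) = 1.
Proof. by rewrite /cmod normr1. Qed.

Lemma cmod0 : cmod (0 : R[i]) = 0.
Proof. by rewrite /cmod normr0. Qed.

Lemma cmodE_sqr a : cmod a ^+ 2 = complex.Re a ^+ 2 + complex.Im a ^+ 2.
Proof.
by apply: complexI; rewrite rmorphXn /= -cmodE -add_Re2_Im2.
Qed.

Lemma Re_le_cmod a : `|complex.Re a| <= cmod a.
Proof.
by rewrite -(@ler_sqr R) ?nnegrE ?cmod_ge0 // cmodE_sqr real_normK ?num_real //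
  lerDl sqr_ge0.
Qed.

Lemma Im_le_cmod a : `|complex.Im a| <= cmod a.
Proof.
by rewrite -(@ler_sqr R) ?nnegrE ?cmod_ge0 // cmodE_sqr real_normK ?num_real //
  lerDr sqr_ge0.
Qed.

Lemma cmodJ a : cmod a^*%C = cmod a.
Proof. by apply: complexI; rewrite -!cmodE normcJ. Qed.

Lemma mulcJ a : a * a^*%C = (cmod a ^+ 2)%:C.
Proof. by rewrite -sqr_normc cmodE rmorphXn. Qed.

Lemma cnormZr r x : cnorm (r%:C *: x) = `|r| * cnorm x.
Proof. by rewrite cnormZ cmodr. Qed.

Lemma ler_cnorm_sum (I : Type) (s : seq I) (P : pred I) (F : I -> X) :
  cnorm (\sum_(i <- s | P i) F i) <= \sum_(i <- s | P i) cnorm (F i).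
Proof.
apply: (big_ind2 (fun x r => cnorm x <= r)) => //; first by rewrite cnorm0.
by move=> x1 r1 x2 r2 h1 h2; apply: le_trans (ler_cnormD _ _) (lerD h1 h2).
Qed.

End CNorm.

Section Avg.
Context {R : realType}.
Implicit Types T U : finType.

Lemma eq_avg T (F G : T -> R) : F =1 G -> avg F = avg G.
Proof. by move=> h; rewrite /avg (eq_bigr G). Qed.

Lemma avgD T (F G : T -> R) : avg (fun t => F t + G t) = avg F + avg G.
Proof. by rewrite /avg big_split mulrDr. Qed.

Lemma avgZ T (c : R) (F : T -> R) : avg (fun t => c * F t) = c * avg F.
Proof. by rewrite /avg -mulr_sumr mulrCA. Qed.

Lemma avg_sum T (I : finType) (F : I -> T -> R) :
  avg (fun t => \sum_i F i t) = \sum_i avg (F i).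
Proof. by rewrite /avg exchange_big mulr_sumr. Qed.

Lemma avg_le T (F G : T -> R) : (forall t, F t <= G t) -> avg F <= avg G.
Proof.
by move=> h; rewrite /avg ler_wpM2l ?invr_ge0 // ler_sum.
Qed.

Lemma avg_ge0 T (F : T -> R) : (forall t, 0 <= F t) -> 0 <= avg F.
Proof. by move=> h; rewrite /avg mulr_ge0 ?invr_ge0 ?sumr_ge0. Qed.

Lemma avg_const T (t0 : T) (c : R) : avg (fun _ : T => c) = c.
Proof.
rewrite /avg sumr_const -[c *+ _]mulr_natl mulrA mulVf ?mul1r //.
by rewrite pnatr_eq0 -lt0n; apply/card_gt0P; exists t0.
Qed.

Lemma avg_bij T U (h : U -> T) (F : T -> R) :
  bijective h -> avg F = avg (fun u => F (h u)).
Proof.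
move=> hb; rewrite /avg (bij_eq_card hb); congr (_ * _).
by rewrite (reindex h) //; case: hb => g hg gh; exists g => x _.
Qed.

Lemma avg_exchange T U (F : T -> U -> R) :
  avg (fun t => avg (F t)) = avg (fun u => avg (fun t => F t u)).
Proof.
rewrite /avg -!mulr_sumr mulrCA; congr (_ * (_ * _)).
by rewrite exchange_big.
Qed.

Lemma avg_sqr_le T (t0 : T) (F : T -> R) :
  avg F ^+ 2 <= avg (fun t => F t ^+ 2).
Proof.
have : 0 <= avg (fun t => (F t - avg F) ^+ 2).
  by apply: avg_ge0 => t; apply: sqr_ge0.
have -> : avg (fun t => (F t - avg F) ^+ 2)
        = avg (fun t => F t ^+ 2) + (- 2 * avg F) * avg F + avg F ^+ 2.
  rewrite -avgZ -[X in _ = _ + X](avg_const t0) -!avgD.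
  by apply: eq_avg => t; ring.
lra.
Qed.

End Avg.

(** * Rademacher averages *)

Section RadDef.
Context {R : realType} {X : normedModType R[i]}.

Definition rsum (I : finType) (x : I -> X) (e : {ffun I -> bool}) : X :=
  \sum_i (-1) ^+ e i *: x i.

Definition Rad (I : finType) (x : I -> X) : R :=
  avg (fun e => cnorm (rsum x e)).

Definition flips (I : finType) (s e : {ffun I -> bool}) : {ffun I -> bool} :=
  [ffun i => s i (+) e i].

End RadDef.

Section RadTheory.
Context {R : realType} {X : normedModType R[i]}.
Implicit Types (I J : finType).

Lemma flipsK I (s : {ffun I -> bool}) : involutive (flips s).
Proof. by move=> e; apply/ffunP => i; rewrite !ffunE addKb. Qed.

Lemma avg_flips I (s : {ffun I -> bool}) (F : {ffun I -> bool} -> R) :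
  avg F = avg (fun e => F (flips s e)).
Proof. exact: avg_bij (inv_bij (flipsK s)). Qed.

(** The law of the restricted signs is invariant under all flips. *)
Lemma avg_comp_inj I J (s : J -> I) (F : {ffun J -> bool} -> R) :
  injective s -> avg (fun e : {ffun I -> bool} => F [ffun j => e (s j)]) = avg F.
Proof.
move=> sI; pose ext (e' : {ffun J -> bool}) : {ffun I -> bool} :=
  [ffun i => if [pick j | s j == i] is Some j then e' j else false].
have extE e' j : ext e' (s j) = e' j.
  rewrite ffunE; case: pickP => [k /eqP/sI->//|/(_ j)]; by rewrite eqxx.
pose G e e' := F (flips e' [ffun j => (e : {ffun I -> bool}) (s j)]).
transitivity (avg (fun e' => avg (fun e => G e e'))).
  rewrite -[LHS](avg_const [ffun=> false] (T := {ffun J -> bool})).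
  apply: eq_avg => e'; rewrite (avg_flips (ext e')); apply: eq_avg => e.
  by rewrite /G; congr F; apply/ffunP => j; rewrite !ffunE -(extE e' j) ffunE.
rewrite avg_exchange -[RHS](avg_const [ffun=> false] (T := {ffun I -> bool})).
apply: eq_avg => e; rewrite /G [RHS](avg_flips [ffun j => e (s j)]).
apply: eq_avg => e'; congr F; apply/ffunP => j.
by rewrite !ffunE addbC.
Qed.

Lemma eq_Rad I (x y : I -> X) : x =1 y -> Rad x = Rad y.
Proof.
move=> h; apply: eq_avg => e; congr cnorm; apply: eq_bigr => i _.
by rewrite h.
Qed.

Lemma Rad_ge0 I (x : I -> X) : 0 <= Rad x.
Proof. by apply: avg_ge0 => e; apply: cnorm_ge0. Qed.

Lemma rsumD I (x y : I -> X) e :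
  rsum (fun i => x i + y i) e = rsum x e + rsum y e.
Proof. by rewrite /rsum -big_split /=; apply: eq_bigr => i _; rewrite scalerDr. Qed.

Lemma rsumZ I (a : R[i]) (x : I -> X) e :
  rsum (fun i => a *: x i) e = a *: rsum x e.
Proof.
by rewrite /rsum scaler_sumr; apply: eq_bigr => i _; rewrite !scalerA mulrC.
Qed.

Lemma RadD I (x y : I -> X) : Rad (fun i => x i + y i) <= Rad x + Rad y.
Proof.
rewrite /Rad -avgD; apply: avg_le => e; rewrite rsumD; exact: ler_cnormD.
Qed.

Lemma RadZ I (a : R[i]) (x : I -> X) : Rad (fun i => a *: x i) = cmod a * Rad x.
Proof. by rewrite /Rad -avgZ; apply: eq_avg => e; rewrite rsumZ cnormZ. Qed.

Lemma Rad0 I : Rad (fun _ : I => 0 : X) = 0.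
Proof.
rewrite -[RHS](avg_const [ffun=> false] (T := {ffun I -> bool})).
by apply: eq_avg => e; rewrite /rsum big1 ?cnorm0 // => i _; rewrite scaler0.
Qed.

Lemma Rad_sum I (K : Type) (s : seq K) (x : K -> I -> X) :
  Rad (fun i => \sum_(k <- s) x k i) <= \sum_(k <- s) Rad (x k).
Proof.
elim: s => [|k s IH].
  rewrite big_nil (eq_Rad (y := fun=> 0)) ?Rad0 // => i.
  by rewrite big_nil.
rewrite big_cons (eq_Rad (y := fun i => x k i + \sum_(k <- s) x k i)).
  by apply: le_trans (RadD _ _) _; rewrite lerD2l.
by move=> i; rewrite big_cons.
Qed.

Lemma rsum_sign I (s : I -> bool) (x : I -> X) e :
  rsum (fun i => (-1) ^+ s i *: x i) e = rsum x (flips (finfun s) e).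
Proof.
by apply: eq_bigr => i _; rewrite scalerA -signr_addb !ffunE addbC.
Qed.

Lemma Rad_sign I (s : I -> bool) (x : I -> X) :
  Rad (fun i => (-1) ^+ s i *: x i) = Rad x.
Proof.
rewrite /Rad [RHS](avg_flips (finfun s)); apply: eq_avg => e.
by rewrite rsum_sign.
Qed.

Lemma Rad_inj I J (s : J -> I) (y : I -> X) (z : J -> X) : injective s ->
  (forall j, y (s j) = z j) -> (forall i, (forall j, s j != i) -> y i = 0) ->
  Rad y = Rad z.
Proof.
move=> sI yz y0; rewrite /Rad -(avg_comp_inj (fun e => cnorm (rsum z e)) sI).
apply: eq_avg => e; congr cnorm; rewrite /rsum.
rewrite (bigID (mem (codom s))) /= [X in _ + X]big1 ?addr0; last first.
  move=> i /negP ni; rewrite y0 ?scaler0 // => j; apply/eqP => sj.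
  by apply: ni; rewrite -sj codom_f.
transitivity (\sum_(i <- codom s) (-1) ^+ e i *: y i).
  by rewrite -big_uniq /=; [apply: eq_bigl | rewrite map_inj_uniq ?enum_uniq].
by rewrite big_map big_enum; apply: eq_bigr => j _; rewrite ffunE yz.
Qed.

Lemma Rad_bij I J (s : J -> I) (y : I -> X) : bijective s ->
  Rad y = Rad (fun j => y (s j)).
Proof.
move=> sb; apply: Rad_inj (bij_inj sb) _ _ => // i.
by case: sb => g _ gs /(_ (g i)); rewrite gs eqxx.
Qed.

(** Signs may be shared by groups of indices: multiplying the signs of each
    group by one further independent sign does not change their law. *)
Lemma Rad_group I J (phi : I -> J) (x : I -> X) :
  Rad x = avg (fun e : {ffun I -> bool} =>
    Rad (fun j => \sum_(i | phi i == j) (-1) ^+ e i *: x i)).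
Proof.
rewrite /Rad avg_exchange.
rewrite -[LHS](avg_const [ffun=> false] (T := {ffun J -> bool})).
apply: eq_avg => f; rewrite (avg_flips [ffun i => f (phi i)]).
apply: eq_avg => e; congr cnorm; rewrite /rsum.
rewrite (partition_big phi xpredT) //=; apply: eq_bigr => j _.
rewrite scaler_sumr; apply: eq_bigr => i /eqP <-.
by rewrite scalerA -signr_addb !ffunE.
Qed.

End RadTheory.
(** ** Contraction principle *)

Section Contraction.
Context {R : realType} {X : normedModType R[i]}.
Implicit Types (I J : finType).

Lemma Rad_contr I (t : I -> R) (x : I -> X) : (forall i, `|t i| <= 1) ->
  Rad (fun i => (t i)%:C *: x i) <= Rad x.
Proof.
move=> t1.
(* Coordinates are contracted one at a time: for one coordinate the contracted
   family is a convex combination of two families that differ by one sign. *)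
pose y (s : seq I) i := if i \in s then (t i)%:C *: x i else x i.
suff main s : Rad (y s) <= Rad x.
  apply: le_trans (main (enum I)); rewrite le_eqVlt; apply/orP; left.
  by apply/eqP/eq_Rad => i; rewrite /y mem_enum.
elim: s => [|j s IH]; first by rewrite (eq_Rad (y := x)).
have [js|njs] := boolP (j \in s).
  apply: le_trans IH; rewrite le_eqVlt; apply/orP; left.
  apply/eqP/eq_Rad => i; rewrite /y inE.
  by have [->|//] := eqVneq i j; rewrite js.
pose z i := (-1) ^+ (i == j) *: y s i.
have -> : Rad (y (j :: s)) =
    Rad (fun i => ((1 + t j) / 2)%:C *: y s i + ((1 - t j) / 2)%:C *: z i).
  apply: eq_Rad => i; rewrite /z /y inE.
  have [->|ij] /= := eqVneq i j.
    rewrite (negbTE njs) scalerA -scalerDl; congr (_ *: _).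
    by rewrite (_ : (-1) ^+ true = -1 :> R[i]) // mulrN1 -rmorphN -rmorphD /=; congr (_%:C); field.
  rewrite (_ : (-1) ^+ false = 1 :> R[i]) // scale1r -scalerDl -rmorphD /=.
  have -> : (1 + t j) / 2 + (1 - t j) / 2 = 1 by field.
  by rewrite scale1r.
apply: le_trans (RadD _ _) _; rewrite !RadZ !cmodr Rad_sign.
have := t1 j; rewrite ler_norml => /andP[t2 t3].
rewrite !ger0_norm; [|lra|lra].
rewrite -mulrDl; have -> : (1 + t j) / 2 + (1 - t j) / 2 = 1 by field.
by rewrite mul1r.
Qed.

Lemma Rad_le I (a b : I -> R) (x : I -> X) : (forall i, `|a i| <= b i) ->
  Rad (fun i => (a i)%:C *: x i) <= Rad (fun i => (b i)%:C *: x i).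
Proof.
move=> ab; pose t i := a i / b i.
have -> : Rad (fun i => (a i)%:C *: x i) =
          Rad (fun i => (t i)%:C *: ((b i)%:C *: x i)).
  apply: eq_Rad => i; rewrite scalerA -rmorphM /= /t.
  have [b0|b0] := eqVneq (b i) 0; last by rewrite divfK.
  by have := ab i; rewrite b0 normr_le0 => /eqP ->; rewrite mulr0.
apply: Rad_contr => i; rewrite /t normrM normfV.
have b0 : 0 <= b i := le_trans (normr_ge0 _) (ab i).
rewrite (ger0_norm b0); have [->|b0'] := eqVneq (b i) 0.
  by rewrite invr0 mulr0.
by rewrite ler_pdivrMr ?mul1r // lt_def b0'.
Qed.

Lemma Rad_if I (P : pred I) (x : I -> X) :
  Rad (fun i => if P i then x i else 0) <= Rad x.
Proof.
rewrite (eq_Rad (y := fun i => (P i)%:R%:C *: x i)); last first.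
  by move=> i; case: (P i); rewrite ?scale1r // raddf0 scale0r.
by apply: Rad_contr => i; case: (P i); rewrite ?normr1 ?normr0.
Qed.

Lemma Rad_contr_c I (a : I -> R[i]) (b : I -> R) (x : I -> X) :
  (forall i, cmod (a i) <= b i) ->
  Rad (fun i => a i *: x i) <= 2 * Rad (fun i => (b i)%:C *: x i).
Proof.
move=> ab.
rewrite (eq_Rad (y := fun i => (complex.Re (a i))%:C *: x i +
                     'i%C *: ((complex.Im (a i))%:C *: x i))); last first.
  by move=> i; rewrite {1}(complexE (a i)) scalerDl scalerA.
apply: le_trans (RadD _ _) _; rewrite RadZ.
have -> : cmod ('i%C : R[i]) = 1.
  rewrite /cmod; have -> : `|'i%C : R[i]| = 1; last by [].
  by rewrite normc_def /= expr0n expr1n add0r sqrtr1.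
rewrite mul1r (_ : 2 = 1 + 1) // mulrDl mul1r; apply: lerD; apply: Rad_le => i.
  exact: le_trans (Re_le_cmod _) (ab i).
exact: le_trans (Im_le_cmod _) (ab i).
Qed.

End Contraction.

(** ** Kahane's inequality *)

Section Walsh.
Context {R : realType} (I : finType).
Local Notation cube := {ffun I -> bool}.
Implicit Types (s e u : cube) (f g : cube -> R).

Let walsh s e : R := \prod_i (-1) ^+ (s i && e i).
Let hat f s : R := \sum_e f e * walsh s e.
Let ones : cube := [ffun=> true].

Lemma walsh_flips s u e : walsh s (flips u e) = walsh s u * walsh s e.
Proof.
rewrite /walsh -big_split /=; apply: eq_bigr => i _.
by rewrite ffunE -signr_addb -andb_addr.
Qed.

Lemma walsh_sum e : \sum_s walsh s e = if e == [ffun=> false] then 2 ^+ #|I| else 0.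
Proof.
rewrite /walsh -(bigA_distr_bigA (fun i b => (-1) ^+ (b && e i))) /=.
have [->|/eqP e0] := eqVneq e _.
  by under eq_bigr do rewrite big_bool /= !ffunE; rewrite prodr_const.
have [i ei] : exists i, e i.
  apply/existsP; apply: contra_notT e0; rewrite negb_exists => /forallP h.
  by apply/ffunP => i; rewrite ffunE; apply/negbTE.
by rewrite (bigD1 i) //= big_bool /= ei expr1 expr0 addNr mul0r.
Qed.

Lemma flips_eq0 e e' : (flips e e' == [ffun=> false]) = (e == e').
Proof.
apply/eqP/eqP => [h|->]; last by apply/ffunP => i; rewrite !ffunE addbb.
by apply/ffunP => i; have /ffunP/(_ i) := h; rewrite !ffunE; case: (e i); case: (e' i).
Qed.

Lemma parseval f g : \sum_s hat f s * hat g s = 2 ^+ #|I| * \sum_e f e * g e.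
Proof.
transitivity (\sum_e \sum_e' f e * g e' * \sum_s walsh s (flips e e')).
  rewrite /hat; under eq_bigr => s _ do rewrite mulr_suml.
  rewrite exchange_big /=; apply: eq_bigr => e _.
  under eq_bigr => s _ do rewrite mulr_sumr.
  rewrite exchange_big /=; apply: eq_bigr => e' _; rewrite mulr_sumr.
  by apply: eq_bigr => s _; rewrite walsh_flips; ring.
rewrite mulr_sumr; apply: eq_bigr => e _; rewrite (bigD1 e) //= walsh_sum flips_eq0 eqxx mulrC.
rewrite [X in _ + X]big1 ?addr0 // => e' ne.
by rewrite walsh_sum flips_eq0 eq_sym (negbTE ne) mulr0.
Qed.

Lemma hat_flips u f s : hat (fun e => f (flips u e)) s = walsh s u * hat f s.
Proof.
rewrite /hat (reindex_inj (inv_inj (flipsK u))) mulr_sumr /=.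
by apply: eq_bigr => e _; rewrite flipsK walsh_flips mulrCA.
Qed.

Let delta i : cube := [ffun k => k == i].

Lemma walsh_delta s i : walsh s (delta i) = (-1) ^+ s i.
Proof.
rewrite /walsh (bigD1 i) //= ffunE eqxx andbT big1 ?mulr1 // => k ki.
by rewrite ffunE (negbTE ki) andbF.
Qed.

Lemma walsh_ones s : walsh s ones = (-1) ^+ (\sum_i s i)%N.
Proof.
rewrite /walsh -prodrXr; apply: eq_bigr => i _; by rewrite ffunE andbT.
Qed.

Lemma sum_sign s : \sum_i (-1) ^+ s i = #|I|%:R - 2 * (\sum_i s i)%N%:R :> R.
Proof.
rewrite natr_sum mulr_sumr -sum1_card natr_sum -sumrB.
by apply: eq_bigr => i _; case: (s i); rewrite /= ?expr1 ?expr0; lra.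
Qed.

(** An even function on the cube has no Walsh coefficients of order one, so the
    operator that sums over the neighbours has no eigenvalue between [#|I| - 4]
    and [#|I|] on even functions. *)
Lemma even_neighbours f : (forall e, f (flips ones e) = f e) ->
  \sum_e \sum_i f e * f (flips (delta i) e) <=
  (#|I|%:R - 4) * \sum_e f e ^+ 2 + 4 * (2 ^+ #|I|)^-1 * (\sum_e f e) ^+ 2.
Proof.
move=> fe; have n0 : 0 < 2 ^+ #|I| :> R by rewrite exprn_gt0.
have E1 : 2 ^+ #|I| * \sum_e \sum_i f e * f (flips (delta i) e) =
          \sum_s hat f s ^+ 2 * (#|I|%:R - 2 * (\sum_i s i)%N%:R).
  rewrite [X in _ * X]exchange_big /= [LHS]mulr_sumr.
  under [LHS]eq_bigr => i _.
    rewrite -(parseval f (fun e => f (flips (delta i) e))).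
    under eq_bigr => s _ do rewrite hat_flips walsh_delta mulrCA -expr2.
    over.
  rewrite exchange_big /=; apply: eq_bigr => s _.
  by rewrite -mulr_suml sum_sign mulrC.
have E2 : \sum_s hat f s ^+ 2 = 2 ^+ #|I| * \sum_e f e ^+ 2.
  under eq_bigr => s _ do rewrite expr2.
  by rewrite parseval; under eq_bigr => s _ do rewrite -expr2.
have h0 : \sum_e f e = hat f [ffun=> false].
  apply: eq_bigr => e _; rewrite /walsh big1 ?mulr1 // => i _.
  by rewrite ffunE.
rewrite -(ler_pM2l n0) E1 mulrDr mulrCA -E2 h0.
have -> : 2 ^+ #|I| * (4 * (2 ^+ #|I|)^-1 * hat f [ffun=> false] ^+ 2) =
          4 * hat f [ffun=> false] ^+ 2.
  by move: n0; move: (2 ^+ _) => n n0; field; rewrite gt_eqF.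
rewrite (bigD1 [ffun=> false]) //= [X in _ <= _ * X + _](bigD1 [ffun=> false]) //=.
rewrite big1 => [|i _]; last by rewrite ffunE.
set A := \sum_(_ | _) _; set B := \sum_(_ | _) _.
suff : A <= (#|I|%:R - 4) * B by move=> AB; nra.
rewrite /B mulr_sumr; apply: ler_sum => s s0; rewrite mulrC.
have [odd_s|even_s] := boolP (odd (\sum_i s i)%N).
  have := hat_flips ones f s; rewrite walsh_ones -signr_odd odd_s expr1.
  have -> : hat (fun e => f (flips ones e)) s = hat f s.
    by apply: eq_bigr => e _; rewrite fe.
  move=> h; have -> : hat f s = 0 by lra.
  by rewrite expr0n /= !mulr0.
apply: ler_wpM2r; first exact: sqr_ge0.
suff : (2 <= \sum_i s i)%N by rewrite -(ler_nat R); lra.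
case h: (\sum_i s i)%N even_s => [|[|n]] // _.
case/eqP: s0; apply/ffunP => i; rewrite ffunE.
by have /eqP := h; rewrite sum_nat_eq0 => /forallP/(_ i)/=; case: (s i).
Qed.

End Walsh.

Section Kahane.
Context {R : realType} {X : normedModType R[i]}.
Implicit Types (I J : finType).

(** Kahane's inequality with the constant of Latala and Oleszkiewicz. By the
    triangle inequality, the norm [f] of a signed sum satisfies
    [(#|I| - 2) * f <= (sum of f over the neighbours)]; together with the
    spectral gap for even functions this bounds the variance of [f]. *)
Lemma kahane I (x : I -> X) :
  avg (fun e : {ffun I -> bool} => cnorm (rsum x e) ^+ 2) <= 2 * Rad x ^+ 2.
Proof.
pose f e := cnorm (rsum x e).
have fe e : f (flips [ffun=> true] e) = f e.
  rewrite /f -(cnormN (rsum x e)); congr cnorm; rewrite /rsum -sumrN.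
  by apply: eq_bigr => i _; rewrite !ffunE signr_addb expr1 mulN1r scaleNr.
have := even_neighbours fe; set N := #|I|.
have : (N%:R - 2) * \sum_e f e ^+ 2 <=
       \sum_e \sum_i f e * f (flips [ffun k => k == i] e).
  rewrite mulr_sumr; apply: ler_sum => e _; rewrite -mulr_sumr expr2 mulrCA.
  apply: ler_wpM2l; first exact: cnorm_ge0.
  apply: (@le_trans _ _ (cnorm ((N%:R - 2)%:C *: rsum x e))).
    by rewrite cnormZr ler_wpM2r ?cnorm_ge0 // ler_norm.
  apply: le_trans (ler_cnorm_sum _ _ _).
  rewrite le_eqVlt; apply/orP; left; apply/eqP; congr cnorm.
  transitivity (\sum_(i : I) (rsum x e - 2%:R *: ((-1) ^+ e i *: x i))).
    rewrite sumrB sumr_const -[rsum x e *+ _]scaler_nat -scaler_sumr -/(rsum x e) -scalerBl; congr (_ *: _).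
    by rewrite rmorphB /= !rmorph_nat.
  apply: eq_bigr => i _; rewrite /rsum (bigD1 i) //= [RHS](bigD1 i) //=.
  rewrite !ffunE eqxx signr_addb expr1 mulN1r scaleNr.
  set a := (-1) ^+ e i *: x i; set b := (X in a + X - _).
  have -> : 2%:R *: a = a + a by rewrite scaler_nat mulr2n.
  rewrite opprD addrA [a + b]addrC addrK addrC; congr +%R.
  by apply: eq_bigr => k ki; rewrite !ffunE (negbTE ki).
move=> h1 h2; have {h1 h2} := le_trans h1 h2.
rewrite /Rad /avg card_ffun card_bool -/N natrX.
have n0 : 0 < 2 ^+ N :> R by rewrite exprn_gt0.
rewrite exprMn -/f; move: n0; set Q := \sum_e _; set S := \sum_e _.
move: (2 ^+ N) => n n0 h.
have {}h : Q <= 2 * n^-1 * S ^+ 2 by move: h; lra.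
rewrite (_ : 2 * _ = n^-1 * (2 * n^-1 * S ^+ 2)); last by rewrite expr2; ring.
by rewrite ler_pM2l ?invr_gt0.
Qed.

End Kahane.

(** ** Moments of scalar Rademacher sums *)

Section Moments.
Context {R : realType} (I : finType) (c : I -> R).

Let S (s : seq I) (e : {ffun I -> bool}) : R := \sum_(i <- s) (-1) ^+ e i * c i.

(** By induction on the number of terms: odd powers of a new independent sign have
    mean zero, and the constants are the moments of a Gaussian variable. *)
Lemma moments_seq (s : seq I) : uniq s ->
  [/\ avg (fun e : {ffun I -> bool} => S s e ^+ 2) = \sum_(i <- s) c i ^+ 2,
      avg (fun e : {ffun I -> bool} => S s e ^+ 4) <= 3 * (\sum_(i <- s) c i ^+ 2) ^+ 2 &
      avg (fun e : {ffun I -> bool} => S s e ^+ 6) <= 15 * (\sum_(i <- s) c i ^+ 2) ^+ 3].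
Proof.
elim: s => [_|j s IH /= /andP[js /IH[m2 m4 m6]]].
  have E n : avg (fun e : {ffun I -> bool} => S [::] e ^+ n.+1) = 0.
    rewrite -[RHS](avg_const [ffun=> false] (T := {ffun I -> bool})).
    by apply: eq_avg => e; rewrite /S big_nil expr0n.
  by rewrite !E !big_nil !expr0n /= !mulr0.
have Sflip e : S s (flips [ffun k => k == j] e) = S s e.
  apply: eq_big_seq => i si; rewrite !ffunE.
  by rewrite (negbTE (memPn js i si)).
have split n : avg (fun e : {ffun I -> bool} => S (j :: s) e ^+ n) =
    avg (fun e : {ffun I -> bool} => 2^-1 * ((S s e + c j) ^+ n + (S s e - c j) ^+ n)).
  rewrite (eq_avg (G := fun e : {ffun I -> bool} => ((-1) ^+ e j * c j + S s e) ^+ n)); last first.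
    by move=> e; rewrite {1}/S big_cons.
  pose F (e : {ffun I -> bool}) := ((-1) ^+ e j * c j + S s e) ^+ n.
  have : avg F + avg F = 2 * avg (fun e : {ffun I -> bool} =>
      2^-1 * ((S s e + c j) ^+ n + (S s e - c j) ^+ n)).
    rewrite {1}(avg_flips [ffun k => k == j]) -avgD -avgZ; apply: eq_avg => e.
    rewrite mulrA divff ?pnatr_eq0 // mul1r /F Sflip !ffunE eqxx.
    case: (e j); rewrite /= ?expr1 ?expr0 ?mulN1r ?mul1r ![_ + S s e]addrC //.
    by rewrite [LHS]addrC.
  by rewrite /F; lra.
rewrite !split !big_cons; set sg := \sum_(_ <- _) _ in m2 m4 m6 *.
have sg0 : 0 <= sg by apply: sumr_ge0 => i _; apply: sqr_ge0.
have c0 : 0 <= c j ^+ 2 := sqr_ge0 _.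
have cst (r : R) : avg (fun _ : {ffun I -> bool} => r) = r.
  exact: (avg_const [ffun=> false]).
split.
- rewrite (eq_avg (G := fun e : {ffun I -> bool} => S s e ^+ 2 + c j ^+ 2)) ?avgD ?m2 ?cst 1?addrC //.
  by move=> e; field.
- rewrite (eq_avg (G := fun e : {ffun I -> bool} => S s e ^+ 4 +
      (6 * c j ^+ 2) * S s e ^+ 2 + c j ^+ 4)); last by move=> e; field.
  rewrite !avgD cst avgZ m2.
  have -> : c j ^+ 4 = (c j ^+ 2) ^+ 2 by rewrite -exprM.
  nra.
- rewrite (eq_avg (G := fun e : {ffun I -> bool} => S s e ^+ 6 + (15 * c j ^+ 2) * S s e ^+ 4 +
      (15 * c j ^+ 4) * S s e ^+ 2 + c j ^+ 6)); last by move=> e; field.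
  rewrite !avgD cst !avgZ m2.
  have -> : c j ^+ 4 = (c j ^+ 2) ^+ 2 by rewrite -exprM.
  have -> : c j ^+ 6 = (c j ^+ 2) ^+ 3 by rewrite -exprM.
  move: (c j ^+ 2) c0 => u u0.
  have := ler_wpM2l (mulr_ge0 (ler0n _ 15) u0) m4.
  have := mulr_ge0 u0 (sqr_ge0 sg); have := mulr_ge0 (sqr_ge0 u) sg0.
  have := exprn_ge0 3 u0.
  have -> : 15 * (u + sg) ^+ 3 = 15 * sg ^+ 3 + 45 * (u * sg ^+ 2) +
    45 * (u ^+ 2 * sg) + 15 * u ^+ 3 by ring.
  by rewrite -mulrA -!(mulrA 15); lra.
Qed.

Lemma moment2 : avg (fun e : {ffun I -> bool} =>
  (\sum_i (-1) ^+ e i * c i) ^+ 2) = \sum_i c i ^+ 2.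
Proof.
have [h _ _] := moments_seq (enum_uniq I); rewrite big_enum /= in h.
by rewrite -h; apply: eq_avg => e; rewrite /S big_enum.
Qed.

Lemma moment6 : avg (fun e : {ffun I -> bool} =>
  (\sum_i (-1) ^+ e i * c i) ^+ 6) <= 15 * (\sum_i c i ^+ 2) ^+ 3.
Proof.
have [_ _ h] := moments_seq (enum_uniq I); rewrite big_enum /= in h.
by apply: le_trans h; apply: avg_le => e; rewrite /S big_enum.
Qed.

End Moments.

Lemma Re_sum (R : realType) (J : Type) (s : seq J) (P : pred J) (F : J -> R[i]) :
  complex.Re (\sum_(j <- s | P j) F j) = \sum_(j <- s | P j) complex.Re (F j).
Proof. exact: (raddf_sum (@complex.Re R : Rcomplex R -> R)). Qed.

Lemma Im_sum (R : realType) (J : Type) (s : seq J) (P : pred J) (F : J -> R[i]) :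
  complex.Im (\sum_(j <- s | P j) F j) = \sum_(j <- s | P j) complex.Im (F j).
Proof. exact: (raddf_sum (@complex.Im R : Rcomplex R -> R)). Qed.

Lemma sign_C (R : realType) (b : bool) : (-1) ^+ b = ((-1) ^+ b)%:C :> R[i].
Proof. by rewrite rmorph_sign. Qed.

Lemma Re_signM (R : realType) (b : bool) (z : R[i]) :
  complex.Re ((-1) ^+ b * z) = (-1) ^+ b * complex.Re z.
Proof. by rewrite sign_C; case: z => u v; simpc. Qed.

Lemma Im_signM (R : realType) (b : bool) (z : R[i]) :
  complex.Im ((-1) ^+ b * z) = (-1) ^+ b * complex.Im z.
Proof. by rewrite sign_C; case: z => u v; simpc. Qed.

Lemma moment2_c (R : realType) (I : finType) (c : I -> R[i]) :
  avg (fun e : {ffun I -> bool} => cmod (\sum_i (-1) ^+ e i * c i) ^+ 2) =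
  \sum_i cmod (c i) ^+ 2.
Proof.
transitivity (avg (fun e : {ffun I -> bool} =>
    (\sum_i (-1) ^+ e i * complex.Re (c i)) ^+ 2 +
    (\sum_i (-1) ^+ e i * complex.Im (c i)) ^+ 2)).
  apply: eq_avg => e; rewrite cmodE_sqr Re_sum Im_sum.
  congr (_ ^+ 2 + _ ^+ 2); apply: eq_bigr => i _.
    by rewrite Re_signM.
  by rewrite Im_signM.
rewrite avgD !moment2 -big_split; apply: eq_bigr => i _ /=.
by rewrite cmodE_sqr.
Qed.

Lemma khintchine (R : realType) (I : finType) (c : I -> R[i]) :
  \sum_i cmod (c i) ^+ 2 <= 2 * avg (fun e : {ffun I -> bool} =>
    cmod (\sum_i (-1) ^+ e i * c i)) ^+ 2.
Proof. rewrite -moment2_c; exact: (@kahane R (R[i]^o : normedModType R[i])). Qed.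

(** ** Comparison of Rademacher sums with sums of independent copies *)

Section Copies.
Context {R : realType} {X : normedModType R[i]}.
Implicit Types (I J : finType).

Lemma sum_fst (V : nmodType) I J (F : I * J -> V) i :
  \sum_(p | p.1 == i) F p = \sum_j F (i, j).
Proof.
transitivity (\sum_(p | (p.1 == i) && true) F (p.1, p.2)).
  by apply: eq_big => [p|[a b] _]; rewrite ?andbT.
rewrite -(pair_big_dep (fun a => a == i) (fun _ _ => true) (fun a b => F (a, b))).
by rewrite /= big_pred1_eq.
Qed.

(** The signs of the copies of [x i] may be multiplied by one more sign that they
    share, and the remaining signs are part of the coefficient. *)
Lemma Rad_copies I J (c : I -> J -> R[i]) (x : I -> X) :
  Rad (fun p : I * J => c p.1 p.2 *: x p.1) =
  avg (fun e : {ffun I * J -> bool} =>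
    Rad (fun i => (\sum_j (-1) ^+ e (i, j) * c i j) *: x i)).
Proof.
rewrite (Rad_group (fun p : I * J => p.1)); apply: eq_avg => e.
apply: eq_Rad => i; rewrite sum_fst scaler_suml; apply: eq_bigr => j _.
by rewrite /= scalerA.
Qed.

(** Conditionally on the coefficients [G i], the sum dominates the one with
    coefficients [|G i|], hence also, by convexity, the one with coefficients
    the means of [|G i|]; these are bounded below by Khintchine's inequality. *)
Lemma Rad_copies_ge I J (c : I -> J -> R[i]) (b : R) (x : I -> X) : 0 <= b ->
  (forall i, b ^+ 2 <= \sum_j cmod (c i j) ^+ 2) ->
  b * Rad x <= 4 * Rad (fun p : I * J => c p.1 p.2 *: x p.1).
Proof.
move=> b0 hb; rewrite Rad_copies.
pose G i (e : {ffun I * J -> bool}) : R[i] := \sum_j (-1) ^+ e (i, j) * c i j.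
have EG i : b / 2 <= avg (fun e => cmod (G i e)).
  have A0 : 0 <= avg (fun e => cmod (G i e)) by apply: avg_ge0 => e; apply: cmod_ge0.
  pose c' (p : I * J) := if p.1 == i then c p.1 p.2 else 0.
  have := khintchine c'.
  have -> : \sum_p cmod (c' p) ^+ 2 = \sum_j cmod (c i j) ^+ 2.
    rewrite -(sum_fst (fun p => cmod (c p.1 p.2) ^+ 2)) [RHS]big_mkcond.
    by apply: eq_bigr => p _; rewrite /c'; case: eqP => //; rewrite cmod0 expr0n.
  have -> : avg (fun e : {ffun I * J -> bool} => cmod (\sum_p (-1) ^+ e p * c' p)) =
            avg (fun e => cmod (G i e)).
    apply: eq_avg => e; congr cmod; rewrite /G.
    rewrite -(sum_fst (fun p => (-1) ^+ e p * c p.1 p.2)) [RHS]big_mkcond.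
    by apply: eq_bigr => p _; rewrite /c'; case: eqP => //; rewrite mulr0.
  by move=> h; have := le_trans (hb i) h; nra.
apply: (@le_trans _ _ (2 * Rad (fun i => (avg (fun e => cmod (G i e)))%:C *: x i))).
  apply: (@le_trans _ _ (2 * Rad (fun i => (b / 2)%:C *: x i))).
    by rewrite RadZ cmodr ger0_norm ?divr_ge0 //; lra.
  by rewrite ler_pM2l //; apply: Rad_le => i; rewrite ger0_norm ?divr_ge0.
suff h : Rad (fun i => (avg (fun e => cmod (G i e)))%:C *: x i) <=
    avg (fun e => Rad (fun i => (cmod (G i e))%:C *: x i)).
  have h2 : avg (fun e => Rad (fun i => (cmod (G i e))%:C *: x i)) <=
     2 * avg (fun e => Rad (fun i => G i e *: x i)).
    rewrite -avgZ; apply: avg_le => e.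
    pose u i := if G i e == 0 then 0 else (cmod (G i e))%:C / G i e.
    have -> : Rad (fun i => (cmod (G i e))%:C *: x i) =
              Rad (fun i => u i *: (G i e *: x i)).
      apply: eq_Rad => i; rewrite scalerA /u; congr (_ *: _).
      by case: eqP => [->|/eqP g0]; rewrite ?cmod0 ?mul0r // divfK.
    apply: le_trans (Rad_contr_c (b := fun=> 1) _ _) _ => [i|].
      rewrite /u; case: eqP => [_|/eqP g0]; first by rewrite cmod0 ler01.
      rewrite cmodM cmodV cmodr ger0_norm ?cmod_ge0 // divff //.
      by apply: contra_neq g0 => g0; apply/eqP; rewrite -normr_eq0 cmodE g0.
    by rewrite RadZ cmodr normr1 mul1r.
  lra.
rewrite /avg (eq_Rad (y := fun i => \sum_e
    (#|{ffun I * J -> bool}|%:R^-1)%:C *: ((cmod (G i e))%:C *: x i))).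
  apply: le_trans (Rad_sum _ _) _; rewrite mulr_sumr; apply: ler_sum => e _.
  by rewrite RadZ cmodr ger0_norm ?invr_ge0.
move=> i; rewrite -scaler_sumr -scaler_suml scalerA -rmorph_sum -rmorphM //.
Qed.

End Copies.

(** ** Upper bounds under weak cotype *)

(** This is implied by cotype [q] for every [q <= 3]. The number of vectors is a
    power of [64] and the bound a power of [16] so that sixth moments can be
    summed without roots. *)
Definition weak_cotype (R : realType) (X : normedModType R[i]) (A : R) : Prop :=
  forall (s : nat) (x : 'I_(64 ^ s) -> X), \sum_k cnorm (x k) <= A * 16 ^+ s * Rad x.

Section WeakCotype.
Context {R : realType} {X : normedModType R[i]}.
Implicit Types (I J : finType).

Lemma sum_pushforward I (U : finType) (w : I -> U -> R) (g : I -> U -> bool)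
    (F : {ffun I -> bool} -> R) :
  \sum_(l : {ffun I -> U}) (\prod_i w i (l i)) * F [ffun i => g i (l i)] =
  \sum_(S : {ffun I -> bool}) (\prod_i \sum_(u | g i u == S i) w i u) * F S.
Proof.
rewrite (partition_big (fun l : {ffun I -> U} => [ffun i => g i (l i)]) xpredT) //=.
apply: eq_bigr => S _.
rewrite (bigA_distr_big_dep (fun i u => g i u == S i)) mulr_suml.
apply: eq_big => [l|l /eqP -> //].
apply/eqP/familyP => [<- i|h]; first by rewrite ffunE unfold_in.
by apply/ffunP => i; have := h i; rewrite ffunE unfold_in => /eqP.
Qed.

Let ber I (p : I -> R) (S : {ffun I -> bool}) : R :=
  \prod_i (if S i then p i else 1 - p i).

Let part I (x : I -> X) (S : {ffun I -> bool}) : R :=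
  Rad (fun i => if S i then x i else 0).

Lemma sum_option (V : nmodType) (U : finType) (F : option U -> V) :
  \sum_u F u = F None + \sum_k F (Some k).
Proof.
rewrite (bigD1 None) //=; congr +%R.
rewrite (reindex_omap Some id) /=; last by case.
by apply: eq_bigl => k; rewrite eqxx.
Qed.

Lemma weak_cotype_labels (A : R) (hA : weak_cotype X A) (s : nat) I (x : I -> X)
    (l : I -> option 'I_(64 ^ s)) : 0 <= A ->
  \sum_k part x [ffun i => l i == Some k] <= A * 16 ^+ s * Rad x.
Proof.
move=> A0.
pose S (e : {ffun I -> bool}) u := \sum_(i | l i == u) (-1) ^+ e i *: x i.
have -> : \sum_k part x [ffun i => l i == Some k] =
    avg (fun e => \sum_k cnorm (S e (Some k))).
  rewrite avg_sum; apply: eq_bigr => k _; apply: eq_avg => e; congr cnorm.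
  rewrite /rsum /S [RHS]big_mkcond; apply: eq_bigr => i _; rewrite ffunE.
  by case: eqP => //; rewrite scaler0.
rewrite (Rad_group l) -avgZ; apply: avg_le => e.
apply: le_trans (hA s _) _; rewrite ler_wpM2l ?mulr_ge0 ?exprn_ge0 //.
rewrite -(@Rad_inj _ _ _ _ Some (fun u => if u is Some _ then S e u else 0)) //.
- by rewrite (eq_Rad (y := fun u => if isSome u then S e u else 0)) ?Rad_if //; case.
- by case=> // k /(_ k); rewrite eqxx.
Qed.

(** Random labels with values among [64 ^ s] classes turn [weak_cotype] into a
    bound for the sum over a random set of indices, chosen independently with
    probabilities at most [64 ^- s]. *)
Lemma weak_cotype_select (A : R) (hA : weak_cotype X A) (s : nat) I (x : I -> X)
    (p : I -> R) : 0 <= A -> (forall i, 0 <= p i) -> (forall i, 64 ^+ s * p i <= 1) ->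
  \sum_S ber p S * part x S <= A * 4^-1 ^+ s * Rad x.
Proof.
move=> A0 p0 p1; pose m := (64 ^ s)%N.
pose w i (u : option 'I_m) := if u is Some _ then p i else 1 - 64 ^+ s * p i.
have w0 i u : 0 <= w i u by case: u => [k|] /=; rewrite ?subr_ge0.
have w1 i : \sum_u w i u = 1.
  rewrite sum_option /= sumr_const card_ord -[p i *+ m]mulr_natl natrX; lra.
have Ek k : \sum_S ber p S * part x S = \sum_(l : {ffun I -> option 'I_m})
    (\prod_i w i (l i)) * part x [ffun i => l i == Some k].
  rewrite (sum_pushforward w (fun i u => u == Some k)).
  apply: eq_bigr => S _; congr (_ * _); apply: eq_bigr => i _.
  have T : \sum_(u | u == Some k) w i u = p i by rewrite big_pred1_eq.
  case: (S i); first by rewrite -[LHS]T; apply: eq_bigl => u; rewrite eqb_id.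
  have := w1 i; rewrite (bigID (fun u => u == Some k)) /= T => <-.
  rewrite addrAC subrr add0r; apply: eq_bigl => u; by rewrite eqbF_neg.
have : m%:R * \sum_S ber p S * part x S <= A * 16 ^+ s * Rad x.
  rewrite (_ : _ * _ = \sum_(k < m) \sum_(l : {ffun I -> option 'I_m})
    (\prod_i w i (l i)) * part x [ffun i => l i == Some k]); last first.
    under [RHS]eq_bigr => k _ do rewrite -(Ek k).
    by rewrite sumr_const card_ord mulr_natl.
  rewrite exchange_big /=.
  have -> : A * 16 ^+ s * Rad x = \sum_(l : {ffun I -> option 'I_m})
     (\prod_i w i (l i)) * (A * 16 ^+ s * Rad x).
    rewrite -mulr_suml -(bigA_distr_bigA w) big1 ?mul1r // => i _; exact: w1.
  apply: ler_sum => l _; rewrite -mulr_sumr ler_wpM2l ?prodr_ge0 //.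
  exact: weak_cotype_labels.
rewrite /m natrX => h.
have h64 : 0 < 64 ^+ s :> R by rewrite exprn_gt0.
rewrite -(ler_pM2l h64); apply: le_trans h _.
have E : 16 ^+ s = 64 ^+ s * 4^-1 ^+ s :> R.
  by rewrite -exprMn; congr (_ ^+ _); field.
by rewrite E le_eqVlt; apply/orP; left; apply/eqP; ring.
Qed.

Lemma ler_layers (T : nat) (u : R) : 0 <= u -> u <= 2 ^+ T.+1 ->
  u <= 2 + \sum_(t < T) 2 ^+ t.+2 * (2 ^+ t.+1 < u)%R%:R.
Proof.
move=> u0; elim: T => [|T IH] hu; first by rewrite big_ord0 addr0 -(expr1 2).
rewrite big_ord_recr /= addrA; have [hT|hT] := ltP (2 ^+ T.+1) u.
  rewrite mulr1; apply: le_trans hu _; rewrite lerDr; apply: addr_ge0 => //.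
  by apply: sumr_ge0 => t _; rewrite mulr_ge0 // exprn_ge0.
by rewrite mulr0 addr0; apply: IH.
Qed.

Lemma avg_gt_le (Om : finType) (u : Om -> R) (t : nat) : (forall o, 0 <= u o) ->
  avg (fun o => u o ^+ 6) <= 15 ->
  64 ^+ t * avg (fun o => (2 ^+ t.+1 < u o)%R%:R : R) <= 1.
Proof.
move=> u0 h.
have h64 : 0 < 64 ^+ t.+1 :> R by rewrite exprn_gt0.
have : 64 ^+ t.+1 * avg (fun o => (2 ^+ t.+1 < u o)%R%:R : R) <= 15.
  apply: le_trans h; rewrite -avgZ; apply: avg_le => o.
  case: ltP => ho; last by rewrite /= mulr0n mulr0 exprn_ge0.
  rewrite mulr1 (_ : 64 = 2 ^+ 6 :> R); last by rewrite -natrX.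
  by rewrite exprAC lerXn2r ?nnegrE ?exprn_ge0 // ltW.
rewrite exprS -mulrA; set z := 64 ^+ t * _; lra.
Qed.

(** The modulus of a real coefficient is split into the layers where it
    exceeds a power of two; a layer is a random set of indices of small
    probability, to which [weak_cotype_select] applies. *)
Lemma Rad_copies_le_real (A : R) (hA : weak_cotype X A) I J (c : I -> J -> R)
    (x : I -> X) : 0 <= A -> (forall i, \sum_j c i j ^+ 2 <= 1) ->
  Rad (fun p : I * J => (c p.1 p.2)%:C *: x p.1) <= (2 + 8 * A) * Rad x.
Proof.
move=> A0 c1.
pose Om := {ffun J -> bool}; pose a i (o : Om) : R := \sum_j (-1) ^+ o j * c i j.
pose T := #|J|.
have cij i j : `|c i j| <= 1.
  rewrite -(@ler_sqr R) ?nnegrE // expr1n real_normK ?num_real //.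
  apply: le_trans (c1 i); rewrite (bigD1 j) //= lerDl sumr_ge0 // => k _.
  exact: sqr_ge0.
have aT i o : `|a i o| <= 2 ^+ T.+1.
  apply: le_trans (ler_norm_sum _ _ _) _.
  apply: (@le_trans _ _ (\sum_(j : J) 1)).
    by apply: ler_sum => j _; rewrite normrM normr_sign mul1r.
  rewrite sumr_const -natrX ler_nat; apply: leq_trans (ltnW (ltn_expl _ (isT : 1 < 2)%N)) _.
  by rewrite leq_exp2l.
have -> : Rad (fun p : I * J => (c p.1 p.2)%:C *: x p.1) =
    avg (fun w : {ffun I -> Om} => Rad (fun i => (a i (w i))%:C *: x i)).
  rewrite (Rad_copies (fun i j => (c i j)%:C)).
  pose h (w : {ffun I -> Om}) : {ffun I * J -> bool} := [ffun p => w p.1 p.2].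
  rewrite (@avg_bij _ _ _ h); last first.
    exists (fun e : {ffun I * J -> bool} => [ffun i => [ffun j => e (i, j)]]).
      by move=> w; apply/ffunP => i; apply/ffunP => j; rewrite !ffunE.
    by move=> e; apply/ffunP => -[i j]; rewrite !ffunE.
  apply: eq_avg => w; apply: eq_Rad => i; congr (_ *: _).
  rewrite /a rmorph_sum; apply: eq_bigr => j _.
  by rewrite ffunE sign_C -rmorphM.
pose sel t (w : {ffun I -> Om}) : {ffun I -> bool} := [ffun i => 2 ^+ t.+1 < `|a i (w i)|].
have layers (w : {ffun I -> Om}) : Rad (fun i => (a i (w i))%:C *: x i) <=
    2 * Rad x + \sum_(t < T) 2 ^+ t.+2 * part x (sel t w).
  apply: le_trans (Rad_le _ _) _ => [i|].
    by apply: (@ler_layers T); rewrite ?aT.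
  under eq_Rad => i do rewrite rmorphD rmorph_sum scalerDl scaler_suml.
  apply: le_trans (RadD _ _) _; rewrite RadZ cmodr ger0_norm // lerD2l.
  apply: le_trans (Rad_sum _ _) _; apply: ler_sum => t _.
  under eq_Rad => i do rewrite rmorphM -scalerA.
  rewrite RadZ cmodr ger0_norm ?exprn_ge0 // ler_wpM2l ?exprn_ge0 //.
  rewrite le_eqVlt; apply/orP; left; apply/eqP; apply: eq_Rad => i.
  by rewrite ffunE; case: ltP => _; rewrite ?scale1r //= mulr0n raddf0 scale0r.
apply: le_trans (avg_le layers) _; rewrite avgD avg_sum.
rewrite (avg_const [ffun=> [ffun=> false]]) [leRHS]mulrDl lerD2l.
have sel_le t : avg (fun w : {ffun I -> Om} => part x (sel t w)) <= A * 4^-1 ^+ t * Rad x.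
  pose p i := avg (fun o : Om => (2 ^+ t.+1 < `|a i o|)%R%:R : R).
  have p0 i : 0 <= p i by apply: avg_ge0.
  have p1 i : 64 ^+ t * p i <= 1.
    apply: avg_gt_le => //; apply: le_trans (_ : 15 * (\sum_j c i j ^+ 2) ^+ 3 <= _).
      apply: le_trans (moment6 _); apply: avg_le => o.
      by rewrite -normrX ger0_norm // exprn_even_ge0.
    rewrite -[leRHS]mulr1 ler_pM2l // exprn_ile1 // sumr_ge0 // => j _.
    exact: sqr_ge0.
  apply: le_trans (weak_cotype_select hA x A0 p0 p1).
  have := sum_pushforward (fun (i : I) (o : Om) => #|Om|%:R^-1)
    (fun i o => 2 ^+ t.+1 < `|a i o|) (part x).
  have -> : avg (fun w : {ffun I -> Om} => part x (sel t w)) =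
    \sum_(w : {ffun I -> Om}) (\prod_(i : I) #|Om|%:R^-1) * part x (sel t w).
    by rewrite /avg mulr_sumr card_ffun natrX prodr_const exprVn.
  move=> ->; rewrite le_eqVlt; apply/orP; left; apply/eqP.
  apply: eq_bigr => S _; congr (_ * _); apply: eq_bigr => i _.
  have T1 : \sum_(o : Om) #|Om|%:R^-1 = 1 :> R.
    rewrite sumr_const -[_ *+ _]mulr_natl divff // pnatr_eq0 -lt0n.
    by apply/card_gt0P; exists [ffun=> false].
  have Tp : \sum_(o : Om | 2 ^+ t.+1 < `|a i o|) #|Om|%:R^-1 = p i.
    rewrite big_mkcond /p /avg mulr_sumr; apply: eq_bigr => o _.
    by case: ltP; rewrite /= ?mulr1 ?mulr0n ?mulr0.
  case: (S i); first by rewrite -[RHS]Tp; apply: eq_bigl => o; rewrite eqb_id.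
  move: T1; rewrite (bigID (fun o => 2 ^+ t.+1 < `|a i o|)) /= Tp => /eqP.
  rewrite addrC eq_sym -subr_eq => /eqP ->. 
  by apply: eq_bigl => o; rewrite eqbF_neg.
under eq_bigr => t _ do rewrite avgZ.
apply: (@le_trans _ _ (\sum_(t < T) 4 * (2^-1 ^+ t) * (A * Rad x))).
  apply: ler_sum => t _; apply: le_trans (ler_wpM2l _ (sel_le t)) _.
    by rewrite exprn_ge0.
  have -> : 4^-1 = 2^-1 * 2^-1 :> R by field.
  rewrite exprMn !exprS le_eqVlt; apply/orP; left; apply/eqP.
  have h2 : 2 ^+ t * 2^-1 ^+ t = 1 :> R by rewrite -exprMn divff ?expr1n.
  transitivity (4 * 2^-1 ^+ t * (A * Rad x) * (2 ^+ t * 2^-1 ^+ t)).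
    by ring.
  by rewrite h2 mulr1.
rewrite -mulr_suml -mulr_sumr mulrA ler_wpM2r ?Rad_ge0 //.
rewrite ler_wpM2r //.
suff -> : \sum_(t < T) 2^-1 ^+ t = 2 - 2 * 2^-1 ^+ T :> R.
  by have := exprn_ge0 T (_ : 0 <= 2^-1 :> R); lra.
elim: T {aT sel_le layers} => [|n IH]; first by rewrite big_ord0 expr0; lra.
by rewrite big_ord_recr /= IH exprS; lra.
Qed.

End WeakCotype.

Section CopiesUpper.
Context {R : realType} {X : normedModType R[i]}.
Implicit Types (I J : finType).

Lemma Rad_ReIm I (a : I -> R[i]) (x : I -> X) :
  Rad (fun i => a i *: x i) <= Rad (fun i => (complex.Re (a i))%:C *: x i) +
                               Rad (fun i => (complex.Im (a i))%:C *: x i).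
Proof.
rewrite (eq_Rad (y := fun i => (complex.Re (a i))%:C *: x i +
                     'i%C *: ((complex.Im (a i))%:C *: x i))); last first.
  by move=> i; rewrite {1}(complexE (a i)) scalerDl scalerA.
apply: le_trans (RadD _ _) _; rewrite RadZ.
suff -> : cmod ('i%C : R[i]) = 1 by rewrite mul1r.
by rewrite /cmod normc_def /= expr0n expr1n add0r sqrtr1.
Qed.

Lemma Rad_copies_ReIm I J (c : I -> J -> R[i]) (x : I -> X) (b K : R) : 0 < b ->
  (forall i, \sum_j cmod (c i j) ^+ 2 <= b ^+ 2) ->
  (forall c' : I -> J -> R, (forall i, \sum_j c' i j ^+ 2 <= 1) ->
     Rad (fun p : I * J => (c' p.1 p.2)%:C *: x p.1) <= K * Rad x) ->
  Rad (fun p : I * J => c p.1 p.2 *: x p.1) <= 2 * b * K * Rad x.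
Proof.
move=> b0 cb hK; apply: le_trans (Rad_ReIm _ _) _.
have main (c' : I -> J -> R) : (forall i j, `|c' i j| <= cmod (c i j)) ->
    Rad (fun p : I * J => (c' p.1 p.2)%:C *: x p.1) <= b * K * Rad x.
  move=> hc.
  have -> : Rad (fun p : I * J => (c' p.1 p.2)%:C *: x p.1) =
      b * Rad (fun p : I * J => (c' p.1 p.2 / b)%:C *: x p.1).
    have := RadZ b%:C (fun p : I * J => (c' p.1 p.2 / b)%:C *: x p.1).
    rewrite cmodr ger0_norm ?(ltW b0) // => <-; apply: eq_Rad => p.
    rewrite scalerA -rmorphM; congr (_%:C *: _); field; exact: lt0r_neq0.
  rewrite -mulrA ler_pM2l //; apply: (hK (fun i j => c' i j / b)) => i.
  under eq_bigr => j _ do rewrite expr_div_n.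
  rewrite -mulr_suml ler_pdivrMr ?exprn_gt0 // mul1r; apply: le_trans (cb i).
  apply: ler_sum => j _; rewrite -real_normK ?num_real // ler_sqr //.
  by rewrite nnegrE cmod_ge0.
have -> : 2 * b * K * Rad x = b * K * Rad x + b * K * Rad x by ring.
apply: lerD; [apply: (main (fun i j => complex.Re (c i j))) => i j|
              apply: (main (fun i j => complex.Im (c i j))) => i j].
  exact: Re_le_cmod.
exact: Im_le_cmod.
Qed.

Lemma Rad_copies_le (A : R) (hA : weak_cotype X A) I J (c : I -> J -> R[i])
    (b : R) (x : I -> X) : 0 <= A -> 0 < b ->
  (forall i, \sum_j cmod (c i j) ^+ 2 <= b ^+ 2) ->
  Rad (fun p : I * J => c p.1 p.2 *: x p.1) <= b * (4 + 16 * A) * Rad x.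
Proof.
move=> A0 b0 cb; have -> : b * (4 + 16 * A) = 2 * b * (2 + 8 * A) by ring.
apply: Rad_copies_ReIm => // c' hc; exact: Rad_copies_le_real.
Qed.

(** Without any assumption on the space, the coefficients may be replaced by
    their maximum, which the sixth moments control. *)
Lemma Rad_copies_le_max (s : nat) I J (c : I -> J -> R[i]) (b : R) (x : I -> X) :
  #|I| = (64 ^ s)%N -> 0 < b ->
  (forall i, \sum_j cmod (c i j) ^+ 2 <= b ^+ 2) ->
  Rad (fun p : I * J => c p.1 p.2 *: x p.1) <= b * (32 * 2 ^+ s) * Rad x.
Proof.
move=> cardI b0 cb; have -> : b * (32 * 2 ^+ s) = 2 * b * (16 * 2 ^+ s) by ring.
apply: Rad_copies_ReIm => // {}c {}cb.
rewrite (Rad_copies (fun i j => (c i j)%:C)).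
pose a i (e : {ffun I * J -> bool}) : R := \sum_j (-1) ^+ e (i, j) * c i j.
have s0 : 0 < 2 ^+ s :> R by rewrite exprn_gt0.
pose B (e : {ffun I * J -> bool}) := 2 ^+ s + (2 ^+ s) ^- 5 * \sum_i a i e ^+ 6.
have a6 i e : 0 <= a i e ^+ 6 by rewrite exprn_even_ge0.
have aB i e : `|a i e| <= B e.
  have : a i e ^+ 6 <= \sum_i a i e ^+ 6 by rewrite (bigD1 i) //= lerDl sumr_ge0.
  rewrite -(ler_pM2l (_ : 0 < (2 ^+ s) ^- 5)) ?invr_gt0 ?exprn_gt0 //.
  rewrite /B; set Q := \sum_i _; move: s0; set l := 2 ^+ s => l0 h.
  have [ul|lu] := leP `|a i e| l.
    apply: (le_trans ul); rewrite lerDl mulr_ge0 ?invr_ge0 ?exprn_ge0 ?(ltW l0) //.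
    exact: sumr_ge0.
  apply: le_trans (_ : l ^- 5 * a i e ^+ 6 <= _); last first.
    by apply: le_trans h _; rewrite lerDr ltW.
  have -> : a i e ^+ 6 = `|a i e| ^+ 6 by rewrite -normrX ger0_norm.
  rewrite [X in _ * X]exprS mulrCA ler_peMr // -exprVn -exprMn exprn_ege1 //.
  by rewrite mulrC ler_pdivlMr // mul1r ltW.
apply: (@le_trans _ _ (avg (fun e => B e * Rad x))).
  apply: avg_le => e.
  rewrite (eq_Rad (y := fun i => (a i e)%:C *: x i)); last first.
    move=> i; congr (_ *: _); rewrite rmorph_sum; apply: eq_bigr => j _.
    by rewrite sign_C -rmorphM.
  apply: le_trans (Rad_le (b := fun=> B e) _ (fun i => aB i e)) _.
  by rewrite RadZ cmodr ger0_norm // addr_ge0 ?mulr_ge0 ?sumr_ge0 ?invr_ge0 ?exprn_ge0.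
under eq_avg => e do rewrite mulrC.
rewrite avgZ mulrC ler_wpM2r ?Rad_ge0 // /B avgD (avg_const [ffun=> false]) avgZ avg_sum.
have a15 i : avg (fun e => a i e ^+ 6) <= 15.
  pose c' (p : I * J) := if p.1 == i then c p.1 p.2 else 0.
  have -> : avg (fun e => a i e ^+ 6) =
      avg (fun e : {ffun I * J -> bool} => (\sum_p (-1) ^+ e p * c' p) ^+ 6).
    apply: eq_avg => e; congr (_ ^+ 6).
    rewrite /a -(sum_fst (fun p => (-1) ^+ e p * c p.1 p.2)) [LHS]big_mkcond.
    by apply: eq_bigr => p _; rewrite /c'; case: eqP => //; rewrite mulr0.
  apply: le_trans (moment6 _) _; rewrite -[leRHS]mulr1 ler_pM2l //.
  rewrite exprn_ile1 //; first by apply: sumr_ge0 => p _; apply: sqr_ge0.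
  apply: le_trans (cb i); rewrite -(sum_fst (fun p => c p.1 p.2 ^+ 2)).
  rewrite [leRHS]big_mkcond; apply: ler_sum => p _; rewrite /c'.
  by case: eqP => // _; rewrite expr0n.
have : \sum_i avg (fun e => a i e ^+ 6) <= 15 * 64 ^+ s.
  apply: le_trans (ler_sum _ (fun i _ => a15 i)) _.
  by rewrite sumr_const cardI -[15 *+ _]mulr_natr natrX.
move=> h; have -> : 16 * 2 ^+ s = 2 ^+ s + (2 ^+ s) ^- 5 * (15 * 64 ^+ s) :> R.
  have -> : 64 = 2 ^+ 6 :> R by rewrite -natrX.
  rewrite [2 ^+ 6 ^+ s]exprAC; move: s0; move: (2 ^+ s) => l l0; field.
  exact: lt0r_neq0.
by rewrite lerD2l ler_pM2l // invr_gt0 exprn_gt0.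
Qed.

End CopiesUpper.

(** ** Type and cotype in terms of Rademacher averages *)

Section TypeCotype.
Context {R : realType} {X : normedModType R[i]}.
Implicit Types (I J : finType).

Lemma expect_signs_avg N (F : sign_seq N -> R) : expect_signs F = avg F.
Proof. by rewrite /expect_signs /avg card_ffun card_bool card_ord natrX. Qed.

Definition sqsum I (x : I -> X) : R := Num.sqrt (\sum_i cnorm (x i) ^+ 2).

Lemma sqsum_ge0 I (x : I -> X) : 0 <= sqsum x.
Proof. exact: sqrtr_ge0. Qed.

Lemma sqr_sqsum I (x : I -> X) : sqsum x ^+ 2 = \sum_i cnorm (x i) ^+ 2.
Proof. by rewrite sqr_sqrtr // sumr_ge0 // => i _; apply: sqr_ge0. Qed.

Lemma sqsum_inj I J (s : J -> I) (y : I -> X) (z : J -> X) : injective s ->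
  (forall j, y (s j) = z j) -> (forall i, (forall j, s j != i) -> y i = 0) ->
  sqsum y = sqsum z.
Proof.
move=> sI yz y0; congr Num.sqrt.
rewrite (bigID (mem (codom s))) /= [X in _ + X]big1 ?addr0; last first.
  move=> i /negP ni; rewrite y0 ?cnorm0 ?expr0n // => j; apply/eqP => sj.
  by apply: ni; rewrite -sj codom_f.
transitivity (\sum_(i <- codom s) cnorm (y i) ^+ 2).
  by rewrite -big_uniq /=; [apply: eq_bigl | rewrite map_inj_uniq ?enum_uniq].
by rewrite big_map big_enum; apply: eq_bigr => j _; rewrite yz.
Qed.

Lemma Rad_le_L2 I (x : I -> X) :
  Rad x <= Num.sqrt (avg (fun e : {ffun I -> bool} => cnorm (rsum x e) ^+ 2)).
Proof.
rewrite -(ler_sqr (Rad_ge0 x)) ?nnegrE ?sqrtr_ge0 // sqr_sqrtr.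
  exact: (avg_sqr_le [ffun=> false]).
by apply: avg_ge0 => e; apply: sqr_ge0.
Qed.

Lemma L2_le_Rad I (x : I -> X) :
  Num.sqrt (avg (fun e : {ffun I -> bool} => cnorm (rsum x e) ^+ 2)) <= 2 * Rad x.
Proof.
have h0 := Rad_ge0 x; have h2 : 0 <= 2 * Rad x by rewrite mulr_ge0.
rewrite -(ler_sqr (sqrtr_ge0 _)) ?nnegrE // sqr_sqrtr.
  apply: le_trans (kahane x) _; have := sqr_ge0 (Rad x).
  by rewrite (_ : (2 * Rad x) ^+ 2 = 4 * Rad x ^+ 2); [lra|ring].
by apply: avg_ge0 => e; apply: sqr_ge0.
Qed.

Lemma type2_Rad : has_type2 X ->
  exists2 C : R, 0 <= C & forall I (x : I -> X), Rad x <= C * sqsum x.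
Proof.
move=> [C hC]; exists `|C| => // I x.
have eb : bijective (@enum_val I predT) by apply: enum_val_bij.
rewrite (Rad_bij x eb); apply: le_trans (Rad_le_L2 _) _.
have := hC #|I| (fun i => x (enum_val i)); rewrite expect_signs_avg => h.
apply: le_trans h _.
rewrite (_ : Num.sqrt _ = sqsum x) ?ler_wpM2r ?sqsum_ge0 ?ler_norm //.
by congr Num.sqrt; rewrite [RHS](reindex _ (onW_bij _ eb)).
Qed.

Lemma cotype2_Rad : has_cotype2 X ->
  exists2 C : R, 0 <= C & forall I (x : I -> X), sqsum x <= C * Rad x.
Proof.
move=> [C hC]; exists (2 * `|C|) => [|I x]; first by rewrite mulr_ge0.
have eb : bijective (@enum_val I predT) by apply: enum_val_bij.
have := hC #|I| (fun i => x (enum_val i)); rewrite expect_signs_avg.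
rewrite (_ : Num.sqrt (\sum_i _) = sqsum x); last first.
  by congr Num.sqrt; rewrite [RHS](reindex _ (onW_bij _ eb)).
move=> h; apply: le_trans h _; rewrite (Rad_bij x eb).
apply: le_trans (ler_wpM2r (sqrtr_ge0 _) (ler_norm C)) _.
by rewrite (mulrC 2) -mulrA ler_wpM2l // L2_le_Rad.
Qed.

Lemma type2P : (exists C : R, forall N (x : 'I_N -> X), Rad x <= C * sqsum x) ->
  has_type2 X.
Proof.
move=> [C hC]; exists (2 * C) => N x; rewrite expect_signs_avg.
by apply: le_trans (L2_le_Rad _) _; rewrite -mulrA ler_pM2l // hC.
Qed.

Lemma cotype2P : (exists2 C : R, 0 <= C & forall k (x : 'I_(2 ^ k) -> X),
  sqsum x <= C * Rad x) -> has_cotype2 X.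
Proof.
move=> [C C0 hC]; exists C => N x; rewrite expect_signs_avg.
have NK : (N <= 2 ^ N)%N by apply/ltnW/ltn_expl.
pose y (i : 'I_(2 ^ N)) : X := if insub (val i) is Some j then x j else 0.
have yx j : y (widen_ord NK j) = x j by rewrite /y /= valK.
have y0 i : (forall j, widen_ord NK j != i) -> y i = 0.
  rewrite /y; case: insubP => // j _ ji /(_ j)/eqP []; exact/val_inj.
have wI : injective (widen_ord NK).
  by move=> a b /(congr1 val) /= /val_inj.
have := hC N y; rewrite (sqsum_inj wI yx y0) (Rad_inj wI yx y0) => h.
apply: le_trans h _; rewrite ler_wpM2l //; exact: Rad_le_L2.
Qed.

Lemma sum_le_sqsum n (x : 'I_n -> X) : (\sum_i cnorm (x i)) ^+ 2 <= n%:R * sqsum x ^+ 2.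
Proof.
case: n x => [|n] x; first by rewrite big_ord0 expr0n mul0r.
have := avg_sqr_le (ord0 : 'I_n.+1) (fun i => cnorm (x i)).
rewrite sqr_sqsum /avg card_ord exprMn expr2 -mulrA ler_pM2l ?invr_gt0 ?ltr0n //.
by rewrite ler_pdivrMl ?ltr0n.
Qed.

(** Weak cotype leaves room: the cotype 2 constant may grow like the sixth root of
    the number of vectors. *)
Lemma sqsum_weak_cotype (C : R) : 0 <= C ->
  (forall s (x : 'I_(64 ^ s) -> X), sqsum x <= C * 2 ^+ s * Rad x) ->
  weak_cotype X C.
Proof.
move=> C0 hC s x.
have l0 : 0 <= \sum_k cnorm (x k) by apply: sumr_ge0 => i _; apply: cnorm_ge0.
have r0 : 0 <= C * 16 ^+ s * Rad x 
  by apply: mulr_ge0 (Rad_ge0 _); apply: mulr_ge0 => //; apply: exprn_ge0.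
rewrite -(@ler_sqr R) ?nnegrE //.
apply: le_trans (sum_le_sqsum _) _.
have -> : (C * 16 ^+ s * Rad x) ^+ 2 = (64 ^ s)%N%:R * (C * 2 ^+ s * Rad x) ^+ 2.
  have e64 : (64 : R) = 8 ^+ 2 by rewrite -natrX.
  have e16 : (16 : R) = 8 * 2 by rewrite -natrM.
  by rewrite natrX e64 e16 [(8 * 2) ^+ s]exprMn [8 ^+ 2 ^+ s]exprAC; ring.
rewrite ler_wpM2l // ler_sqr ?nnegrE ?sqsum_ge0 //.
by apply: mulr_ge0 (Rad_ge0 _); apply: mulr_ge0 => //; apply: exprn_ge0.
Qed.

Lemma cotype2_weak_cotype (C : R) : 0 <= C ->
  (forall I (x : I -> X), sqsum x <= C * Rad x) -> weak_cotype X C.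
Proof.
move=> C0 hC; apply: sqsum_weak_cotype => // s x.
apply: le_trans (hC _ x) _; rewrite ler_wpM2r ?Rad_ge0 // ler_peMr //.
by rewrite exprn_ege1 // ler1n.
Qed.

End TypeCotype.

(** * Independent copies and the central limit effect *)

Section Walks.
Context {R : realType} {X : normedModType R[i]}.
Implicit Types (I J B : finType).

Lemma Rad_copies_sqrt I J (c : I * J -> R[i]) (x : I -> X) :
  Rad (fun p => c p *: x p.1) <=
  \sum_i Num.sqrt (\sum_j cmod (c (i, j)) ^+ 2) * cnorm (x i).
Proof.
pose c' i (p : I * J) := if p.1 == i then c p else 0.
rewrite (eq_Rad (y := fun p => \sum_i c' i p *: x i)); last first.
  move=> p; rewrite (bigD1 p.1) //= /c' eqxx big1 ?addr0 // => i.
  by rewrite eq_sym => /negbTE ->; rewrite scale0r.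
apply: le_trans (Rad_sum _ _) _; apply: ler_sum => i _.
have -> : Rad (fun p => c' i p *: x i) =
    avg (fun e : {ffun I * J -> bool} => cmod (\sum_p (-1) ^+ e p * c' i p)) * cnorm (x i).
  rewrite mulrC -avgZ; apply: eq_avg => e; rewrite mulrC -cnormZ scaler_suml.
  by congr cnorm; apply: eq_bigr => p _; rewrite scalerA.
rewrite ler_wpM2r ?cnorm_ge0 //.
rewrite (_ : \sum_j cmod (c (i, j)) ^+ 2 = \sum_p cmod (c' i p) ^+ 2).
  rewrite -(moment2_c (c' i)).
  exact: (@Rad_le_L2 R (R[i]^o : normedModType R[i]) _ (c' i)).
rewrite -(sum_fst (fun p => cmod (c p) ^+ 2)) big_mkcond.
by apply: eq_bigr => p _; rewrite /c'; case: eqP => //; rewrite cmod0 expr0n.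
Qed.

Definition copies K I (x : I -> X) : R := Rad (fun p : I * 'I_K => x p.1).

(** Sums of independent signs of length [m i] in the direction of [x i]; the value
    is the same for every [K] that is at least all [m i]. *)
Definition walks K I (m : I -> nat) (x : I -> X) : R :=
  Rad (fun p : I * 'I_K => (p.2 < m p.1)%N%:R%:C *: x p.1).

Lemma walks_cst K K' I (x : I -> X) : (K' <= K)%N ->
  walks K (fun=> K') x = copies K' x.
Proof.
move=> le; apply: (@Rad_inj _ _ _ _ (fun p => (p.1, widen_ord le p.2))).
- by move=> [a k] [b l] [-> /val_inj ->].
- by move=> [a k] /=; rewrite ltn_ord scale1r.
move=> [a k] h /=; case: ltnP => [kK'|_]; last by rewrite scale0r.
by case/eqP: (h (a, Ordinal kK')); congr pair; apply: val_inj.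
Qed.

(** The average depends on a family with repetitions only through the number of
    times that each vector occurs. *)
Lemma walks_fibres K I J (f : J -> I) (x : I -> X) :
  (forall i, #|[pred j | f j == i]| <= K)%N ->
  Rad (fun j => x (f j)) = walks K (fun i => #|[pred j | f j == i]|) x.
Proof.
move=> hK; pose F i := enum [pred j | f j == i].
have jF j : j \in F (f j) by rewrite mem_enum inE eqxx.
have lt j : (index j (F (f j)) < K)%N.
  by apply: leq_trans (hK (f j)); rewrite cardE index_mem jF.
symmetry; apply: (@Rad_inj _ _ _ _ (fun j => (f j, Ordinal (lt j)))).
- move=> j j' [ff E]; rewrite -[LHS](nth_index j (jF j)) E ff nth_index //.
- by move=> j /=; rewrite cardE index_mem jF scale1r.
move=> [i k] h /=; case: ltnP => [ki|_]; last by rewrite scale0r.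
rewrite cardE in ki; have [j0 _] : exists j0 : J, true.
  by case: (enum _) ki => [//|j0 ? _]; exists j0.
pose j := nth j0 (F i) k.
have : j \in F i by rewrite mem_nth.
rewrite mem_enum inE => /eqP fj.
case/eqP: (h j); rewrite {1}fj; congr pair; apply: val_inj => /=.
by rewrite fj index_uniq // enum_uniq.
Qed.

Lemma sum_lt_diff K m m' : (m <= K)%N -> (m' <= K)%N ->
  \sum_(k < K) ((k < m)%N%:R - (k < m')%N%:R) ^+ 2 = `|m%:R - m'%:R| :> R.
Proof.
wlog mm' : m m' / (m' <= m)%N.
  move=> h hm hm'; have [|/ltnW] := leqP m' m; first by move=> /h; apply.
  move=> /h/(_ hm' hm); rewrite distrC => <-; apply: eq_bigr => k _.
  by rewrite -sqrrN opprB.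
move=> hm hm'; rewrite ger0_norm ?subr_ge0 ?ler_nat //.
have S n : (n <= K)%N -> \sum_(k < K) (k < n)%N%:R = n%:R :> R.
  move=> nK; rewrite (eq_bigr (fun k : 'I_K => if (k < n)%N then 1 else 0)).
    rewrite -big_mkcond /= -(big_ord_widen _ (fun=> 1)) //.
    by rewrite sumr_const card_ord.
  by move=> k _; case: ltnP.
rewrite -[in RHS](S m) // -[in RHS](S m') // -sumrB; apply: eq_bigr => k _.
case: ltnP => km; case: ltnP => km'; rewrite ?subrr ?expr0n ?subr0 ?expr1n //.
by have := leq_trans km' (leq_trans mm' km); rewrite ltnn.
Qed.

Lemma walks_le K I (m m' : I -> nat) (x : I -> X) :
  (forall i, m i <= K)%N -> (forall i, m' i <= K)%N ->
  walks K m x <= walks K m' x + \sum_i Num.sqrt `|(m i)%:R - (m' i)%:R| * cnorm (x i).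
Proof.
move=> hm hm'.
pose c (p : I * 'I_K) : R := (p.2 < m p.1)%N%:R - (p.2 < m' p.1)%N%:R.
rewrite /walks (eq_Rad (y := fun p : I * 'I_K => (p.2 < m' p.1)%N%:R%:C *: x p.1 + (c p)%:C *: x p.1)).
  apply: le_trans (RadD _ _) _; rewrite lerD2l.
  apply: le_trans (Rad_copies_sqrt _ _) _; apply: ler_sum => i _.
  rewrite ler_wpM2r ?cnorm_ge0 // -(sum_lt_diff (hm i) (hm' i)).
  rewrite le_eqVlt; apply/orP; left; apply/eqP; congr Num.sqrt.
  by apply: eq_bigr => k _; rewrite cmodr real_normK ?num_real.
by move=> p; rewrite -scalerDl -rmorphD /= /c addrC subrK.
Qed.

Definition hadamard B (z : B * bool -> X) (p : B * bool) : X :=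
  z (p.1, false) + (-1) ^+ p.2 *: z (p.1, true).

Lemma sum_pair (V : nmodType) (T U : finType) (F : T * U -> V) :
  \sum_p F p = \sum_t \sum_u F (t, u).
Proof. by rewrite pair_bigA; apply: eq_bigr => -[]. Qed.

Lemma avg_pair (T U : finType) (F : T * U -> R) :
  avg F = avg (fun t => avg (fun u => F (t, u))).
Proof.
rewrite /avg card_prod natrM invfM -mulr_sumr mulrA; congr (_ * _).
by rewrite sum_pair.
Qed.

(** Two independent signs [e0], [e1] satisfy
    [e0 * (u + v) + e1 * (u - v) = 2 * e0 * w] with [w = u] if they agree and
    [w = v] otherwise; so the transformed family behaves like copies of the
    family itself in random numbers. *)
Lemma copies_hadamard B K (z : B * bool -> X) :
  copies K (hadamard z) = avg (fun d : {ffun B * 'I_K -> bool} =>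
    2 * Rad (fun q : B * 'I_K => z (q.1, d q))).
Proof.
pose h (w : {ffun B * 'I_K -> bool} * {ffun B * 'I_K -> bool}) :
    {ffun (B * bool) * 'I_K -> bool} :=
  [ffun p => w.2 (p.1.1, p.2) (+) (p.1.2 && w.1 (p.1.1, p.2))].
rewrite /copies /Rad (@avg_bij _ _ _ h); last first.
  exists (fun e : {ffun (B * bool) * 'I_K -> bool} =>
    ([ffun q => e ((q.1, false), q.2) (+) e ((q.1, true), q.2)],
     [ffun q => e ((q.1, false), q.2)])).
    move=> [d e]; congr pair; apply/ffunP => -[b k]; rewrite !ffunE /=.
      by rewrite addbF addKb.
    by rewrite addbF.
  move=> e; apply/ffunP => -[[b d] k]; rewrite !ffunE /=.
  by case: d; rewrite /= ?addbF // addKb.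
rewrite avg_pair; apply: eq_avg => d; rewrite -avgZ; apply: eq_avg => e.
have -> : 2 = cmod (2%:R : R[i]) by rewrite -(rmorph_nat (real_complex R)) cmodr ger0_norm.
rewrite -cnormZ; congr cnorm; rewrite /rsum scaler_sumr.
rewrite !sum_pair; apply: eq_bigr => b _; rewrite big_bool /= -big_split; apply: eq_bigr => k _ /=.
rewrite !ffunE /= addbF signr_addb -scalerA -scalerDr scalerA [2%:R * _]mulrC -scalerA.
congr (_ *: _); rewrite /hadamard /= expr1 expr0 scale1r scaleN1r scaler_nat mulr2n.
case: (d _); rewrite ?expr1 ?expr0 ?scale1r ?scaleN1r.
  by rewrite opprB [z (b, false) + _]addrC addrACA addNr addr0.
by rewrite addrACA addNr addr0.
Qed.

(** The number of occurrences is binomial with mean [K] and variance [K / 2]. *)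
Lemma avg_dev K B b c : avg (fun d : {ffun B * 'I_(2 * K) -> bool} =>
    `|#|[pred q : B * 'I_(2 * K) | (q.1, d q) == (b, c)]|%:R - K%:R|) <=
  Num.sqrt K%:R :> R.
Proof.
rewrite -(@ler_sqr R) ?nnegrE ?sqrtr_ge0 ?avg_ge0 // sqr_sqrtr //.
apply: le_trans (avg_sqr_le [ffun=> false] _) _.
pose a (q : B * 'I_(2 * K)) : R := if q.1 == b then 2^-1 else 0.
have suma2 : \sum_q a q ^+ 2 = K%:R / 2.
  rewrite (eq_bigr (fun q : B * 'I_(2 * K) => if q.1 == b then 2^-1 ^+ 2 else 0)).
    rewrite -big_mkcond (sum_fst (fun _ => 2^-1 ^+ 2)) sumr_const card_ord.
    by rewrite -[_ *+ (2 * K)]mulr_natl natrM; field.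
  by move=> q _; rewrite /a; case: eqP => // _; rewrite expr0n.
apply: (@le_trans _ _ (K%:R / 2)); last first.
  by rewrite ler_pdivrMr // ler_peMr // ler1n.
rewrite -suma2 -moment2 le_eqVlt; apply/orP; left; apply/eqP.
apply: eq_avg => d; rewrite real_normK ?num_real //.
have card_sum : #|[pred q : B * 'I_(2 * K) | (q.1, d q) == (b, c)]|%:R =
    \sum_(q : B * 'I_(2 * K) | q.1 == b) (2^-1 + (-1) ^+ c * ((-1) ^+ d q * 2^-1)) :> R.
  rewrite -sum1_card natr_sum.
  rewrite [LHS](eq_bigl (fun q => (q.1 == b) && (d q == c))) //.
  rewrite big_mkcondr; apply: eq_bigr => q _.
  by case: (d q); case: c => /=; rewrite ?expr1 ?expr0; lra.
have -> : #|[pred q : B * 'I_(2 * K) | (q.1, d q) == (b, c)]|%:R - K%:R =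
    (-1) ^+ c * \sum_q (-1) ^+ d q * a q.
  rewrite card_sum big_split /= (sum_fst (fun=> 2^-1)) sumr_const card_ord.
  rewrite -mulr_sumr [in RHS](eq_bigr (fun q => if q.1 == b then (-1) ^+ d q * 2^-1 else 0)).
    by rewrite -[in RHS]big_mkcond -[2^-1 *+ _]mulr_natl natrM mulrAC divff // mul1r addrC addrK.
  by move=> q _; rewrite /a; case: eqP; rewrite ?mulr0.
by rewrite exprMn sqrr_sign mul1r.
Qed.

End Walks.

Section Hadamard.
Context {R : realType} {X : normedModType R[i]}.
Implicit Types (I J B : finType).

Lemma copies_bij K I J (s : J -> I) (x : I -> X) : bijective s ->
  copies K x = copies K (fun j => x (s j)).
Proof.
move=> [t st ts]; apply: (@Rad_bij _ _ _ _ (fun p => (s p.1, p.2))).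
by exists (fun p => (t p.1, p.2)) => -[a k] /=; rewrite ?st ?ts.
Qed.

Lemma eq_copies K I (x y : I -> X) : x =1 y -> copies K x = copies K y.
Proof. by move=> h; apply: eq_Rad => p. Qed.

Lemma sqrt_le_affine (a u : R) : 0 < a -> 0 <= u -> Num.sqrt u <= u / a + a.
Proof.
move=> a0 u0; have [h|h] := leP (Num.sqrt u) a.
  by apply: (le_trans h); rewrite lerDr divr_ge0 // ltW.
apply: le_trans (_ : u / a <= _); last by rewrite lerDl ltW.
by rewrite ler_pdivlMr // -[leRHS](sqr_sqrtr u0) expr2 ler_wpM2l ?sqrtr_ge0 // ltW.
Qed.

Lemma copies_hadamard_le B K (z : B * bool -> X) (a : R) : 0 < a ->
  copies (2 * K)%N (hadamard z) <=
  2 * copies K z + 2 * (Num.sqrt K%:R / a + a) * \sum_p cnorm (z p).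
Proof.
move=> a0; rewrite copies_hadamard avgZ -mulrA -mulrDr ler_pM2l //.
pose f (d : {ffun B * 'I_(2 * K) -> bool}) (q : B * 'I_(2 * K)) := (q.1, d q).
pose m d p := #|[pred q | f d q == p]|.
have hm d p : (m d p <= 2 * K)%N.
  rewrite /m; apply: (@leq_trans #|[pred q : B * 'I_(2 * K) | q.1 == p.1]|).
    by apply/subset_leq_card/fintype.subsetP => q; rewrite !inE => /eqP <-.
  by rewrite -sum1_card (sum_fst (fun=> 1%N)) sum1_card card_ord.
have step d : Rad (fun q => z (f d q)) <=
    copies K z + \sum_p Num.sqrt `|(m d p)%:R - K%:R| * cnorm (z p).
  rewrite (walks_fibres z (hm d)) -(@walks_cst _ _ (2 * K)%N); last by lia.
  by apply: walks_le (hm d) _ => p; lia.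
apply: le_trans (avg_le step) _.
rewrite avgD (avg_const [ffun=> false]) lerD2l avg_sum mulr_sumr.
apply: ler_sum => p _; under eq_avg => d do rewrite mulrC.
rewrite avgZ mulrC ler_wpM2r ?cnorm_ge0 //.
apply: (@le_trans _ _ (avg (fun d => a^-1 * `|(m d p)%:R - K%:R| + a))).
  by apply: avg_le => d; rewrite mulrC; apply: sqrt_le_affine.
rewrite avgD (avg_const [ffun=> false]) lerD2r avgZ mulrC ler_wpM2r ?invr_ge0 ?(ltW a0) //.
by case: p => b c; apply: avg_dev.
Qed.

Lemma sqrt_large (c d : R) : 0 < d ->
  exists K0, forall K, (K0 <= K)%N -> c <= d * Num.sqrt K%:R.
Proof.
move=> d0; exists (Num.bound ((c / d) ^+ 2)) => K hK.
rewrite mulrC -ler_pdivrMr //; apply: le_trans (ler_norm _) _.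
rewrite -sqrtr_sqr ler_wsqrtr //; apply/ltW.
apply: (lt_le_trans (archi_boundP (sqr_ge0 _))).
by rewrite ler_nat.
Qed.

(** The numbers of copies differ from their mean by about the square root of [K],
    and the error in the average is a sum of square roots of these
    differences. *)
Lemma copies_hadamard_asymp B (z : B * bool -> X) (d : R) : 0 < d ->
  exists K0, forall K, (K0 <= K)%N ->
  copies (2 * K)%N (hadamard z) <= 2 * copies K z + d * Num.sqrt K%:R.
Proof.
move=> d0; pose S := \sum_p cnorm (z p) + 1.
have S0 : 0 < S by rewrite ltr_wpDl // sumr_ge0 // => p _; apply: cnorm_ge0.
have a0 : 0 < 4 * S / d by rewrite divr_gt0 // mulr_gt0.
have d2 : 0 < d / 2 by rewrite divr_gt0.
have [K0 hK0] := sqrt_large (2 * S * (4 * S / d)) d2.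
exists K0 => K /hK0 hK; apply: le_trans (copies_hadamard_le K z a0) _.
rewrite lerD2l; have q0 := sqrtr_ge0 (K%:R : R).
apply: (@le_trans _ _ (2 * (Num.sqrt K%:R / (4 * S / d) + 4 * S / d) * S)).
  by rewrite ler_wpM2l ?lerDl // mulr_ge0 // addr_ge0 ?divr_ge0 // ltW ?mulr_gt0.
move: hK q0; set q := Num.sqrt _ => hK q0.
have -> : 2 * (q / (4 * S / d) + 4 * S / d) * S = d / 2 * q + 2 * S * (4 * S / d).
  by field; rewrite !lt0r_neq0.
by have -> : d * q = d / 2 * q + d / 2 * q; [field|rewrite lerD2l].
Qed.

End Hadamard.

Section Phases.
Context {R : realType} {X : normedModType R[i]}.
Implicit Types (I J B : finType).
(* The copies of each vector carry all powers of [w] as phases; multiplying a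
   vector by a power of [w] then only permutes its copies. *)
Variables (w : R[i]) (L : nat).
Hypothesis wL : w ^+ L.+1 = 1.

Definition phased I (x : I -> X) (p : I * 'I_L.+1) : X := w ^+ p.2 *: x p.1.

Definition pcopies K I (x : I -> X) : R := copies K (phased x).

Lemma pcopies_bij K I J (s : J -> I) (x : I -> X) : bijective s ->
  pcopies K x = pcopies K (fun j => x (s j)).
Proof.
move=> [t st ts]; apply: (@copies_bij _ _ _ _ _ (fun p => (s p.1, p.2))).
by exists (fun p => (t p.1, p.2)) => -[a k] /=; rewrite ?st ?ts.
Qed.

Lemma eq_pcopies K I (x y : I -> X) : x =1 y -> pcopies K x = pcopies K y.
Proof. by move=> h; apply: eq_copies => p; rewrite /phased h. Qed.

Lemma pcopies_phase K I (a : I -> nat) (x : I -> X) :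
  pcopies K (fun i => w ^+ a i *: x i) = pcopies K x.
Proof.
symmetry; rewrite /pcopies.
rewrite (@copies_bij _ _ _ _ _ (fun p => (p.1, p.2 + inZp (a p.1)))).
  apply: eq_copies => -[i l]; rewrite /phased /= scalerA -exprD.
  by rewrite (expr_mod _ wL) exprD (expr_mod _ wL) -exprD.
by exists (fun p => (p.1, p.2 - inZp (a p.1))) => -[i l] /=; rewrite ?addrK ?subrK.
Qed.

Lemma pcopies_hadamard B (x : B * bool -> X) (d : R) : 0 < d ->
  exists K0, forall K, (K0 <= K)%N ->
  pcopies (2 * K)%N (hadamard x) <= 2 * pcopies K x + d * Num.sqrt K%:R.
Proof.
move=> d0; pose z (p : (B * 'I_L.+1) * bool) := w ^+ p.1.2 *: x (p.1.1, p.2).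
pose s (p : (B * 'I_L.+1) * bool) := ((p.1.1, p.2), p.1.2).
have sb : bijective s by exists (fun p => ((p.1.1, p.2), p.1.2)) => -[[]].
have [K0 hK] := copies_hadamard_asymp z d0; exists K0 => K /hK.
have -> : pcopies (2 * K)%N (hadamard x) = copies (2 * K)%N (hadamard z).
  rewrite /pcopies (copies_bij _ _ sb); apply: eq_copies => -[[b l] c].
  by rewrite /phased /hadamard /z /= scalerDr !scalerA mulrC.
have -> // : pcopies K x = copies K z.
by rewrite /pcopies (copies_bij _ _ sb).
Qed.

Lemma pcopiesZ K I (a : R[i]) (x : I -> X) :
  pcopies K (fun i => a *: x i) = cmod a * pcopies K x.
Proof.
rewrite /pcopies /copies -RadZ; apply: eq_Rad => p.
by rewrite /phased !scalerA mulrC.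
Qed.

End Phases.

(** * The fast Fourier transform *)

Definition dyadic_root (R : realType) (k : nat) (r : R[i]) : Prop :=
  if k is k'.+1 then r ^+ (2 ^ k') = -1 else r = 1.

Section DyadicRoots.
Context {R : realType}.

Lemma dyadic_root_expr k (r : R[i]) : dyadic_root k r -> r ^+ (2 ^ k) = 1.
Proof.
case: k => [->//|k] /= h.
by rewrite expnS mulnC exprM h sqrrN expr1n.
Qed.

Lemma dyadic_root_prim k (r : R[i]) : dyadic_root k r -> (2 ^ k).-primitive_root r.
Proof.
move=> h; have [m pm] := prim_order_exists (expn_gt0 2 k) (dyadic_root_expr h).
case/(dvdn_pfactor _ _ (isT : prime 2)) => j jk mE; rewrite mE in pm.
case: k h jk {mE} => [|k] /= h jk; first by move: jk pm; rewrite leqn0 => /eqP ->.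
move: jk; rewrite leq_eqVlt => /orP[/eqP <- //|]; rewrite ltnS => jk.
have : r ^+ (2 ^ k) = 1.
  by rewrite -(subnK jk) addnC expnD exprM (prim_expr_order pm) expr1n.
move/eqP; rewrite h eqr_oppLR => /eqP h1.
have : (2%:R : R[i]) == 0 by rewrite mulr2n {1}h1 addNr.
by rewrite pnatr_eq0.
Qed.

Lemma dyadic_root_exists k : exists r : R[i], dyadic_root k r.
Proof.
case: k => [|k]; first by exists 1.
elim: k => [|k [r hr]]; first by exists (-1).
by exists (sqrtC r); rewrite /= expnS exprM sqrtCK.
Qed.

Lemma cmod_root n (r : R[i]) : r ^+ n.+1 = 1 -> cmod r = 1.
Proof.
move=> h; apply/eqP; rewrite -(@pexpr_eq1 _ _ n.+1) ?cmod_ge0 //.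
by rewrite -cmodX h cmod1.
Qed.

Lemma dyadic_root_cmod k (r : R[i]) : dyadic_root k r -> cmod r = 1.
Proof.
move=> /dyadic_root_expr; rewrite -[(2 ^ k)%N]prednK ?expn_gt0 //.
exact: cmod_root.
Qed.

Lemma prim_root_sum n (r : R[i]) (a b : nat) : n.-primitive_root r ->
  \sum_(j < n) r ^+ (j * a) * r ^- (j * b) = (if a == b %[mod n] then n%:R else 0).
Proof.
move=> pr; have r0 : r != 0.
  apply/eqP => r0; have := prim_expr_order pr; rewrite r0 expr0n.
  by rewrite gtn_eqF ?(prim_order_gt0 pr) // => /esym/eqP; rewrite oner_eq0.
pose u := r ^+ a / r ^+ b.
under eq_bigr => j _ do rewrite !(mulnC j) !exprM -expr_div_n -/u.
rewrite -(eq_prim_root_expr pr); case: eqP => [e|ne].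
  have -> : u = 1 by rewrite /u e divff // expf_neq0.
  by under eq_bigr => j _ do rewrite expr1n; rewrite sumr_const card_ord.
have u1 : u - 1 != 0.
  rewrite subr_eq0; apply/eqP => u1; apply: ne.
  by rewrite -[LHS](divfK (expf_neq0 b r0)) -/u u1 mul1r.
apply: (mulfI u1); rewrite mulr0 -subrX1 /u expr_div_n -!exprM ![(_ * n)%N]mulnC.
by rewrite !exprM (prim_expr_order pr) !expr1n divr1 subrr.
Qed.

End DyadicRoots.

Fixpoint bits (k : nat) : finType :=
  if k is k'.+1 then (bool * bits k')%type : finType else unit : finType.

(** The two numberings of [bits k] by the integers below [2 ^ k], with the first
    bit the highest, respectively the lowest. *)
Fixpoint val_hi k : bits k -> nat :=
  if k is k'.+1 then fun j : bool * bits k' => (val_hi j.2 + j.1 * 2 ^ k')%N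
  else fun _ => 0%N.

Fixpoint val_lo k : bits k -> nat :=
  if k is k'.+1 then fun n : bool * bits k' => (n.1 + 2 * val_lo n.2)%N
  else fun _ => 0%N.

Section Bits.

Lemma card_bits k : #|bits k| = (2 ^ k)%N.
Proof. by elim: k => [|k IH]; rewrite ?card_unit // card_prod card_bool IH expnS. Qed.

Lemma val_hi_lt k (j : bits k) : (val_hi j < 2 ^ k)%N.
Proof.
elim: k j => [//|k IH] [b j] /=; rewrite expnS.
by have := IH j; case: b; lia.
Qed.

Lemma val_lo_lt k (j : bits k) : (val_lo j < 2 ^ k)%N.
Proof.
elim: k j => [//|k IH] [b j] /=; rewrite expnS.
by have := IH j; case: b; lia.
Qed.

Lemma val_hi_inj k : injective (@val_hi k).
Proof.
elim: k => [[] []//|k IH] [b j] [b' j'] /=.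
have := val_hi_lt j; have := val_hi_lt j'.
by case: b; case: b' => /= h h' e; try lia; congr pair; apply: IH; lia.
Qed.

Lemma val_lo_inj k : injective (@val_lo k).
Proof.
elim: k => [[] []//|k IH] [b j] [b' j'] /=.
by case: b; case: b' => /= e; try lia; congr pair; apply: IH; lia.
Qed.

Definition ord_hi k (j : bits k) : 'I_(2 ^ k) := Ordinal (val_hi_lt j).
Definition ord_lo k (j : bits k) : 'I_(2 ^ k) := Ordinal (val_lo_lt j).

Lemma ord_hi_bij k : bijective (@ord_hi k).
Proof.
apply: inj_card_bij => [a b /(congr1 val)/val_hi_inj //|].
by rewrite card_ord card_bits.
Qed.

Lemma ord_lo_bij k : bijective (@ord_lo k).
Proof.
apply: inj_card_bij => [a b /(congr1 val)/val_lo_inj //|].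
by rewrite card_ord card_bits.
Qed.

End Bits.

Section FFT.
Context {R : realType} {X : normedModType R[i]}.
Implicit Types (I J B : finType).

Definition dft_bits (r : R[i]) k B (x : B * bits k -> X) (p : B * bits k) : X :=
  \sum_n r ^+ (val_hi p.2 * val_lo n) *: x (p.1, n).

(** One step of the fast Fourier transform: transforms of half the length, a
    multiplication by phases, and a Hadamard transform. *)
Lemma dft_bits_step (r : R[i]) k B (x : B * bits k.+1 -> X) (b : B) (d : bool)
    (j : bits k) : r ^+ (2 ^ k) = -1 ->
  dft_bits r x (b, (d, j)) =
  hadamard (fun p : (B * bits k) * bool => r ^+ (p.2 * val_hi p.1.2) *:
     dft_bits (r ^+ 2) (fun q : (B * bool) * bits k => x (q.1.1, (q.1.2, q.2)))
       ((p.1.1, p.2), p.1.2)) ((b, j), d).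
Proof.
move=> hr; rewrite /hadamard /dft_bits /= sum_pair big_bool /= addrC.
rewrite mul0n expr0 scale1r mul1n; congr +%R.
  apply: eq_bigr => n _; congr (_ *: _); rewrite add0n -exprM.
  rewrite mulnDl exprD [X in _ * X](_ : _ = 1); last first.
    rewrite (_ : _ * _ = 2 ^ k * 2 * (d * val_lo n))%N; last by ring.
    by rewrite !exprM hr sqrrN !expr1n.
  by rewrite mulr1; congr (_ ^+ _); ring.
rewrite !scaler_sumr; apply: eq_bigr => n _; rewrite !scalerA; congr (_ *: _).
rewrite -exprM -exprD.
have -> : ((val_hi j + d * 2 ^ k) * (1 + 2 * val_lo n) =
  2 ^ k * d + (val_hi j + 2 * (val_hi j * val_lo n)) + 2 ^ k * 2 * (d * val_lo n))%N by ring.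
rewrite exprD [X in _ * X](_ : _ = 1); last by rewrite !exprM hr sqrrN !expr1n.
by rewrite mulr1 exprD exprM hr.
Qed.

(** The number of copies doubles with each step while the average is multiplied by
    2, as for Gaussian sums, where the Hadamard transform and the doubling of the
    variance each contribute the square root of 2. *)
Lemma fft_bits (w : R[i]) L (wL : w ^+ L.+1 = 1) k (r : R[i]) (a : nat) :
  dyadic_root k r -> r = w ^+ a ->
  forall B (x : B * bits k -> X) (d : R), 0 < d ->
  exists K0, forall K, (K0 <= K)%N ->
  pcopies w L (2 ^ k * K)%N (dft_bits r x) <=
  2 ^+ k * pcopies w L K x + d * Num.sqrt K%:R.
Proof.
elim: k r a => [|k IH] r a hr ra B x d d0.
  exists 0%N => K _; rewrite mul1n expr0 mul1r (eq_pcopies _ _ _ (y := x)).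
    by rewrite lerDl mulr_ge0 ?sqrtr_ge0 // ltW.
  move=> [b []]; rewrite /dft_bits /= (big_pred1 tt) ?expr0 ?scale1r //.
have hr2 : dyadic_root k (r ^+ 2).
  case: (k) hr => [/=|k']; first by rewrite expn0 expr1 => ->; rewrite sqrrN expr1n.
  by rewrite /= expnS exprM.
have ra2 : r ^+ 2 = w ^+ (a * 2) by rewrite ra exprM.
pose x' (q : (B * bool) * bits k) := x (q.1.1, (q.1.2, q.2)).
pose u := dft_bits (r ^+ 2) x'.
pose z (p : (B * bits k) * bool) := r ^+ (p.2 * val_hi p.1.2) *: u ((p.1.1, p.2), p.1.2).
have p2 : 0 < 2 ^+ k :> R by rewrite exprn_gt0.
have [K1 h1] := pcopies_hadamard w L z (divr_gt0 d0 (mulr_gt0 (ltr0n R 2) p2)).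
have [K2 h2] := IH _ _ hr2 ra2 _ x' _ (divr_gt0 d0 (ltr0n R 4)).
exists (maxn K1 K2) => K; rewrite geq_max => /andP[hK1 hK2].
have -> : pcopies w L (2 ^ k.+1 * K)%N (dft_bits r x) =
    pcopies w L (2 * (2 ^ k * K))%N (hadamard z).
  pose s (p : (B * bits k) * bool) : B * bits k.+1 := (p.1.1, (p.2, p.1.2)).
  have sb : bijective s.
    by exists (fun p : B * bits k.+1 => ((p.1, p.2.2), p.2.1)) => [[[]]|[? []]].
  rewrite expnS -mulnA (pcopies_bij _ _ _ _ sb); apply: eq_pcopies => -[[b j] c].
  exact: dft_bits_step.
have zu : pcopies w L (2 ^ k * K)%N z = pcopies w L (2 ^ k * K)%N u.
  pose s (p : (B * bits k) * bool) : (B * bool) * bits k := ((p.1.1, p.2), p.1.2).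
  have sb : bijective s.
    by exists (fun p : (B * bool) * bits k => ((p.1.1, p.2), p.1.2)) => [[[]]|[[]]].
  rewrite [RHS](pcopies_bij _ _ _ _ sb).
  rewrite -[RHS](pcopies_phase wL _ (fun p : (B * bits k) * bool => a * (p.2 * val_hi p.1.2))%N).
  by apply: eq_pcopies => p; rewrite /z [in RHS]exprM -ra.
have xx' : pcopies w L K x = pcopies w L K x'.
  pose s (q : (B * bool) * bits k) : B * bits k.+1 := (q.1.1, (q.1.2, q.2)).
  have sb : bijective s.
    by exists (fun p : B * bits k.+1 => ((p.1, p.2.1), p.2.2)) => [[[]]|[? []]].
  by rewrite (pcopies_bij _ _ _ _ sb).
have hK1' : (K1 <= 2 ^ k * K)%N by apply: (leq_trans hK1); rewrite leq_pmull ?expn_gt0.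
apply: le_trans (h1 _ hK1') _; rewrite zu xx'.
have := h2 _ hK2; rewrite -/u.
have : Num.sqrt (2 ^ k * K)%N%:R <= 2 ^+ k * Num.sqrt K%:R :> R.
  rewrite natrM sqrtrM // ler_wpM2r ?sqrtr_ge0 //.
  rewrite natrX -[leRHS](ger0_norm (ltW p2)) -sqrtr_sqr ler_wsqrtr //.
  by rewrite expr2 ler_peMr ?(ltW p2) // exprn_ege1 // ler1n.
rewrite exprS; set U := pcopies _ _ _ _; set V := pcopies _ _ _ _.
move: (2 ^+ k) p2 => p p0; set q := Num.sqrt _; set q' := Num.sqrt _ => hq hU.
have : d / (2 * p) * q <= d / (2 * p) * (p * q').
  by rewrite ler_wpM2l // divr_ge0 ?mulr_ge0 // ltW.
have -> : d / (2 * p) * (p * q') = d / 2 * q' by field; rewrite lt0r_neq0.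
have -> : d / 2 * q' = d * q' / 2 by ring.
move: hU; have -> : d / 4 * q' = d * q' / 4 by ring.
by move=> hU hq'; lra.
Qed.

Definition dft (r : R[i]) k (x : 'I_(2 ^ k) -> X) (j : 'I_(2 ^ k)) : X :=
  \sum_(n < 2 ^ k) r ^+ (j * n) *: x n.

Lemma fft (k : nat) (r : R[i]) L (w : R[i]) (a : nat) (x : 'I_(2 ^ k) -> X) (d : R) :
  w ^+ L.+1 = 1 -> dyadic_root k r -> r = w ^+ a -> 0 < d ->
  exists K0, forall K, (K0 <= K)%N ->
  pcopies w L (2 ^ k * K)%N (dft r x) <= 2 ^+ k * pcopies w L K x + d * Num.sqrt K%:R.
Proof.
move=> wL hr ra d0; pose x' (p : unit * bits k) := x (ord_lo p.2).
have [K0 hK] := fft_bits wL hr ra x' d0; exists K0 => K /hK.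
have hi : bijective (fun p : unit * bits k => ord_hi p.2).
  have [g hg gh] := ord_hi_bij k; exists (fun i => (tt, g i)) => [[[] b]|i] /=.
    by rewrite hg.
  by rewrite gh.
have lo : bijective (fun p : unit * bits k => ord_lo p.2).
  have [g hg gh] := ord_lo_bij k; exists (fun i => (tt, g i)) => [[[] b]|i] /=.
    by rewrite hg.
  by rewrite gh.
rewrite (pcopies_bij _ _ K x lo) (pcopies_bij _ _ _ (dft r x) hi).
rewrite (eq_pcopies _ _ _ (y := fun p => dft r x (ord_hi p.2))) // => p.
rewrite /dft_bits /dft [RHS](reindex (@ord_lo k)) //.
exact/onW_bij/ord_lo_bij.
Qed.

Lemma dft_inv k (r : R[i]) (x : 'I_(2 ^ k) -> X) (m : 'I_(2 ^ k)) : dyadic_root k r ->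
  dft r^-1 (dft r x) m = 2 ^+ k *: x m.
Proof.
move=> /dyadic_root_prim pr; rewrite /dft.
under eq_bigr => j _ do rewrite scaler_sumr.
rewrite exchange_big /=.
transitivity (\sum_n (if n == m then 2 ^+ k else 0) *: x n); last first.
  rewrite (bigD1 m) //= eqxx big1 ?addr0 // => n /negbTE ->.
  by rewrite scale0r.
apply: eq_bigr => n _; under eq_bigr => j _ do rewrite scalerA.
rewrite -scaler_suml; congr (_ *: _).
under eq_bigr => j _ do rewrite mulrC (mulnC m) exprVn.
rewrite (prim_root_sum _ _ pr) !modn_small // -natrX; congr (if _ then _ else _).
Qed.

Lemma dyadic_rootV k (r : R[i]) : dyadic_root k r -> dyadic_root k r^-1.
Proof.
case: k => [/= ->|k /= h]; first by rewrite invr1.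
by rewrite exprVn h invrN1.
Qed.

Lemma copies_assoc I J K (x : I -> X) (c : J -> R[i]) :
  Rad (fun p : (I * J) * 'I_K => c p.1.2 *: x p.1.1) =
  Rad (fun p : I * (J * 'I_K) => c p.2.1 *: x p.1).
Proof.
apply: (@Rad_bij _ _ _ _ (fun p : I * (J * 'I_K) => ((p.1, p.2.1), p.2.2))).
by exists (fun p => (p.1.1, (p.1.2, p.2))) => [[? []]|[[]]].
Qed.

Section PCopiesBounds.
Variables (w : R[i]) (L : nat).
Hypothesis wL : w ^+ L.+1 = 1.

Let w1 l : cmod (w ^+ l) = 1.
Proof. by rewrite cmodX (cmod_root wL) expr1n. Qed.

Let A K : R := Num.sqrt (L.+1 * K)%N%:R.

Let sumw K : \sum_(q : 'I_L.+1 * 'I_K) cmod (w ^+ q.1) ^+ 2 = A K ^+ 2.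
Proof.
under eq_bigr => q _ do rewrite w1 expr1n.
by rewrite sumr_const card_prod !card_ord sqr_sqrtr.
Qed.

(** In the limit of many copies the error terms of [fft] disappear, since the average
    over [K] copies is at least of the order of the square root of [K]. *)
Lemma pcopies_ge K I (x : I -> X) : A K * Rad x <= 4 * pcopies w L K x.
Proof.
rewrite /pcopies /copies (copies_assoc K x (fun l : 'I_L.+1 => w ^+ l)).
apply: (Rad_copies_ge (c := fun _ (q : 'I_L.+1 * 'I_K) => w ^+ q.1)).
  exact: sqrtr_ge0.
by move=> i; rewrite sumw.
Qed.

Lemma pcopies_le (C : R) K I (x : I -> X) : weak_cotype X C -> 0 <= C -> (0 < K)%N ->
  pcopies w L K x <= A K * (4 + 16 * C) * Rad x.
Proof.
move=> hC C0 K0; rewrite /pcopies /copies (copies_assoc K x (fun l : 'I_L.+1 => w ^+ l)).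
apply: (Rad_copies_le hC (c := fun _ (q : 'I_L.+1 * 'I_K) => w ^+ q.1)) => //.
  by rewrite sqrtr_gt0 ltr0n muln_gt0.
by move=> i; rewrite sumw.
Qed.

Lemma sqsum_pcopies K I (x : I -> X) :
  sqsum (fun p : (I * 'I_L.+1) * 'I_K => phased w x p.1) = A K * sqsum x.
Proof.
rewrite /A /sqsum -sqrtrM //; congr Num.sqrt; rewrite mulr_sumr !sum_pair.
apply: eq_bigr => i _; rewrite (eq_bigr (fun=> K%:R * cnorm (x i) ^+ 2)).
  by rewrite sumr_const card_ord natrM -[LHS]mulr_natl mulrA.
move=> l _; rewrite (eq_bigr (fun=> cnorm (x i) ^+ 2)).
  by rewrite sumr_const card_ord -[LHS]mulr_natl.
by move=> j _; rewrite /phased cnormZ w1 mul1r.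
Qed.

End PCopiesBounds.

Lemma ler_addgt0_scale (a b c : R) : (forall d, 0 < d -> a <= b + c * d) -> a <= b.
Proof.
move=> h; apply/ler_addgt0Pr => e e0.
have c0 : 0 < `|c| + 1 by rewrite ltr_wpDl.
apply: le_trans (h _ (divr_gt0 e0 c0)) _; rewrite lerD2l.
apply: le_trans (_ : `|c| * (e / (`|c| + 1)) <= _).
  by rewrite ler_wpM2r ?ler_norm // divr_ge0 ?ltW.
rewrite mulrCA ler_piMr ?(ltW e0) // ler_pdivrMr // mul1r lerDl //.
Qed.

End FFT.

Section DftBounds.
Context {R : realType} {X : normedModType R[i]}.

(** In a space of type 2, Rademacher averages of a family are controlled by the
    quadratic mean of its Fourier transform: the averages over many copies
    are almost invariant under the normalized transform, which is unitary. *)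
Lemma type2_dft (C : R) (hC : forall (I : finType) (x : I -> X), Rad x <= C * sqsum x)
    k (r : R[i]) (x : 'I_(2 ^ k) -> X) : 0 <= C -> dyadic_root k r ->
  Num.sqrt (2 ^+ k) * Rad x <= 4 * C * sqsum (dft r x).
Proof.
move=> C0 hr; set q := Num.sqrt _; pose y := dft r x.
have [L LE] : exists L, (2 ^ k = L.+1)%N.
  by exists (2 ^ k).-1; rewrite prednK ?expn_gt0.
have wL : r ^+ L.+1 = 1 by rewrite -LE dyadic_root_expr.
have wa : r^-1 = r ^+ L by apply: (mulfI (_ : r != 0)); rewrite ?mulfV -?exprS //;
  apply/eqP => r0; move: wL; rewrite r0 expr0n /= => /esym/eqP; rewrite oner_eq0.
apply: (@ler_addgt0_scale _ _ _ 4) => d d0.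
have [K0 hK] := fft y wL (dyadic_rootV hr) wa d0.
have {hK} := hK K0.+1 (leqnSn _); set K := K0.+1.
pose A := Num.sqrt (L.+1 * K)%N%:R : R.
have A0 : 0 < A by rewrite sqrtr_gt0 ltr0n muln_gt0.
have yx : pcopies r L (2 ^ k * K)%N (dft r^-1 y) = 2 ^+ k * pcopies r L (2 ^ k * K)%N x.
  rewrite (eq_pcopies _ _ _ (y := fun m => 2 ^+ k *: x m)); last first.
    by move=> m; rewrite dft_inv.
  by rewrite pcopiesZ cmodX -[2](rmorph_nat (real_complex R)) cmodr ger0_norm.
rewrite yx; set P := pcopies _ _ _ x; set Q := pcopies _ _ _ y => hPQ.
have hP : q * A * Rad x <= 4 * P.
  have := pcopies_ge wL (2 ^ k * K)%N x; rewrite -/P.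
  by rewrite mulnCA natrM sqrtrM // natrX.
have hQ : Q <= C * (A * sqsum y).
  rewrite -(sqsum_pcopies wL K y); exact: hC.
have KA : Num.sqrt K%:R <= A by rewrite ler_wsqrtr // ler_nat leq_pmull.
have p1 : 1 <= 2 ^+ k :> R by rewrite exprn_ege1 // ler1n.
have hPQ' : P <= Q + d * A.
  have p0 : 0 < 2 ^+ k :> R by rewrite exprn_gt0.
  rewrite -(ler_pM2l p0); apply: (le_trans hPQ); rewrite mulrDr lerD2l.
  apply: le_trans (_ : d * A <= _); first by rewrite ler_wpM2l // ltW.
  by rewrite ler_peMl // mulr_ge0 ?ltW.
rewrite -(ler_pM2l A0).
have : q * A * Rad x <= 4 * (C * (A * sqsum y) + d * A).
  by apply: (le_trans hP); rewrite ler_pM2l //; apply: (le_trans hPQ'); rewrite lerD2r.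
suff [-> ->] : A * (q * Rad x) = q * A * Rad x /\
   A * (4 * C * sqsum (dft r x) + 4 * d) = 4 * (C * (A * sqsum y) + d * A) by [].
by split; rewrite /y; ring.
Qed.

(** The same comparison in the other direction. Here the copies of [x] have to be
    bounded from above, which cotype 2 allows. *)
Lemma cotype2_dft (C : R)
    (hC : forall (I : finType) (x : I -> X), sqsum x <= C * Rad x)
    k (r : R[i]) (x : 'I_(2 ^ k) -> X) : 0 <= C -> dyadic_root k r ->
  Num.sqrt (2 ^+ k) * sqsum (dft r x) <= C * (4 + 16 * C) * 2 ^+ k * Rad x.
Proof.
move=> C0 hr; set q := Num.sqrt _; pose y := dft r x.
have [L LE] : exists L, (2 ^ k = L.+1)%N.
  by exists (2 ^ k).-1; rewrite prednK ?expn_gt0.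
have wL : r ^+ L.+1 = 1 by rewrite -LE dyadic_root_expr.
apply: (@ler_addgt0_scale _ _ _ C) => d d0.
have [K0 hK] := fft x wL hr (esym (expr1 r)) d0.
have {hK} := hK K0.+1 (leqnSn _); set K := K0.+1.
pose A := Num.sqrt (L.+1 * K)%N%:R : R.
have A0 : 0 < A by rewrite sqrtr_gt0 ltr0n muln_gt0.
rewrite -/y; set P := pcopies _ _ _ x; set Q := pcopies _ _ _ y => hPQ.
have hQ : q * A * sqsum y <= C * Q.
  have := hC _ (fun p : ('I_(2 ^ k) * 'I_L.+1) * 'I_(2 ^ k * K) => phased r y p.1).
  by rewrite (sqsum_pcopies wL) mulnCA natrM sqrtrM // natrX.
have hP : P <= A * (4 + 16 * C) * Rad x.
  by apply: pcopies_le => //; apply: cotype2_weak_cotype.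
have KA : Num.sqrt K%:R <= A by rewrite ler_wsqrtr // ler_nat leq_pmull.
rewrite -(ler_pM2l A0).
have : q * A * sqsum y <= C * (2 ^+ k * (A * (4 + 16 * C) * Rad x) + d * A).
  apply: (le_trans hQ); rewrite ler_wpM2l //; apply: (le_trans hPQ).
  by apply: lerD; [rewrite ler_wpM2l ?exprn_ge0|rewrite ler_wpM2l // ltW].
suff [-> ->] : A * (q * sqsum (dft r x)) = q * A * sqsum y /\
   A * (C * (4 + 16 * C) * 2 ^+ k * Rad x + C * d) =
   C * (2 ^+ k * (A * (4 + 16 * C) * Rad x) + d * A) by [].
by split; rewrite /y; ring.
Qed.

End DftBounds.

(** * Multi-indices and characters of the torus *)

Section MultiIndex.

Lemma nth_prime_prime i : prime (nth_prime i).
Proof. by case: i => [|i] /=; case: ex_minnP => p /andP[]. Qed.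

Lemma nth_prime_ltS i : (nth_prime i < nth_prime i.+1)%N.
Proof. by rewrite [X in (_ < X)%N]/=; case: ex_minnP => p /andP[]. Qed.

Lemma nth_prime_lt i j : (i < j)%N -> (nth_prime i < nth_prime j)%N.
Proof. move: i j; exact: (homo_ltn ltn_trans nth_prime_ltS). Qed.

Lemma nth_prime_inj : injective nth_prime.
Proof.
move=> i j e; have [/nth_prime_lt|/nth_prime_lt|//] := ltngtP i j;
  by rewrite e ltnn.
Qed.

Lemma nth_prime_gt i : (i < nth_prime i)%N.
Proof.
elim: i => [|i IH]; first exact/prime_gt0/nth_prime_prime.
by apply: leq_ltn_trans IH (nth_prime_ltS i).
Qed.

Lemma nth_prime_surj p : prime p -> exists i, nth_prime i = p.
Proof.
move=> pp; have : (p < nth_prime p)%N by apply: nth_prime_gt.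
elim: {2}p => [|i IH] /=; case: ex_minnP => q /andP[pq lq] qmin pltq.
  by have := qmin p; rewrite pp prime_gt0 // => /(_ isT); rewrite leqNgt pltq.
have [/IH //|hi|->] := ltngtP p (nth_prime i); last by exists i.
by have := qmin p; rewrite pp hi => /(_ isT); rewrite leqNgt pltq.
Qed.

Lemma nth_prime0 : nth_prime 0 = 2%N.
Proof.
rewrite /=; case: ex_minnP => q /andP[pq _] qmin; apply/eqP.
by rewrite eqn_leq (qmin 2%N) // prime_gt1.
Qed.

Definition mindex (s : nat) (g : nat -> int) : multi_index :=
  [fsfun i in seq_fset tt (iota 0 s) => g i].

Lemma mindexE s g i : mindex s g i = if (i < s)%N then g i else 0.
Proof. by rewrite /mindex fsfunE seq_fsetE mem_iota add0n. Qed.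

Lemma prod_finsupp (V : Type) (e : V) (op : Monoid.com_law e) (s : nat)
    (a : multi_index) (F : nat -> V) : (forall i, a i != 0 -> (i < s)%N) ->
  (forall i, a i = 0 -> F i = e) ->
  \big[op/e]_(i <- finsupp a) F i = \big[op/e]_(i < s) F i.
Proof.
move=> as' F1; rewrite -(big_mkord xpredT) /index_iota subn0.
rewrite [RHS](bigID (mem (finsupp a))) /= [X in op _ X]big1 ?Monoid.mulm1; last first.
  by move=> i; rewrite memNfinsupp => /eqP/F1.
rewrite -[RHS]big_filter; apply: perm_big; apply: uniq_perm.
- exact: fset_uniq.
- by rewrite filter_uniq // iota_uniq.
move=> i; rewrite mem_filter mem_iota add0n /= mem_finsupp.
by case: eqP => //= /eqP /as' ->.
Qed.

Definition nat_index (n : nat) : multi_index :=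
  mindex n (fun i => (logn (nth_prime i) n)%:Z).

Lemma logn_nth_prime_ge n i : (n <= i)%N -> logn (nth_prime i) n = 0%N.
Proof.
move=> ni; case: n ni => [|n] ni; first by rewrite logn0.
apply/eqP; rewrite -leqn0 leqNgt logn_gt0 mem_primes.
apply/negP => /and3P[_ _ /dvdn_leq -/(_ isT)]; rewrite leqNgt => /negP; apply.
exact: leq_ltn_trans ni (nth_prime_gt i).
Qed.

Lemma nat_indexE n i : nat_index n i = (logn (nth_prime i) n)%:Z.
Proof.
by rewrite mindexE; case: ltnP => // ni; rewrite logn_nth_prime_ge.
Qed.

Lemma nat_index_nonneg n : nonneg_index (nat_index n).
Proof. by move=> i; rewrite nat_indexE. Qed.

Lemma multi_index_supp (a : multi_index) : exists s, forall i, a i != 0 -> (i < s)%N.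
Proof.
exists (\max_(i <- finsupp a) i).+1 => i ai.
by rewrite ltnS; apply: (@leq_bigmax_seq _ _ xpredT id) => //; rewrite mem_finsupp.
Qed.

Lemma index_nat_gt0 (a : multi_index) : (0 < index_nat a)%N.
Proof.
apply: prodn_gt0 => i; rewrite expn_gt0 prime_gt0 //; exact: nth_prime_prime.
Qed.

Lemma logn_prod_nth_prime s (e : nat -> nat) j :
  logn (nth_prime j) (\prod_(i < s) nth_prime i ^ e i)%N = if (j < s)%N then e j else 0%N.
Proof.
elim: s => [|s IH]; first by rewrite big_ord0 logn1.
have g0 i m : (0 < nth_prime i ^ m)%N by rewrite expn_gt0 prime_gt0 ?nth_prime_prime.
rewrite big_ord_recr /= lognM ?IH //; last by apply: prodn_gt0.
rewrite lognX logn_prime ?nth_prime_prime // (inj_eq nth_prime_inj) ltnS.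
by case: (ltngtP j s) => js; rewrite ?muln0 ?addn0 // js muln1.
Qed.

Lemma logn_index_nat (a : multi_index) i :
  logn (nth_prime i) (index_nat a) = absz (a i).
Proof.
have [s hs] := multi_index_supp a.
rewrite /index_nat (prod_finsupp _ hs); last by move=> j ->.
rewrite (logn_prod_nth_prime s (fun j => absz (a j))).
case: ltnP => // si; apply/esym/eqP; rewrite absz_eq0.
by apply: contraLR si => /hs; rewrite -ltnNge.
Qed.

Lemma index_natK (a : multi_index) : nonneg_index a -> nat_index (index_nat a) = a.
Proof.
by move=> ha; apply/fsfunP => i; rewrite nat_indexE logn_index_nat gez0_abs.
Qed.

Lemma nat_indexK n : (0 < n)%N -> index_nat (nat_index n) = n.
Proof.
move=> n0; apply: eqn_from_log => //; first exact: index_nat_gt0.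
move=> p; case pp : (prime p); last by rewrite lognE pp [RHS]lognE pp.
by have [i <-] := nth_prime_surj pp; rewrite logn_index_nat nat_indexE.
Qed.

End MultiIndex.

Section Characters.
Context {R : realType}.
Implicit Types (z w : torus R) (a : multi_index).

Lemma circle_neq0 (u : circle R) : (u : R[i]) != 0.
Proof. by rewrite -normr_gt0 (eqP (circle_valP u)) ltr01. Qed.

Lemma cmod_circle (u : circle R) : cmod u = 1.
Proof. by rewrite /cmod (eqP (circle_valP u)). Qed.

Lemma monomialE s a z : (forall i, a i != 0 -> (i < s)%N) ->
  monomial a z = \prod_(i < s) (z i : R[i]) ^ a i.
Proof. by move=> hs; apply: prod_finsupp => // i ->; rewrite expr0z. Qed.

Lemma monomial_mindex s g z : monomial (mindex s g) z = \prod_(i < s) (z i : R[i]) ^ g i.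
Proof.
rewrite (@monomialE s); last by move=> i; rewrite mindexE; case: ltnP.
by apply: eq_bigr => i _; rewrite mindexE ltn_ord.
Qed.

Lemma monomial_mul a w z : monomial a (torus_mul w z) = monomial a w * monomial a z.
Proof.
rewrite /monomial -big_split; apply: eq_bigr => i _ /=.
by rewrite expfzMl.
Qed.

Lemma cmod_expz (u : R[i]) (m : int) : cmod u = 1 -> cmod (u ^ m) = 1.
Proof.
case: m => m u1; rewrite ?NegzE -?exprnP ?exprnN ?cmodV cmodX u1 expr1n //.
by rewrite invr1.
Qed.

Lemma cmod_monomial a z : cmod (monomial a z) = 1.
Proof.
rewrite /monomial; apply: (big_ind (fun u => cmod u = 1)); first exact: cmod1.
  by move=> u v hu hv; rewrite cmodM hu hv mulr1.
by move=> i _; apply/cmod_expz/cmod_circle.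
Qed.

Lemma monomial_neq0 a z : monomial a z != 0.
Proof.
by apply/eqP => m0; have := cmod_monomial a z; rewrite m0 cmod0 => /eqP;
  rewrite eq_sym oner_eq0.
Qed.

(** Bohr's correspondence: this character stands for [n^-s]. *)
Definition chi (n : nat) z : R[i] := monomial (nat_index n) z.

Lemma chi_mul n w z : chi n (torus_mul w z) = chi n w * chi n z.
Proof. exact: monomial_mul. Qed.

Lemma cmod_chi n z : cmod (chi n z) = 1.
Proof. exact: cmod_monomial. Qed.

Lemma chiE s n z : (n <= s)%N ->
  chi n z = \prod_(i < s) (z i : R[i]) ^+ logn (nth_prime i) n.
Proof.
move=> ns; rewrite /chi (@monomialE s).
  by apply: eq_bigr => i _; rewrite nat_indexE.
move=> i; rewrite nat_indexE => h; rewrite ltnNge; apply: contra h => si.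
by rewrite logn_nth_prime_ge // (leq_trans ns).
Qed.

Lemma chi_pow2 e z : chi (2 ^ e) z = (z 0%N : R[i]) ^+ e.
Proof.
rewrite (@chiE (2 ^ e).-1.+1); last by rewrite prednK ?expn_gt0.
have lg i : logn (nth_prime i) (2 ^ e) = if i == 0%N then e else 0%N.
  rewrite lognX -nth_prime0 logn_prime ?nth_prime_prime //.
  by rewrite (inj_eq nth_prime_inj) eq_sym; case: eqP; rewrite ?muln1 ?muln0.
rewrite big_ord_recl big1 ?mulr1; first by rewrite lg.
by move=> i _; rewrite lg.
Qed.

Definition circle_exp (u : circle R) (n : nat) : circle R :=
  Circle (introT eqP (etrans (normrX n (u : R[i]))
    (etrans (congr1 (fun r => r ^+ n) (eqP (circle_valP u))) (expr1n _ n)))).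

Definition circle_of (u : R[i]) (h : cmod u = 1) : circle R :=
  Circle (introT eqP (etrans (cmodE u) (congr1 (real_complex R) h))).

End Characters.

(** * Bochner integrals *)

Section Partitions.
Local Open Scope classical_set_scope.
Context {d : measure_display} {T : measurableType d} {R : realType}.
Context {X : normedModType R[i]} (mu : probability T R).
Implicit Types (J K : finType).

(** A simple function is handled as [c \o g], for a measurable map [g] to a
    finite type; finitely many of them then have a common refinement. *)
Definition measurable_part J (g : T -> J) : Prop :=
  forall j, measurable (g @^-1` [set j]).

Definition mass J (g : T -> J) (j : J) : R := fine (mu (g @^-1` [set j])).

Lemma mass_ge0 J (g : T -> J) j : 0 <= mass g j.
Proof. by rewrite fine_ge0. Qed.

Lemma measurable_fun_part J (g : T -> J) (h : J -> R) : measurable_part g ->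
  measurable_fun setT (fun t => h (g t)).
Proof.
move=> mg; rewrite (_ : (fun t => h (g t)) =
    (fun t => \sum_(j : J) h j * \1_(g @^-1` [set j]) t)); last first.
  apply/funext => t; rewrite (bigD1 (g t)) //= indicE mem_set // mulr1.
  rewrite big1 ?addr0 // => j ne; rewrite indicE memNset ?mulr0 //.
  by move=> /= e; rewrite e eqxx in ne.
by apply: measurable_sum => j; apply: measurable_funM => //; apply: measurable_indic.
Qed.

Lemma integral_part J (g : T -> J) (h : J -> R) : measurable_part g ->
  (forall j, 0 <= h j) ->
  (\int[mu]_t (h (g t))%:E = (\sum_j h j * mass g j)%:E)%E.
Proof.
move=> mg h0.
rewrite (eq_integral (fun t => \sum_(j : J) (h j)%:E * (\1_(g @^-1` [set j]) t)%:E)%E); last first.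
  move=> t _; rewrite (bigD1 (g t)) //= indicE mem_set // mule1.
  rewrite big1 ?adde0 // => j ne; rewrite indicE memNset ?mule0 //.
  by move=> /= e; rewrite e eqxx in ne.
have mi j : measurable_fun setT (fun t => (\1_(g @^-1` [set j]) t)%:E : \bar R).
  by apply/measurable_EFinP; exact: measurable_indic.
rewrite ge0_integral_sum //; last 2 first.
- by move=> j; apply: measurable_funeM.
- by move=> j t _; rewrite mule_ge0 // lee_fin.
rewrite -sumEFin; apply: eq_bigr => j _.
rewrite ge0_integralZl_EFin // integral_indic // setIT EFinM.
by rewrite fineK // fin_num_measure.
Qed.

Lemma is_simple_part J (g : T -> J) (c : J -> X) : measurable_part g ->
  is_simple (fun t => c (g t)).
Proof.
move=> mg; split.
  apply: (@sub_finite_set _ _ (c @` setT)); last exact/finite_image/finite_finset.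
  by move=> x [t _ <-]; exists (g t).
move=> x; rewrite (_ : _ @^-1` _ = \big[setU/set0]_(j : J | c j == x) (g @^-1` [set j])).
  by apply: bigsetU_measurable => j _.
rewrite -bigcup_seq_cond; apply/seteqP; split => [t /= ct|t [j /= /andP[_ /eqP cj] gt]].
  by exists (g t) => //=; rewrite mem_index_enum ct eqxx.
by rewrite gt.
Qed.

Lemma simple_integral_part J (g : T -> J) (c : J -> X) : measurable_part g ->
  simple_integral mu (fun t => c (g t)) = \sum_j (mass g j)%:C *: c j.
Proof.
move=> mg; have [fr _] := is_simple_part c mg.
rewrite /simple_integral fsbig_finite //=.
have E x : fine (mu ((fun t => c (g t)) @^-1` [set x])) = \sum_(j | c j == x) mass g j.
  pose h j : R := (c j == x)%:R.
  have := integral_part mg (fun j => ler0n R (c j == x)).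
  rewrite (eq_integral (fun t => (\1_((fun t => c (g t)) @^-1` [set x]) t)%:E)).
    rewrite integral_indic //; last by have [_] := is_simple_part c mg; apply.
    rewrite setIT => -> /=; rewrite [RHS]big_mkcond; apply: eq_bigr => j _.
    by case: eqP; rewrite ?mul1r ?mul0r.
  move=> t _; rewrite indicE; congr (_%:R%:E).
  by congr nat_of_bool; apply/eqP/idP => [/mem_set //|/set_mem].
under eq_bigr => x _ do rewrite E rmorph_sum scaler_suml.
rewrite (exchange_big_dep xpredT) //=; apply: eq_bigr => j _.
have [cj|cj] := boolP (c j \in fset_set (range (fun t => c (g t)))).
  rewrite -big_filter (_ : [seq _ <- _ | _] = [:: c j]) ?big_seq1 //.
  rewrite (eq_filter (a2 := pred1 (c j))); last by move=> x /=; rewrite eq_sym.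
  by apply: filter_pred1_uniq => //; apply: fset_uniq.
rewrite big_seq_cond big_pred0; last first.
  by move=> x; apply/andP => -[xs /eqP e]; rewrite e xs in cj.
suff -> : mass g j = 0 by rewrite scale0r.
rewrite /mass (_ : g @^-1` _ = set0) ?measure0 //.
apply/seteqP; split => // t /= gt; move/negP: cj; apply.
by rewrite in_fset_set //; apply/mem_set; exists t => //; rewrite gt.
Qed.

Lemma simple_partP (s : T -> X) : is_simple s ->
  exists J (g : T -> J) (c : J -> X), measurable_part g /\ s = (fun t => c (g t)).
Proof.
move=> [fr ms]; pose F := fset_set (range s).
have sF t : s t \in F by rewrite in_fset_set //; apply/mem_set; exists t.
exists F, (fun t => [` sF t]%fset), val; split => //.
move=> j; rewrite (_ : _ @^-1` _ = s @^-1` [set val j]) //.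
apply/seteqP; split => t /=; first by move=> <-.
by move=> e; apply: val_inj.
Qed.

Lemma measurable_part_pair J K (g : T -> J) (h : T -> K) :
  measurable_part g -> measurable_part h -> measurable_part (fun t => (g t, h t)).
Proof.
move=> mg mh [j k].
rewrite (_ : _ @^-1` _ = (g @^-1` [set j]) `&` (h @^-1` [set k])).
  exact: measurableI.
by apply/seteqP; split => t /=; [case=> -> ->|case=> -> ->].
Qed.

Lemma common_part (s s' : T -> X) : is_simple s -> is_simple s' ->
  exists J (g : T -> J) (c c' : J -> X), [/\ measurable_part g,
    s = (fun t => c (g t)) & s' = (fun t => c' (g t))].
Proof.
move=> /simple_partP[J [g [c [mg ->]]]] /simple_partP[K [h [c' [mh ->]]]].
exists (J * K)%type, (fun t => (g t, h t)), (fun p => c p.1), (fun p => c' p.2).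
by split => //; apply: measurable_part_pair.
Qed.

Lemma is_simpleD (s s' : T -> X) : is_simple s -> is_simple s' ->
  is_simple (fun t => s t + s' t).
Proof.
move=> hs hs'; have [J [g [c [c' [mg -> ->]]]]] := common_part hs hs'.
exact: (is_simple_part (fun j => c j + c' j)).
Qed.

Lemma is_simpleZ (a : R[i]) (s : T -> X) : is_simple s -> is_simple (fun t => a *: s t).
Proof.
move=> /simple_partP[J [g [c [mg ->]]]].
exact: (is_simple_part (fun j => a *: c j)).
Qed.

Lemma simple_integralD (s s' : T -> X) : is_simple s -> is_simple s' ->
  simple_integral mu (fun t => s t + s' t) = simple_integral mu s + simple_integral mu s'.
Proof.
move=> hs hs'; have [J [g [c [c' [mg -> ->]]]]] := common_part hs hs'.
rewrite (simple_integral_part (fun j => c j + c' j)) // !simple_integral_part //.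
by rewrite -big_split; apply: eq_bigr => j _; rewrite scalerDr.
Qed.

Lemma simple_integralZ (a : R[i]) (s : T -> X) : is_simple s ->
  simple_integral mu (fun t => a *: s t) = a *: simple_integral mu s.
Proof.
move=> /simple_partP[J [g [c [mg ->]]]].
rewrite (simple_integral_part (fun j => a *: c j)) // simple_integral_part //.
by rewrite scaler_sumr; apply: eq_bigr => j _; rewrite !scalerA mulrC.
Qed.

Lemma cnorm_simple_integral (s : T -> X) : is_simple s ->
  ((cnorm (simple_integral mu s))%:E <= \int[mu]_t (cnorm (s t))%:E)%E.
Proof.
move=> /simple_partP[J [g [c [mg ->]]]].
rewrite (integral_part (h := fun j => cnorm (c j))) //; last by move=> j; apply: cnorm_ge0.
rewrite simple_integral_part // lee_fin; apply: le_trans (ler_cnorm_sum _ _ _) _.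
apply: ler_sum => j _; rewrite cnormZr ger0_norm ?mass_ge0 //.
by rewrite mulrC.
Qed.

Lemma measurable_simple (s : T -> X) : is_simple s ->
  measurable_fun setT (fun t => cnorm (s t)).
Proof.
move=> /simple_partP[J [g [c [mg ->]]]].
exact: (measurable_fun_part (fun j => cnorm (c j))).
Qed.

End Partitions.

Section BochnerTheory.
Local Open Scope classical_set_scope.
Context {d : measure_display} {T : measurableType d} {R : realType}.
Context {X : normedModType R[i]} (mu : probability T R).
Implicit Types (f g : T -> X).

Lemma le_integralD (h h1 h2 : T -> R) : measurable_fun setT h ->
  measurable_fun setT h1 -> measurable_fun setT h2 ->
  (forall t, 0 <= h t) -> (forall t, 0 <= h1 t) -> (forall t, 0 <= h2 t) ->
  (forall t, h t <= h1 t + h2 t) ->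
  (\int[mu]_t (h t)%:E <= \int[mu]_t (h1 t)%:E + \int[mu]_t (h2 t)%:E)%E.
Proof.
move=> m m1 m2 p p1 p2 le.
have M (k : T -> R) : measurable_fun setT k -> measurable_fun setT (fun t => (k t)%:E : \bar R).
  by move=> mk; apply/measurable_EFinP.
have P (k : T -> R) : (forall t, 0 <= k t) -> forall t, setT t -> (0 <= (k t)%:E :> \bar R)%E.
  by move=> k0 t _; rewrite lee_fin.
rewrite -(ge0_integralD mu measurableT (P _ p1) (M _ m1) (P _ p2) (M _ m2)).
apply: ge0_le_integral; [exact: measurableT|exact: P|exact: M| |].
  exact: emeasurable_funD (M _ m1) (M _ m2).
by move=> t _; rewrite -EFinD lee_fin.
Qed.

Lemma cvg_cnorm (u : nat -> X) (l : X) :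
  (u @ \oo --> l) <-> forall e : R, 0 < e -> \forall n \near \oo, cnorm (l - u n) < e.
Proof.
rewrite cvgrPdist_lt; split => [h e e0|h e e0].
  have e0' : 0 < e%:C by rewrite ltcR.
  near=> n; rewrite -ltcR -cnormE; near: n; exact: h.
have eE : e = (complex.Re e)%:C by rewrite RRe_real // gtr0_real.
have e0' : 0 < complex.Re e by rewrite -ltcR -eE.
near=> n; rewrite cnormE eE ltcR; near: n; exact: h.
Unshelve. all: by end_near.
Qed.

Lemma ler_dist_cnorm (x y : X) : `|cnorm x - cnorm y| <= cnorm (x - y).
Proof.
have h1 := ler_cnormD (x - y) y; have h2 := ler_cnormD (y - x) x.
rewrite !subrK in h1 h2; rewrite -[y - x]opprB cnormN in h2.
by rewrite ler_norml; apply/andP; split; lra.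
Qed.

Lemma strongly_measurable_cnorm f : strongly_measurable f ->
  measurable_fun setT (fun t => cnorm (f t)).
Proof.
move=> [s hs sf]; apply: (measurable_fun_cvg (h := fun n t => cnorm (s n t))).
  by move=> n; apply: measurable_simple.
move=> t _; apply/cvgrPdist_lt => e e0.
have /cvg_cnorm/(_ _ e0) h := sf t.
by near=> n; apply: le_lt_trans (ler_dist_cnorm _ _) _; near: n.
Unshelve. all: by end_near.
Qed.

Lemma is_simple_strongly_measurable f : is_simple f -> strongly_measurable f.
Proof. by move=> hf; exists (fun=> f) => // t; apply: cvg_cst. Qed.

Lemma strongly_measurableD f g : strongly_measurable f -> strongly_measurable g ->
  strongly_measurable (fun t => f t + g t).
Proof.
move=> [s hs sf] [s' hs' sg]; exists (fun n t => s n t + s' n t).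
  by move=> n; apply: is_simpleD.
by move=> t; apply: cvgD.
Qed.

Lemma strongly_measurableZ (a : R[i]) f : strongly_measurable f ->
  strongly_measurable (fun t => a *: f t).
Proof.
move=> [s hs sf]; exists (fun n t => a *: s n t).
  by move=> n; apply: is_simpleZ.
by move=> t; apply: cvgZl_tmp.
Qed.

Lemma strongly_measurableB f g : strongly_measurable f -> strongly_measurable g ->
  strongly_measurable (fun t => f t - g t).
Proof.
move=> hf hg; have := strongly_measurableD hf (strongly_measurableZ (-1) hg).
by rewrite (_ : (fun _ => _) = (fun t => f t - g t)) //; apply/funext => t;
  rewrite scaleN1r.
Qed.

Lemma cnorm_bochner_integral f v : is_bochner_integral mu f v ->
  ((cnorm v)%:E <= \int[mu]_t (cnorm (f t))%:E)%E.
Proof.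
move=> [mf [s [hs sf sv]]]; apply/lee_addgt0Pr => e e0.
have e2 : 0 < e / 2 by rewrite divr_gt0.
have /cvg_cnorm/(_ _ e2) h1 := sv.
have h2 : \forall n \near \oo, (\int[mu]_t (cnorm (f t - s n t))%:E < (e / 2)%:E)%E.
  apply: (sf [set y | (y < (e / 2)%:E)%E]); apply: open_ereal_lt'.
  by rewrite lte_fin.
have [n [hn1 hn2]] : exists n, cnorm (v - simple_integral mu (s n)) < e / 2 /\
    (\int[mu]_t (cnorm (f t - s n t))%:E < (e / 2)%:E)%E.
  have : \forall n \near \oo, cnorm (v - simple_integral mu (s n)) < e / 2 /\
    (\int[mu]_t (cnorm (f t - s n t))%:E < (e / 2)%:E)%E by apply: filterI.
  by case=> N _ hN; exists N; apply: hN => /=.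
have mfs : measurable_fun setT (fun t => cnorm (f t - s n t)).
  apply/strongly_measurable_cnorm/strongly_measurableB => //.
  exact: is_simple_strongly_measurable.
have mf' := strongly_measurable_cnorm mf.
have hs' : (\int[mu]_t (cnorm (s n t))%:E <=
    \int[mu]_t (cnorm (f t))%:E + \int[mu]_t (cnorm (f t - s n t))%:E)%E.
  apply: le_integralD => //; try by move=> t; apply: cnorm_ge0.
    exact: measurable_simple.
  move=> t; have := ler_cnormB (f t) (f t - s n t).
  by rewrite opprB addrC subrK.
apply: (@le_trans _ _ ((cnorm (v - simple_integral mu (s n)) +
    cnorm (simple_integral mu (s n)))%:E)%E).
  rewrite lee_fin; have := ler_cnormD (v - simple_integral mu (s n)) (simple_integral mu (s n)).
  by rewrite subrK.
rewrite EFinD (splitr e) EFinD addeA addeC.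
apply: leeD; last by rewrite lee_fin ltW.
apply: le_trans (cnorm_simple_integral mu (hs n)) (le_trans hs' _).
by rewrite leeD2l // ltW.
Qed.

Lemma is_bochner_integralD f g u v : is_bochner_integral mu f u ->
  is_bochner_integral mu g v -> is_bochner_integral mu (fun t => f t + g t) (u + v).
Proof.
move=> [mf [s [hs sf su]]] [mg [s' [hs' sg sv]]]; split.
  exact: strongly_measurableD.
exists (fun n t => s n t + s' n t); split.
- by move=> n; apply: is_simpleD.
- have c0 n t : (0 <= (cnorm (f t + g t - (s n t + s' n t)))%:E :> \bar R)%E.
    by rewrite lee_fin cnorm_ge0.
  have m1 n : measurable_fun setT (fun t => (cnorm (f t - s n t))%:E : \bar R).
    apply/measurable_EFinP/strongly_measurable_cnorm/strongly_measurableB => //.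
    exact: is_simple_strongly_measurable.
  have m2 n : measurable_fun setT (fun t => (cnorm (g t - s' n t))%:E : \bar R).
    apply/measurable_EFinP/strongly_measurable_cnorm/strongly_measurableB => //.
    exact: is_simple_strongly_measurable.
  apply: (@squeeze_cvge _ _ _ _ (fun=> 0%E) _
    (fun n => (\int[mu]_t (cnorm (f t - s n t))%:E + \int[mu]_t (cnorm (g t - s' n t))%:E)%E)).
  + near=> n; rewrite integral_ge0 //=.
    apply: le_integralD; try by move=> t; apply: cnorm_ge0.
    * apply/strongly_measurable_cnorm/strongly_measurableB.
        exact: strongly_measurableD.
      by apply/is_simple_strongly_measurable/is_simpleD.
    * by apply/measurable_EFinP; exact: m1.
    * by apply/measurable_EFinP; exact: m2.
    * by move=> t; rewrite opprD addrACA; exact: ler_cnormD.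
  + exact: cvg_cst.
  + by rewrite -[X in _ --> X]adde0; apply: cvgeD.
- under eq_fun do rewrite simple_integralD //.
  exact: cvgD.
Unshelve. all: by end_near.
Qed.

Lemma is_bochner_integralZ (a : R[i]) f v : is_bochner_integral mu f v ->
  is_bochner_integral mu (fun t => a *: f t) (a *: v).
Proof.
move=> [mf [s [hs sf sv]]]; split; first exact: strongly_measurableZ.
exists (fun n t => a *: s n t); split.
- by move=> n; apply: is_simpleZ.
- rewrite (_ : (fun n => _) =
      (fun n => ((cmod a)%:E * \int[mu]_t (cnorm (f t - s n t))%:E)%E)).
    by rewrite -[X in _ --> X](mule0 (cmod a)%:E); apply: cvgeZl.
  apply/funext => n; rewrite -ge0_integralZl_EFin ?cmod_ge0 //.
  + by apply: eq_integral => t _; rewrite -scalerBr cnormZ EFinM.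
  + by move=> t _; rewrite lee_fin cnorm_ge0.
  + apply/measurable_EFinP/strongly_measurable_cnorm/strongly_measurableB => //.
    exact: is_simple_strongly_measurable.
- under eq_fun do rewrite simple_integralZ //.
  exact: cvgZl_tmp.
Qed.

Lemma is_bochner_integral_unif f (s : nat -> T -> X) (b : nat -> R) v :
  (forall n, is_simple (s n)) -> (forall n t, cnorm (f t - s n t) <= b n) ->
  b @ \oo --> (0 : R) -> (fun n => simple_integral mu (s n)) @ \oo --> v ->
  is_bochner_integral mu f v.
Proof.
move=> hs sb b0 sv.
have mf : strongly_measurable f.
  exists s => // t; apply/cvg_cnorm => e e0.
  have /cvgrPdist_lt/(_ _ e0) h := b0.
  near=> n; apply: le_lt_trans (sb n t) _; apply: le_lt_trans (ler_norm _) _.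
  by rewrite -normrN -(sub0r (b n)); near: n.
split => //; exists s; split => //.
apply: (@squeeze_cvge _ _ _ _ (fun=> 0%E) _ (fun n => (b n)%:E)).
- near=> n; rewrite integral_ge0 /=; last by move=> t _; rewrite lee_fin cnorm_ge0.
  apply: (@le_trans _ _ (\int[mu]_(t in setT) cst (b n)%:E t)%E).
    apply: ge0_le_integral => //.
    + by move=> t _; rewrite lee_fin cnorm_ge0.
    + apply/measurable_EFinP/strongly_measurable_cnorm/strongly_measurableB => //.
      exact: is_simple_strongly_measurable.
    + by move=> t _; rewrite lee_fin.
  rewrite integral_cst // [X in (_ * X)%E](_ : _ = 1%E); last exact: probability_setT.
  by rewrite mule1.
- exact: cvg_cst.
- by apply: cvg_EFin; [exact: nearW|exact: b0].
Unshelve. all: by end_near.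
Qed.

Lemma is_bochner_integral_cst (x : X) : is_bochner_integral mu (fun=> x) x.
Proof.
have hx : is_simple (fun _ : T => x).
  apply: (is_simple_part (fun _ : unit => x) (g := fun=> tt)) => -[].
  by rewrite (_ : _ @^-1` _ = setT) //; apply/seteqP.
apply: (@is_bochner_integral_unif _ (fun=> fun=> x) (fun=> 0)) => //.
- by move=> n t; rewrite subrr cnorm0.
- exact: cvg_cst.
- suff -> : simple_integral mu (fun=> x) = x by apply: cvg_cst.
  rewrite (simple_integral_part mu (fun _ : unit => x) (g := fun=> tt)).
    rewrite (big_pred1 tt); last by case.
    rewrite /mass (_ : _ @^-1` _ = setT); last by apply/seteqP.
    by rewrite probability_setT scale1r.
  by move=> -[]; rewrite (_ : _ @^-1` _ = setT) //; apply/seteqP.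
Qed.

Lemma is_bochner_integral_sum (I : Type) (r : seq I) (F : I -> T -> X) (v : I -> X) :
  (forall i, is_bochner_integral mu (F i) (v i)) ->
  is_bochner_integral mu (fun t => \sum_(i <- r) F i t) (\sum_(i <- r) v i).
Proof.
move=> h; elim: r => [|i r IH].
  rewrite big_nil; under eq_fun do rewrite big_nil.
  exact: is_bochner_integral_cst.
rewrite big_cons; under eq_fun do rewrite big_cons.
exact: is_bochner_integralD.
Qed.

Lemma eq_bochner_integral f g v : f =1 g -> is_bochner_integral mu g v ->
  is_bochner_integral mu f v.
Proof. by move=> /funext ->. Qed.

Lemma strongly_measurable_sum (I : Type) (r : seq I) (F : I -> T -> X) :
  (forall i, strongly_measurable (F i)) ->
  strongly_measurable (fun t => \sum_(i <- r) F i t).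
Proof.
move=> h; elim: r => [|i r IH].
  under eq_fun do rewrite big_nil.
  by have [] := is_bochner_integral_cst (0 : X).
by under eq_fun do rewrite big_cons; apply: strongly_measurableD.
Qed.

End BochnerTheory.

(** * Harmonic analysis on the infinite torus *)

Section TorusMeasurability.
Local Open Scope classical_set_scope.
Context {R : realType}.
Implicit Types (z w : torus R) (a : multi_index).

Definition cmeasurable d (T : measurableType d) (f : T -> R[i]) : Prop :=
  measurable_fun setT (fun t => complex.Re (f t)) /\
  measurable_fun setT (fun t => complex.Im (f t)).

Section CMeasurable.
Context {d : measure_display} {T : measurableType d}.
Implicit Types f g : T -> R[i].

Lemma cmeasurable_cst (c : R[i]) : cmeasurable (fun _ : T => c).
Proof. by split; apply: measurable_cst. Qed.

Lemma cmeasurableD f g : cmeasurable f -> cmeasurable g ->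
  cmeasurable (fun t => f t + g t).
Proof.
move=> [f1 f2] [g1 g2]; split.
  rewrite (_ : (fun t => _) = (fun t => complex.Re (f t)) \+ (fun t => complex.Re (g t))).
    exact: measurable_funD.
  by apply/funext => t /=; case: (f t) => ? ?; case: (g t).
rewrite (_ : (fun t => _) = (fun t => complex.Im (f t)) \+ (fun t => complex.Im (g t))).
  exact: measurable_funD.
by apply/funext => t /=; case: (f t) => ? ?; case: (g t).
Qed.

Lemma cmeasurableM f g : cmeasurable f -> cmeasurable g ->
  cmeasurable (fun t => f t * g t).
Proof.
move=> [f1 f2] [g1 g2]; split.
  rewrite (_ : (fun t => _) =
      ((fun t => complex.Re (f t)) \* (fun t => complex.Re (g t))) \-
      ((fun t => complex.Im (f t)) \* (fun t => complex.Im (g t)))).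
    by apply: measurable_funB; apply: measurable_funM.
  by apply/funext => t /=; case: (f t) => ? ?; case: (g t).
rewrite (_ : (fun t => _) =
    ((fun t => complex.Re (f t)) \* (fun t => complex.Im (g t))) \+
    ((fun t => complex.Im (f t)) \* (fun t => complex.Re (g t)))).
  by apply: measurable_funD; apply: measurable_funM.
by apply/funext => t /=; case: (f t) => ? ?; case: (g t).
Qed.

Lemma cmeasurableV f : cmeasurable f -> (forall t, cmod (f t) = 1) ->
  cmeasurable (fun t => (f t)^-1).
Proof.
move=> [f1 f2] h; have E t : (f t)^-1 = (f t)^*%C.
  by rewrite invc_norm cmodE h rmorph1 expr1n invr1 mul1r.
split.
  by rewrite (_ : (fun t => _) = (fun t => complex.Re (f t))) //;
    apply/funext => t; rewrite E; case: (f t).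
rewrite (_ : (fun t => _) = \- (fun t => complex.Im (f t))).
  exact: measurable_funN.
by apply/funext => t /=; rewrite E; case: (f t).
Qed.

Lemma cmeasurable_sum (I : Type) (r : seq I) (F : I -> T -> R[i]) :
  (forall i, cmeasurable (F i)) -> cmeasurable (fun t => \sum_(i <- r) F i t).
Proof.
move=> h; elim: r => [|i r IH].
  by under eq_fun do rewrite big_nil; apply: cmeasurable_cst.
by under eq_fun do rewrite big_cons; apply: cmeasurableD.
Qed.

Lemma cmeasurable_prod (I : Type) (r : seq I) (F : I -> T -> R[i]) :
  (forall i, cmeasurable (F i)) -> cmeasurable (fun t => \prod_(i <- r) F i t).
Proof.
move=> h; elim: r => [|i r IH].
  by under eq_fun do rewrite big_nil; apply: cmeasurable_cst.
by under eq_fun do rewrite big_cons; apply: cmeasurableM.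
Qed.

Lemma eq_cmeasurable f g : f =1 g -> cmeasurable g -> cmeasurable f.
Proof. by move=> /funext ->. Qed.

Lemma cmeasurableX f n : cmeasurable f -> cmeasurable (fun t => f t ^+ n).
Proof.
move=> mf; elim: n => [|n IH]; first exact: cmeasurable_cst.
by under eq_fun do rewrite exprS; apply: cmeasurableM.
Qed.

Lemma measurable_cmod f : cmeasurable f -> measurable_fun setT (fun t => cmod (f t) ^+ 2).
Proof.
move=> [f1 f2]; under eq_fun do rewrite cmodE_sqr.
by apply: measurable_funD; apply: measurable_funX.
Qed.

End CMeasurable.

Lemma torus_measurability d (T : measurableType d) (f : T -> torus R) :
  (forall i (U : set R[i]^o), open U -> measurable [set t | U (f t i : R[i])]) ->
  measurable_fun setT f.
Proof.
move=> h; apply: (@measurability _ _ T (torus R) setT f (@torus_cylinders R)) => //.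
by move=> _ [_ [i [U [oU ->]]] <-]; rewrite setTI; apply: h.
Qed.

Lemma measurable_cylinder i (U : set R[i]^o) : open U ->
  measurable [set z : torus R | U (z i : R[i])].
Proof. by move=> oU; apply: sub_sigma_algebra; exists i, U. Qed.

Lemma open_cmod (U : set R[i]^o) : (forall u : R[i], U u -> exists2 e : R, 0 < e &
  forall v : R[i], cmod (u - v) < e -> U v) -> open U.
Proof.
move=> h; rewrite openE => u /h[e e0 he]; rewrite /interior.
apply/(@nbhs_normP _ (R[i]^o)); exists e%:C; first by rewrite /= ltcR.
by move=> v /= uv; apply: he; rewrite -ltcR -cmodE.
Qed.

Lemma cmeasurable_coord i : cmeasurable (fun z : torus R => (z i : R[i])).
Proof.
split; apply: (measurability _ (RGenOInfty.measurableE R)) => //.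
  move=> _ [_ [x ->] <-]; rewrite setTI.
  rewrite (_ : _ @^-1` _ = [set z : torus R | [set u : R[i]^o | x < complex.Re (u : R[i])] (z i : R[i])]).
    apply: measurable_cylinder; apply: open_cmod => u /= xu.
    exists (complex.Re u - x); first by rewrite subr_gt0.
    move=> v uv; have := Re_le_cmod (u - v).
    have -> : complex.Re (u - v) = complex.Re u - complex.Re v by case: (u); case: (v).
    by have := ler_norm (complex.Re u - complex.Re v); lra.
  by apply/seteqP; split => z /=; rewrite in_itv /= andbT.
move=> _ [_ [x ->] <-]; rewrite setTI.
rewrite (_ : _ @^-1` _ = [set z : torus R | [set u : R[i]^o | x < complex.Im (u : R[i])] (z i : R[i])]).
  apply: measurable_cylinder; apply: open_cmod => u /= xu.
  exists (complex.Im u - x); first by rewrite subr_gt0.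
  move=> v uv; have := Im_le_cmod (u - v).
  have -> : complex.Im (u - v) = complex.Im u - complex.Im v by case: (u); case: (v).
  by have := ler_norm (complex.Im u - complex.Im v); lra.
by apply/seteqP; split => z /=; rewrite in_itv /= andbT.
Qed.

Lemma measurable_torus_mul w : measurable_fun setT (torus_mul w : torus R -> torus R).
Proof.
apply: torus_measurability => i U oU.
rewrite (_ : [set _ | _] = [set z : torus R | [set u : R[i]^o | U ((w i : R[i]) * u)] (z i : R[i])]) //.
apply: measurable_cylinder; apply: open_cmod => u /= Uu.
have : nbhs (((w i : R[i]) * u) : R[i]^o) U by apply: open_nbhs_nbhs.
move=> /(@nbhs_normP _ (R[i]^o))[e /= e0 he]; have eE : e = (complex.Re e)%:C.
  by rewrite RRe_real // gtr0_real.
exists (complex.Re e); first by rewrite -ltcR -eE.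
move=> v uv; apply: he => /=; rewrite -mulrBr normrM (eqP (circle_valP (w i))) mul1r.
by rewrite cmodE eE ltcR.
Qed.

Lemma cmeasurable_monomial a : cmeasurable (fun z : torus R => monomial a z).
Proof.
apply: cmeasurable_prod => i; case: (a i) => m.
  exact/cmeasurableX/cmeasurable_coord.
apply: (eq_cmeasurable (g := fun z : torus R => ((z i : R[i]) ^+ m.+1)^-1)).
  by move=> z; rewrite NegzE -exprnN.
apply: cmeasurableV; first exact/cmeasurableX/cmeasurable_coord.
by move=> z; rewrite cmodX cmod_circle expr1n.
Qed.

End TorusMeasurability.

Section Grid.
Local Open Scope classical_set_scope.
Context {d : measure_display} {T : measurableType d} {R : realType}.

Let cell (q : nat) (m : T -> R[i]) (t : T) : 'I_(2 * q.+1).+1 * 'I_(2 * q.+1).+1 :=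
  (inord (Num.trunc ((complex.Re (m t) + 1) * q.+1%:R)),
   inord (Num.trunc ((complex.Im (m t) + 1) * q.+1%:R))).

Let corner (q : nat) (j : 'I_(2 * q.+1).+1 * 'I_(2 * q.+1).+1) : R[i] :=
  (j.1%:R / q.+1%:R - 1) +i* (j.2%:R / q.+1%:R - 1).

Lemma grid1 (q : nat) (x : R) : `|x| <= 1 ->
  let a := Num.trunc ((x + 1) * q.+1%:R) in
  (a < (2 * q.+1).+1)%N /\ `|x - (a%:R / q.+1%:R - 1)| <= q.+1%:R^-1.
Proof.
rewrite ler_norml => /andP[x1 x2] a.
have q0 : 0 < q.+1%:R :> R by rewrite ltr0n.
have y0 : 0 <= (x + 1) * q.+1%:R by rewrite mulr_ge0 // -lerBlDr sub0r.
have /andP[h1 h2] := trunc_itv y0; rewrite -/a in h1 h2.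
split.
  rewrite ltnS -(ler_nat R); apply: (le_trans h1); rewrite natrM ler_wpM2r //.
  by lra.
have -> : x - (a%:R / q.+1%:R - 1) = ((x + 1) * q.+1%:R - a%:R) / q.+1%:R.
  by field; rewrite lt0r_neq0.
rewrite normrM (ger0_norm (_ : 0 <= q.+1%:R^-1)) ?invr_ge0 // ler_piMl ?invr_ge0 //.
rewrite ger0_norm ?subr_ge0 //; move: h2; rewrite -natr1; lra.
Qed.

Lemma measurable_trunc (q : nat) (f : T -> R) (j : 'I_(2 * q.+1).+1) :
  measurable_fun setT f -> (forall t, `|f t| <= 1) ->
  measurable [set t | inord (Num.trunc ((f t + 1) * q.+1%:R)) = j].
Proof.
move=> mf f1; pose y t := (f t + 1) * q.+1%:R.
have my : measurable_fun setT y.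
  by apply: measurable_funM => //; apply: measurable_funD.
rewrite (_ : [set t | _] = setT `&` y @^-1` `[j%:R, j.+1%:R[%classic).
  by apply: my => //; apply: measurable_itv.
rewrite setTI; apply/seteqP; split => t /=; rewrite in_itv /=.
  move=> <-; have [lt _] := grid1 q (f1 t); rewrite inordK //; apply: trunc_itv.
  by rewrite mulr_ge0 //; have := f1 t; rewrite ler_norml => /andP[]; lra.
by move=> /trunc_def e; apply: val_inj; rewrite /= inordK -/(y t) e.
Qed.

(** A measurable function with values in the unit disc is uniformly
    approximated by rounding its values to a grid. *)
Lemma cmeasurable_grid (m : T -> R[i]) (q : nat) : cmeasurable m ->
  (forall t, cmod (m t) <= 1) ->
  exists (J : finType) (g : T -> J) (c : J -> R[i]), measurable_part g /\
    forall t, cmod (m t - c (g t)) <= 2 / q.+1%:R.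
Proof.
move=> [m1 m2] h1; exists _, (cell q m), (@corner q); split.
  move=> [a b]; rewrite (_ : _ @^-1` _ =
    [set t | inord (Num.trunc ((complex.Re (m t) + 1) * q.+1%:R)) = a] `&`
    [set t | inord (Num.trunc ((complex.Im (m t) + 1) * q.+1%:R)) = b]).
    apply: measurableI; apply: measurable_trunc => // t.
      exact: le_trans (Re_le_cmod _) (h1 t).
    exact: le_trans (Im_le_cmod _) (h1 t).
  by apply/seteqP; split => t /=; rewrite /cell; [case=> -> ->|case=> -> ->].
move=> t; have hr : `|complex.Re (m t)| <= 1 := le_trans (Re_le_cmod _) (h1 t).
have hi : `|complex.Im (m t)| <= 1 := le_trans (Im_le_cmod _) (h1 t).
have [lr er] := grid1 q hr; have [li ei] := grid1 q hi.
rewrite (complexE (m t - _)); apply: le_trans (cmodD _ _) _.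
rewrite cmodM !cmodr (_ : cmod 'i%C = 1); last first.
  by rewrite /cmod normc_def /= expr0n expr1n add0r sqrtr1.
rewrite mul1r (_ : 2 / _ = q.+1%:R^-1 + q.+1%:R^-1); last by rewrite mulrDl mul1r.
apply: lerD.
  rewrite (_ : complex.Re _ = complex.Re (m t) - complex.Re (corner (cell q m t))).
    by rewrite /= inordK.
  by case: (m t).
rewrite (_ : complex.Im _ = complex.Im (m t) - complex.Im (corner (cell q m t))).
  by rewrite /= inordK.
by case: (m t).
Qed.

Lemma cvg_grid (c : R) : (fun q : nat => 2 / q.+1%:R * c) @ \oo --> (0 : R).
Proof.
rewrite -[X in _ --> X](mulr0 (2 * c)).
rewrite (_ : (fun q => _) = (fun q : nat => (2 * c) * q.+1%:R^-1)).
  by apply: cvgMr; apply: cvg_harmonic.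
by apply/funext => q; rewrite mulrAC.
Qed.

Lemma strongly_measurable_cmeasurable {X : normedModType R[i]} (m : T -> R[i]) (x : X) :
  cmeasurable m -> (forall t, cmod (m t) <= 1) ->
  strongly_measurable (fun t => m t *: x).
Proof.
move=> hm m1.
have /choice[s hs] : forall q : nat, exists s : T -> X, is_simple s /\
    forall t, cnorm (m t *: x - s t) <= 2 / q.+1%:R * cnorm x.
  move=> q; have [J [g [c [mg hc]]]] := cmeasurable_grid q hm m1.
  exists (fun t => c (g t) *: x); split.
    exact: (is_simple_part (fun j => c j *: x)).
  by move=> t; rewrite -scalerBl cnormZ ler_wpM2r ?cnorm_ge0.
exists s => [q|t]; first by have [] := hs q.
apply/cvg_cnorm => e e0; have /cvgrPdist_lt/(_ _ e0) h := cvg_grid (cnorm x).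
near=> q; have [_ hq] := hs q; apply: le_lt_trans (hq t) _.
apply: le_lt_trans (ler_norm _) _.
by rewrite -normrN -(sub0r (2 / _ * _)); near: q.
Unshelve. all: by end_near.
Qed.

End Grid.

Section Haar.
Local Open Scope classical_set_scope.
Context {R : realType} {X : normedModType R[i]}.
Variables (mu : probability (torus R) R) (mu_haar : is_haar mu).
Implicit Types (z w : torus R) (a : multi_index).

Lemma haar_integral (w : torus R) (h : torus R -> R) : measurable_fun setT h ->
  (forall z, 0 <= h z) ->
  (\int[mu]_z (h (torus_mul w z))%:E = \int[mu]_z (h z)%:E)%E.
Proof.
move=> mh h0; have mw := @measurable_torus_mul R w.
have := @ge0_integral_pushforward _ _ _ _ R _ mw mu setT (fun z => (h z)%:E) measurableT.
rewrite preimage_setT => <-.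
- apply: eq_measure_integral => A mA _; exact: mu_haar.
- by apply/measurable_EFinP.
- by move=> z _; rewrite lee_fin.
Qed.

Lemma mass_haar (J : finType) (w : torus R) (g : torus R -> J) (j : J) :
  measurable_part g -> mass mu (fun z => g (torus_mul w z)) j = mass mu g j.
Proof. by move=> mg; rewrite /mass; congr fine; apply: (mu_haar w (mg j)). Qed.

Lemma measurable_part_haar (J : finType) (w : torus R) (g : torus R -> J) :
  measurable_part g -> measurable_part (fun z => g (torus_mul w z)).
Proof.
move=> mg j; rewrite -[X in measurable X]setTI.
exact: (@measurable_torus_mul R w measurableT _ (mg j)).
Qed.

(** A bounded function that a translation multiplies by [-1] has mean zero; it
    is approximated by simple functions with the same property. *)
Lemma is_bochner_integral_odd (m : torus R -> R[i]) (w : torus R) (x : X) :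
  cmeasurable m -> (forall z, cmod (m z) <= 1) ->
  (forall z, m (torus_mul w z) = - m z) ->
  is_bochner_integral mu (fun z => m z *: x) 0.
Proof.
move=> hm m1 mw.
have h2 : cmod (2^-1 : R[i]) = 2^-1.
  by rewrite cmodV -[2](rmorph_nat (real_complex R)) cmodr ger0_norm.
have /choice[s hs] : forall q : nat, exists s : torus R -> X,
    [/\ is_simple s, forall z, cnorm (m z *: x - s z) <= 2 / q.+1%:R * cnorm x &
      simple_integral mu s = 0].
  move=> q; have [J [g [c [mg hc]]]] := cmeasurable_grid q hm m1.
  pose g' z := g (torus_mul w z).
  have mg' : measurable_part g' by apply: measurable_part_haar.
  have s1 : is_simple (fun z => c (g z) *: x) by exact: (is_simple_part (fun j => c j *: x)).
  have s2 : is_simple (fun z => c (g' z) *: x) by exact: (is_simple_part (fun j => c j *: x)).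
  exists (fun z => 2^-1 *: (c (g z) *: x + (-1) *: (c (g' z) *: x))); split.
  - by apply: is_simpleZ; apply: is_simpleD => //; apply: is_simpleZ.
  - move=> z; have -> : m z *: x - 2^-1 *: (c (g z) *: x + (-1) *: (c (g' z) *: x)) =
      (2^-1 * ((m z - c (g z)) - (m (torus_mul w z) - c (g' z)))) *: x.
      rewrite mw scaleN1r -scalerBl scalerA -scalerBl; congr (_ *: _).
      by field.
    rewrite cnormZ ler_wpM2r ?cnorm_ge0 // cmodM h2.
    have h3 := cmodD (m z - c (g z)) (- (m (torus_mul w z) - c (g' z))).
    rewrite cmodN in h3; have h4 := hc z; have h5 := hc (torus_mul w z).
    rewrite -/(g' z) in h5; move: h3 h4 h5.
    set u := cmod _; set v := cmod _; set v' := cmod _; set r := 2 / _.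
    by move=> h3 h4 h5; lra.
  - rewrite simple_integralZ; last first.
      by apply: is_simpleD => //; apply: is_simpleZ.
    rewrite simple_integralD ?simple_integralZ //; last exact: is_simpleZ.
    rewrite !(simple_integral_part mu (fun j => c j *: x)) //.
    under [X in _ + _ *: X]eq_bigr => j _ do rewrite mass_haar //.
    by rewrite scaleN1r subrr scaler0.
apply: (@is_bochner_integral_unif _ _ _ _ _ _ s (fun q => 2 / q.+1%:R * cnorm x)).
- by move=> q; have [] := hs q.
- by move=> q z; have [_] := hs q.
- exact: cvg_grid.
- under eq_fun => q do have [_ _ ->] := hs q.
  exact: cvg_cst.
Qed.

End Haar.

Section Polynomials.
Local Open Scope classical_set_scope.
Context {R : realType} {X : normedModType R[i]}.
Variables (mu : probability (torus R) R) (mu_haar : is_haar mu).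
Implicit Types (z w : torus R) (a : multi_index) (f : torus R -> X).

Lemma root_neg1 (k : int) : k != 0 -> exists u : circle R, (u : R[i]) ^ k = -1.
Proof.
move=> k0; have n0 : (0 < absz k)%N by rewrite absz_gt0.
pose v : R[i] := (absz k).-root (-1).
have vn : v ^+ absz k = -1 by rewrite rootCK.
have v1 : cmod v = 1.
  apply/eqP; rewrite -(@pexpr_eq1 _ _ (absz k)) ?cmod_ge0 //.
  by rewrite -cmodX vn cmodN cmod1.
exists (circle_of v1) => /=.
have key (u : R[i]) : u ^+ absz k = -1 -> u ^ k = -1.
  case: (k) => m /= um; first by rewrite -exprnP.
  by rewrite NegzE -exprnN um invrN1.
exact: key.
Qed.

Lemma monomial_single a (i : nat) (u : circle R) :
  monomial a (fun k => if k == i then u else Circle (introT eqP (normr1 R[i]))) =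
  (u : R[i]) ^ a i.
Proof.
have [s hs] := multi_index_supp a.
rewrite (@monomialE _ (s + i.+1)); last by move=> k /hs; lia.
have lt : (i < s + i.+1)%N by lia.
rewrite (bigD1 (Ordinal lt)) //= eqxx big1 ?mulr1 // => k ki.
rewrite (_ : (val k == i) = false) ?exp1rz //.
by apply: contraNF ki => /eqP ki; apply/eqP/val_inj.
Qed.

(** If the two characters differ in one coordinate, some rotation of this coordinate
    multiplies their quotient by [-1]. *)
Lemma chi_fourier a n (x : X) :
  is_bochner_integral mu (fun z => ((monomial a z)^-1 * chi n z) *: x)
    (if nat_index n == a then x else 0).
Proof.
have [<-|/eqP ne] := eqVneq (nat_index n) a.
  apply: eq_bochner_integral (is_bochner_integral_cst mu x) => z.
  by rewrite /chi mulVf ?monomial_neq0 // scale1r.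
have [i hi] : exists i, nat_index n i - a i != 0.
  apply: contrapT => h; apply: ne; apply/fsfunP => i; apply/eqP.
  by rewrite -subr_eq0; apply: contrapT => /negP hi; apply: h; exists i.
have [u hu] := root_neg1 hi.
pose w : torus R := fun k => if k == i then u else Circle (introT eqP (normr1 R[i])).
apply: (@is_bochner_integral_odd _ _ _ mu_haar _ w).
- apply: cmeasurableM; last exact: cmeasurable_monomial.
  by apply: cmeasurableV; [exact: cmeasurable_monomial|move=> z; apply: cmod_monomial].
- by move=> z; rewrite cmodM cmodV cmod_chi cmod_monomial invr1 mulr1.
- move=> z; rewrite /chi !monomial_mul invfM mulrACA.
  rewrite !monomial_single.
  have -> : ((u : R[i]) ^ a i)^-1 * (u : R[i]) ^ nat_index n i = -1.
    by rewrite mulrC invr_expz -expfzDr ?circle_neq0.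
  by rewrite mulN1r.
Qed.

(** The Bohr lift of the Dirichlet polynomial with coefficients [x]. *)
Definition dpoly N (x : 'I_N -> X) z : X := \sum_(i < N) chi i.+1 z *: x i.

Lemma cmeasurable_chi n : cmeasurable (fun z : torus R => chi n z).
Proof. exact: cmeasurable_monomial. Qed.

Lemma strongly_measurable_dpoly N (x : 'I_N -> X) : strongly_measurable (dpoly x).
Proof.
apply: (strongly_measurable_sum mu) => i; apply: strongly_measurable_cmeasurable.
  exact: cmeasurable_chi.
by move=> z; rewrite cmod_chi.
Qed.

Definition L2sq f : \bar R := (\int[mu]_z (cnorm (f z) ^+ 2)%:E)%E.

Lemma L2sq_ge0 f : (0 <= L2sq f)%E.
Proof. by apply: integral_ge0 => z _; rewrite lee_fin sqr_ge0. Qed.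

Lemma Lp_norm_sq f : ((Lp_norm mu 2 f) `^ 2 = L2sq f)%E.
Proof.
rewrite /Lp_norm poweR_Lnorm ?pnatr_eq0 //; apply: eq_integral => z _ /=.
by rewrite -[2]/(2%:R) ger0_norm ?cnorm_ge0 // powR_mulrn ?cnorm_ge0.
Qed.

Lemma Lp_norm_sqrt f : (Lp_norm mu 2 f = (L2sq f) `^ 2^-1)%E.
Proof. by rewrite -Lp_norm_sq -poweRrM divff ?pnatr_eq0 // poweRe1 // Lnorm_ge0. Qed.

Lemma cnorm_dpoly_le N (x : 'I_N -> X) z : cnorm (dpoly x z) <= \sum_i cnorm (x i).
Proof.
apply: le_trans (ler_cnorm_sum _ _ _) _; apply: ler_sum => i _.
by rewrite cnormZ cmod_chi mul1r.
Qed.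

Lemma measurable_sqr_cnorm f : strongly_measurable f ->
  measurable_fun setT (fun z => cnorm (f z) ^+ 2).
Proof. by move=> mf; apply: measurable_funX; apply: strongly_measurable_cnorm. Qed.

Lemma integral_le_cst (h : torus R -> R) (c : R) : measurable_fun setT h ->
  (forall z, 0 <= h z) -> (forall z, h z <= c) -> (\int[mu]_z (h z)%:E <= c%:E)%E.
Proof.
move=> mh h0 hc; apply: (@le_trans _ _ (\int[mu]_(z in setT) cst c%:E z)%E).
  apply: ge0_le_integral => //.
  - by move=> z _; rewrite lee_fin.
  - exact/measurable_EFinP.
  - by move=> z _; rewrite lee_fin.
rewrite integral_cst // [X in (_ * X)%E](_ : _ = 1%E); last exact: probability_setT.
by rewrite mule1.
Qed.

Lemma L2sq_dpoly_lty N (x : 'I_N -> X) : (L2sq (dpoly x) < +oo)%E.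
Proof.
apply: (@le_lt_trans _ _ ((\sum_i cnorm (x i)) ^+ 2)%:E); last exact: ltry.
apply: integral_le_cst.
- apply: measurable_sqr_cnorm; apply: strongly_measurable_dpoly.
- by move=> z; apply: sqr_ge0.
- move=> z; rewrite ler_sqr ?nnegrE ?cnorm_ge0 ?cnorm_dpoly_le //.
  by apply: sumr_ge0 => i _; apply: cnorm_ge0.
Qed.

Lemma dpoly_fourier N (x : 'I_N -> X) a : is_fourier_coef mu (dpoly x) a
  (\sum_(i < N) if nat_index i.+1 == a then x i else 0).
Proof.
rewrite /is_fourier_coef.
have -> : (fun w => (monomial a w)^-1 *: dpoly x w) =
    (fun w => \sum_(i < N) ((monomial a w)^-1 * chi i.+1 w) *: x i).
  apply/funext => w; rewrite /dpoly scaler_sumr; apply: eq_bigr => i _.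
  by rewrite scalerA.
apply: (is_bochner_integral_sum _
  (F := fun (i : 'I_N) w => ((monomial a w)^-1 * chi i.+1 w) *: x i)) => i.
exact: chi_fourier.
Qed.

Lemma represents_dpoly N (x : 'I_N -> X) : represents mu 2 (dpoly x) (dirichlet_poly x).
Proof.
split; [split; [split|]|].
- exact: strongly_measurable_dpoly.
- by rewrite Lp_norm_sqrt poweR_lty // L2sq_dpoly_lty.
- move=> a na; have := dpoly_fourier x a; rewrite big1 // => i _.
  by case: eqP => // e; case: na; rewrite -e; apply: nat_index_nonneg.
move=> a na; have := dpoly_fourier x a; rewrite /dirichlet_poly [X in _ -> is_fourier_coef _ _ _ X]big_mkcond.
rewrite (eq_bigr (fun i : 'I_N => if i.+1 == index_nat a then x i else 0)) // => i _.
congr (if _ then _ else _); apply/eqP/eqP => [<-|->].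
  by rewrite nat_indexK.
exact: index_natK.
Qed.

Definition hp N (x : 'I_N -> X) : R := fine (dirichlet_Hp_norm mu 2 (dirichlet_poly x)).

Lemma Hp_norm_ge0 (D : nat -> X) : (0 <= dirichlet_Hp_norm mu 2 D :> \bar R)%E.
Proof. by apply: le_ereal_inf_tmp => _ [f _ <-]; apply: Lnorm_ge0. Qed.

Lemma Hp_norm_dpoly N (x : 'I_N -> X) :
  (dirichlet_Hp_norm mu 2 (dirichlet_poly x) <= Lp_norm mu 2 (dpoly x))%E.
Proof. by apply: ereal_inf_lbound; exists (dpoly x) => //; apply: represents_dpoly. Qed.

Lemma hpE N (x : 'I_N -> X) : (dirichlet_Hp_norm mu 2 (dirichlet_poly x) = (hp x)%:E)%E.
Proof.
rewrite fineK // ge0_fin_numE ?Hp_norm_ge0 //.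
apply: le_lt_trans (Hp_norm_dpoly x) _.
by rewrite Lp_norm_sqrt poweR_lty // L2sq_dpoly_lty.
Qed.

Lemma hp_ge0 N (x : 'I_N -> X) : 0 <= hp x.
Proof. by rewrite fine_ge0 // Hp_norm_ge0. Qed.

Lemma sqr_hp_le N (x : 'I_N -> X) : (((hp x) ^+ 2)%:E <= L2sq (dpoly x))%E.
Proof.
rewrite -Lp_norm_sq -powR_mulrn ?hp_ge0 // -poweR_EFin -hpE.
apply: gt0_ler_poweR => //; rewrite ?in_itv /= ?andbT ?leey ?Hp_norm_ge0 ?Lnorm_ge0 //.
exact: Hp_norm_dpoly.
Qed.

Lemma hp_ge N (x : 'I_N -> X) (A : R) : 0 <= A ->
  (forall f, represents mu 2 f (dirichlet_poly x) -> forall B : R,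
     L2sq f = B%:E -> A ^+ 2 <= B) -> A <= hp x.
Proof.
move=> A0 h; rewrite -lee_fin -hpE; apply: le_ereal_inf_tmp => _ [f rf <-].
have f0 := L2sq_ge0 f; rewrite Lp_norm_sqrt.
case E : (L2sq f) f0 => [B| |] // B0; last by rewrite poweRyr ?leey ?invr_neq0.
have hB := h f rf B E; rewrite poweR_EFin lee_fin powR12_sqrt //.
by rewrite -(ler_sqr A0) ?nnegrE ?sqrtr_ge0 // sqr_sqrtr.
Qed.

(** The mean over the torus is the mean of the means over the translates by
    finitely many points. *)
Lemma sum_sqr_hp_le (E H : finType) N (x : E -> 'I_N -> X) (t : H -> torus R) (A : R) :
  (0 < #|H|)%N ->
  (forall z, \sum_e \sum_h cnorm (dpoly (x e) (torus_mul (t h) z)) ^+ 2 <= #|H|%:R * A) ->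
  \sum_e hp (x e) ^+ 2 <= A.
Proof.
move=> H0 hA; have hH : 0 < #|H|%:R :> R by rewrite ltr0n.
rewrite -(ler_pM2l hH) -lee_fin.
have mP e h : measurable_fun setT (fun z => cnorm (dpoly (x e) (torus_mul (t h) z)) ^+ 2).
  have := measurable_sqr_cnorm (strongly_measurable_dpoly (x e)).
  by move=> m1; apply: (measurableT_comp m1 (@measurable_torus_mul R (t h))).
have step e : ((#|H|%:R * hp (x e) ^+ 2)%:E <=
    \int[mu]_z (\sum_h cnorm (dpoly (x e) (torus_mul (t h) z)) ^+ 2)%:E)%E.
  under eq_integral => z _ do rewrite -sumEFin.
  rewrite ge0_integral_sum //; last first.
  - by move=> h z _; rewrite lee_fin sqr_ge0.
  - by move=> h; apply/measurable_EFinP.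
  rewrite (eq_bigr (fun=> L2sq (dpoly (x e)))); last first.
    move=> h _; apply: (haar_integral mu_haar (t h) (h := fun z => cnorm (dpoly (x e) z) ^+ 2)).
      apply: measurable_sqr_cnorm; apply: strongly_measurable_dpoly.
    by move=> z; apply: sqr_ge0.
  rewrite mulr_natl -sumr_const -sumEFin; apply: lee_sum => h _.
  exact: sqr_hp_le.
rewrite mulr_sumr -sumEFin.
apply: (@le_trans _ _ (\sum_e \int[mu]_z
    (\sum_h cnorm (dpoly (x e) (torus_mul (t h) z)) ^+ 2)%:E)%E).
  by apply: lee_sum => e _; apply: step.
rewrite -ge0_integral_sum //; last first.
- by move=> e z _; rewrite lee_fin sumr_ge0 // => h _; apply: sqr_ge0.
- by move=> e; apply/measurable_EFinP; apply: measurable_sum => h; apply: mP.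
under eq_integral => z _ do rewrite sumEFin.
apply: integral_le_cst => //.
- by apply: measurable_sum => e; apply: measurable_sum => h; apply: mP.
- by move=> z; apply: sumr_ge0 => e _; apply: sumr_ge0 => h _; apply: sqr_ge0.
Qed.

(** Finite linear combinations of Fourier coefficients are integrals against
    trigonometric polynomials. If these are dominated by translates of one
    function, the coefficients are square summable by the Schur test. *)
Lemma schur_test (I H : finType) f (al : I -> multi_index) (v : I -> X)
    (c : H -> I -> R[i]) (t : H -> torus R) (g : torus R -> R) (G B : R) :
  (forall i, is_fourier_coef mu f (al i) (v i)) -> strongly_measurable f ->
  L2sq f = B%:E -> (0 < #|H|)%N -> 0 < G ->
  measurable_fun setT g -> (forall z, 0 <= g z) ->
  (forall h z, cmod (\sum_i c h i * (monomial (al i) z)^-1) <= g (torus_mul (t h) z)) ->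
  (forall z, \sum_h g (torus_mul (t h) z) <= G) ->
  \sum_h cnorm (\sum_i c h i *: v i) ^+ 2 <= G ^+ 2 / #|H|%:R * B.
Proof.
move=> fv mf fB H0 G0 mg g0 cg gG.
have hH : 0 < #|H|%:R :> R by rewrite ltr0n.
pose gh h z := g (torus_mul (t h) z).
have mgh h : measurable_fun setT (gh h).
  exact: (measurableT_comp mg (@measurable_torus_mul R (t h))).
pose b := G / #|H|%:R; have b0 : 0 < b by rewrite divr_gt0.
have mcf := strongly_measurable_cnorm mf.
have m2 := measurable_sqr_cnorm mf.
have int_gh h : (\int[mu]_z (gh h z)%:E <= b%:E)%E.
  have E h' : (\int[mu]_z (gh h' z)%:E = \int[mu]_z (g z)%:E)%E by apply: haar_integral.
  have S : (\sum_(h' : H) \int[mu]_z (g z)%:E <= G%:E)%E.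
    rewrite (eq_bigr (fun h' => \int[mu]_z (gh h' z)%:E)%E); last by move=> h' _; rewrite E.
    rewrite -ge0_integral_sum //; last first.
    - by move=> h' z _; rewrite lee_fin g0.
    - by move=> h'; apply/measurable_EFinP.
    under eq_integral => z _ do rewrite sumEFin.
    apply: integral_le_cst => //; first by apply: measurable_sum.
    by move=> z; apply: sumr_ge0 => h' _; apply: g0.
  have i0 : (0 <= \int[mu]_z (g z)%:E)%E by apply: integral_ge0 => z _; rewrite lee_fin.
  rewrite E; case Ei : (\int[mu]_z (g z)%:E)%E S i0 => [r| |] //.
    by rewrite sumEFin sumr_const !lee_fin -mulr_natl ler_pdivlMr // mulrC.
  move=> S _; exfalso; move: S.
  have [h0 _] : exists h0 : H, true by case/card_gt0P: H0 => h0 _; exists h0.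
  rewrite (bigD1 h0) //= addye ?leye_eq //.
  by rewrite gt_eqF //; apply: (lt_le_trans (ltNyr 0)); apply: sume_ge0.
pose Ih h := (\int[mu]_z (gh h z * cnorm (f z) ^+ 2)%:E)%E.
have mI h : measurable_fun setT (fun z => gh h z * cnorm (f z) ^+ 2).
  exact: measurable_funM.
have sumI : (\sum_h Ih h <= (G * B)%:E)%E.
  rewrite /Ih -ge0_integral_sum //; last first.
  - by move=> h z _; rewrite lee_fin mulr_ge0 ?g0 ?sqr_ge0.
  - by move=> h; apply/measurable_EFinP.
  under eq_integral => z _ do rewrite sumEFin -mulr_suml.
  rewrite EFinM -fB -ge0_integralZl_EFin ?(ltW G0) //; last 2 first.
  - by move=> z _; rewrite lee_fin sqr_ge0.
  - exact/measurable_EFinP.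
  apply: ge0_le_integral => //.
  - by move=> z _; rewrite lee_fin mulr_ge0 ?sqr_ge0 // sumr_ge0 // => h _; apply: g0.
  - by apply/measurable_EFinP; apply: measurable_funM => //; apply: measurable_sum.
  - by apply/measurable_EFinP; apply: measurable_funM.
  - by move=> z _; rewrite -EFinM lee_fin ler_wpM2r ?sqr_ge0 ?gG.
pose V h := \sum_i c h i *: v i.
have hV h : ((cnorm (V h) ^+ 2)%:E <= b%:E * Ih h)%E.
  have bV : is_bochner_integral mu (fun z => (\sum_i c h i * (monomial (al i) z)^-1) *: f z) (V h).
    rewrite (_ : (fun z => _) = (fun z => \sum_i c h i *: ((monomial (al i) z)^-1 *: f z))).
      apply: (is_bochner_integral_sum _ (F := fun i z => c h i *: ((monomial (al i) z)^-1 *: f z))).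
      by move=> i; apply: is_bochner_integralZ; apply: fv.
    by apply/funext => z; rewrite scaler_suml; apply: eq_bigr => i _; rewrite scalerA.
  set s := cnorm (V h) / b; have s0 : 0 <= s by apply: divr_ge0; [apply: cnorm_ge0|apply: ltW].
  have s2 : 0 <= 2 * s by apply: mulr_ge0.
  have := cnorm_bochner_integral (is_bochner_integralZ (2 * s)%:C bV).
  rewrite cnormZr (ger0_norm s2) => h1.
  have [mk _] := is_bochner_integralZ (2 * s)%:C bV.
  have h2 := @le_integralD _ _ _ mu _ (fun z => gh h z * cnorm (f z) ^+ 2)
    (fun z => s ^+ 2 * gh h z) (strongly_measurable_cnorm mk) (mI h).
  have {}h2 := le_trans h1 (h2 _ _ _ _ _).
  have {}h2 : ((2 * s * cnorm (V h))%:E <= Ih h + (s ^+ 2 * b)%:E)%E.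
    apply: le_trans (h2 _ _ _ _ _) _.
    - exact: measurable_funM.
    - by move=> z; apply: cnorm_ge0.
    - by move=> z; rewrite mulr_ge0 ?sqr_ge0 ?g0.
    - by move=> z; rewrite mulr_ge0 ?sqr_ge0 ?g0.
    - move=> z; rewrite !cnormZ cmodr (ger0_norm s2).
      apply: le_trans (_ : 2 * s * (gh h z * cnorm (f z)) <= _).
        apply: ler_wpM2l => //; apply: ler_wpM2r; first exact: cnorm_ge0.
        exact: cg.
      have -> : gh h z * cnorm (f z) ^+ 2 + s ^+ 2 * gh h z =
         2 * s * (gh h z * cnorm (f z)) + gh h z * (cnorm (f z) - s) ^+ 2 by ring.
      by rewrite lerDl mulr_ge0 ?sqr_ge0 ?g0.
    rewrite leeD2l // EFinM -(_ : (s ^+ 2)%:E * \int[mu]_z (gh h z)%:E =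
      \int[mu]_z (s ^+ 2 * gh h z)%:E)%E; last first.
      rewrite -ge0_integralZl_EFin ?sqr_ge0 //.
        by move=> z _; rewrite lee_fin g0.
      exact/measurable_EFinP.
    by apply: lee_wpmul2l => //; rewrite lee_fin sqr_ge0.
  have I0 : (0 <= Ih h)%E by apply: integral_ge0 => z _; rewrite lee_fin mulr_ge0 ?sqr_ge0 ?g0.
  case EI : (Ih h) h2 I0 => [r| |] //.
    rewrite -EFinD -EFinM !lee_fin /s => h2 _.
    have e1 : 2 * (cnorm (V h) / b) * cnorm (V h) = 2 * (cnorm (V h) ^+ 2 / b) by ring.
    have e2 : (cnorm (V h) / b) ^+ 2 * b = cnorm (V h) ^+ 2 / b by field; rewrite lt0r_neq0.
    by rewrite e1 e2 in h2; rewrite mulrC -ler_pdivrMr //; lra.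
  by move=> _ _; rewrite gt0_muley ?leey // lte_fin.
rewrite -lee_fin -sumEFin.
apply: (@le_trans _ _ (\sum_h b%:E * Ih h)%E); first by apply: lee_sum => h _; apply: hV.
rewrite -ge0_sume_distrr; last first.
  by move=> h _; apply: integral_ge0 => z _; rewrite lee_fin mulr_ge0 ?sqr_ge0 ?g0.
have -> : G ^+ 2 / #|H|%:R * B = b * (G * B) by rewrite /b; ring.
by rewrite [leRHS]EFinM; apply: lee_wpmul2l => //; rewrite lee_fin ltW.
Qed.

End Polynomials.

(** * Norms of Dirichlet polynomials and finite Fourier transforms *)

Section Kronecker.
Context {R : realType}.

Lemma cmod_conjV (z : R[i]) : cmod z = 1 -> z^-1 = z^*%C.
Proof. by move=> h; rewrite invc_norm cmodE h rmorph1 expr1n invr1 mul1r. Qed.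

Lemma cmod_sum_inv (A : finType) (F : A -> R[i]) : (forall a, cmod (F a) = 1) ->
  cmod (\sum_a (F a)^-1) = cmod (\sum_a F a).
Proof.
move=> h; rewrite -[RHS]cmodJ rmorph_sum; congr cmod.
by apply: eq_bigr => a _; rewrite cmod_conjV.
Qed.

Lemma parseval_chars (A : finType) (n : nat) (r : R[i]) (e : A -> nat) (la : A -> R[i]) :
  n.-primitive_root r -> cmod r = 1 -> (forall a, (e a < n)%N) -> injective e ->
  \sum_(h < n) cmod (\sum_a r ^+ (h * e a) * la a) ^+ 2 = n%:R * \sum_a cmod (la a) ^+ 2.
Proof.
move=> pr r1 en eI; apply: complexI; rewrite rmorph_sum rmorphM rmorph_sum /=.
have rJ m : (r ^+ m)^*%C = r ^- m.
  by rewrite rmorphXn /= -cmod_conjV // exprVn.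
transitivity (\sum_(h < n) \sum_a \sum_b
    (la a * (la b)^*%C) * (r ^+ (h * e a) * r ^- (h * e b))).
  apply: eq_bigr => h _; rewrite -mulcJ rmorph_sum big_distrlr /=.
  apply: eq_bigr => a _; apply: eq_bigr => b _; rewrite rmorphM /= rJ; ring.
rewrite exchange_big mulr_sumr; apply: eq_bigr => a _.
rewrite exchange_big (bigD1 a) //= -mulr_sumr (prim_root_sum _ _ pr) eqxx.
rewrite big1 => [|b ba]; last first.
  rewrite -mulr_sumr (prim_root_sum _ _ pr) !modn_small ?en //.
  by rewrite (inj_eq eI) eq_sym (negbTE ba) mulr0.
by rewrite addr0 mulcJ mulrC rmorph_nat.
Qed.

Definition bmon s (a : 'I_s -> nat) (z : torus R) : R[i] := \prod_(i < s) (z i : R[i]) ^+ a i.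

Lemma cmod_bmon s (a : 'I_s -> nat) z : cmod (bmon a z) = 1.
Proof.
apply: (big_ind (fun u => cmod u = 1)); first exact: cmod1.
  by move=> u v hu hv; rewrite cmodM hu hv mulr1.
by move=> i _; rewrite cmodX cmod_circle expr1n.
Qed.

Lemma bmon_neq0 s (a : 'I_s -> nat) z : bmon a z != 0.
Proof.
by apply/eqP => m0; have := cmod_bmon a z; rewrite m0 cmod0 => /eqP;
  rewrite eq_sym oner_eq0.
Qed.

Lemma bmon_mul s (a : 'I_s -> nat) w z : bmon a (torus_mul w z) = bmon a w * bmon a z.
Proof. by rewrite /bmon -big_split; apply: eq_bigr => i _; rewrite /= exprMn. Qed.

Lemma cmeasurable_bmon s (a : 'I_s -> nat) : cmeasurable (fun z : torus R => bmon a z).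
Proof.
by apply: cmeasurable_prod => i; apply: cmeasurableX; apply: cmeasurable_coord.
Qed.

(** Exponents less than [q] are the digits of this number in base [q]. *)
Definition bcode q s (a : 'I_s -> nat) : nat := (\sum_(i < s) a i * q ^ i)%N.

Lemma bcode_lt q s (a : 'I_s -> nat) : (forall i, a i < q)%N -> (bcode q a < q ^ s)%N.
Proof.
elim: s a => [|s IH] a ha; first by rewrite /bcode big_ord0.
rewrite /bcode big_ord_recr /= expnS.
have := IH (fun i => a (widen_ord (leqnSn s) i)) (fun i => ha _); rewrite /bcode /=.
have := ha ord_max; set S := (\sum_(i < s) _)%N => h1 h2.
apply: (@leq_trans (q ^ s + a ord_max * q ^ s)); first by rewrite ltn_add2r.
by rewrite -mulSn leq_mul2r h1 orbT.
Qed.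

Lemma bcode_inj q s (a b : 'I_s -> nat) : (forall i, a i < q)%N -> (forall i, b i < q)%N ->
  bcode q a = bcode q b -> a =1 b.
Proof.
elim: s a b => [|s IH] a b ha hb; first by move=> _ [].
rewrite /bcode !big_ord_recl !expn0 !muln1.
have E (c : 'I_s.+1 -> nat) : (\sum_(i < s) c (lift ord0 i) * q ^ lift ord0 i =
    q * bcode q (fun i => c (lift ord0 i)))%N.
  by rewrite /bcode big_distrr; apply: eq_bigr => i _; rewrite /= expnS; ring.
rewrite !E => e; have q0 : (0 < q)%N by apply: leq_ltn_trans (ha ord0).
have e0 : a ord0 = b ord0.
  by have := congr1 (modn^~ q) e; rewrite /= ![(_ ord0 + _)%N]addnC ![(q * _)%N]mulnC !modnMDl !modn_small.
move: e; rewrite e0 => /addnI /eqP; rewrite eqn_pmul2l // => /eqP /IH h i.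
case: (unliftP ord0 i) => [j ->|-> //]; apply: h => k; [exact: ha|exact: hb].
Qed.

(** Powers of one root of unity, with exponents the powers of [q], give a point
    of the torus at which monomials of degrees less than [q] are separated. *)
Definition kpoint (u : circle R) q (h : nat) : torus R := fun i => circle_exp u (h * q ^ i).

Lemma bmon_kpoint u q h s (a : 'I_s -> nat) :
  bmon a (kpoint u q h) = (u : R[i]) ^+ (h * bcode q a).
Proof.
rewrite /bmon /bcode big_distrr /= -prodrXr; apply: eq_bigr => i _.
by rewrite /= -exprM; congr (_ ^+ _); ring.
Qed.

End Kronecker.

Section LowerBound.
Local Open Scope classical_set_scope.
Context {R : realType} {X : normedModType R[i]}.
Variables (mu : probability (torus R) R) (mu_haar : is_haar mu).

Lemma logn_lt p n : (0 < n)%N -> (logn p n < n)%N.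
Proof.
move=> n0; case pp : (prime p); last by rewrite lognE pp.
apply: leq_trans (ltn_expl _ (prime_gt1 pp)) _.
by apply: dvdn_leq => //; apply: pfactor_dvdnn.
Qed.

Variable N : nat.
(* The side of the box [S]; it is so much larger than the exponents, which are less
   than [N], that [S'] has at most twice as many elements as [S]. *)
Let D := (2 * N * N).+1.
Definition kron_base := (D + N)%N.
Local Notation q := kron_base.
Definition kron_exp := (q ^ N)%N.
Local Notation k := kron_exp.
Let S := {ffun 'I_N -> 'I_D}.
Let S' := {ffun 'I_N -> 'I_q}.
Let expo (n : 'I_N) (i : 'I_N) : nat := logn (nth_prime i) n.+1.

Let expo_lt n i : (expo n i < N)%N.
Proof. by apply: leq_trans (logn_lt _ _) _ => //; apply: ltn_ord. Qed.

Let q_lt2k : (q ^ N < 2 ^ k)%N. Proof. exact: ltn_expl. Qed.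

Lemma chi_bmon (n : 'I_N) (z : torus R) : chi n.+1 z = bmon (expo n) z.
Proof. by rewrite (@chiE _ N). Qed.

Let card_S' : (#|S'|%:R <= 2 * #|S|%:R :> R).
Proof.
rewrite !card_ffun !card_ord !natrX.
have qE : q%:R = D%:R + N%:R :> R by rewrite natrD.
have D0 : 0 <= D%:R :> R by apply: ler0n.
have N0 : 0 <= N%:R :> R by apply: ler0n.
(* Bernoulli's inequality for [1 - N / q = D / q], without denominators. *)
have Bern m : (q%:R - m%:R * N%:R) * q%:R ^+ m <= q%:R * D%:R ^+ m :> R.
  elim: m => [|m IH]; first by rewrite mul0r subr0 !expr0.
  rewrite [q%:R ^+ _]exprS [D%:R ^+ _]exprS.
  apply: le_trans (_ : D%:R * ((q%:R - m%:R * N%:R) * q%:R ^+ m) <= _); last first.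
    by rewrite [leRHS]mulrCA ler_wpM2l.
  rewrite !mulrA ler_wpM2r ?exprn_ge0 // -natr1 qE.
  have : 0 <= m%:R * (N%:R * N%:R) :> R by rewrite !mulr_ge0.
  by lra.
have DE : D%:R = 2 * N%:R * N%:R + 1 :> R by rewrite /D -addn1 natrD !natrM.
have q0 : 0 < q%:R :> R by rewrite qE DE; have := sqr_ge0 (N%:R : R); lra.
rewrite -(ler_pM2l q0); have := Bern N.
have : 0 <= (q%:R - 2 * (N%:R * N%:R)) * q%:R ^+ N :> R.
  by rewrite mulr_ge0 ?exprn_ge0 // qE DE; lra.
by lra.
Qed.

Lemma freq_lt (n : 'I_N) : (bcode q (expo n) < 2 ^ k)%N.
Proof.
apply: leq_ltn_trans (ltnW (bcode_lt _)) q_lt2k => i.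
by apply: leq_trans (expo_lt n i) _; rewrite leq_addl.
Qed.

Definition freq (n : 'I_N) : 'I_(2 ^ k) := Ordinal (freq_lt n).

Lemma freq_inj : injective freq.
Proof.
have lq n i : (expo n i < q)%N by apply: leq_trans (expo_lt n i) _; rewrite leq_addl.
move=> m n /(congr1 val) /= /(bcode_inj (lq m) (lq n)) e.
apply: val_inj; apply: succn_inj; apply: eqn_from_log => // p.
case pp : (prime p); last by rewrite lognE pp [RHS]lognE pp.
have [i <-] := nth_prime_surj pp; have [iN|Ni] := ltnP i N.
  exact: (e (Ordinal iN)).
by rewrite !logn_nth_prime_ge // (leq_trans (ltn_ord _) Ni).
Qed.

Lemma chi_kpoint (u : circle R) (n : 'I_N) h :
  chi n.+1 (kpoint u q h) = (u : R[i]) ^+ (h * freq n).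
Proof. by rewrite chi_bmon bmon_kpoint. Qed.

(** The transform of the coefficients is recovered by convolution with the
    kernel [(sum over S' of the monomials) * (sum over S of their conjugates)],
    where [S' = S + (exponents)]; its coefficients are constant on the
    spectrum of the polynomial, and its mean is bounded because the box [S] is
    much larger than the exponents. *)
Lemma sum_dft_le (u : circle R) (x : 'I_N -> X) : dyadic_root k (u : R[i]) ->
  \sum_(h < 2 ^ k) cnorm (\sum_n (u : R[i])^-1 ^+ (h * freq n) *: x n) ^+ 2 <=
  9 / 4 * (2 ^ k)%N%:R * hp mu x ^+ 2.
Proof.
move=> ru; set W := \sum_(h < _) _.
have M0 : 0 < (2 ^ k)%N%:R :> R by rewrite ltr0n expn_gt0.
have pr := dyadic_root_prim ru; have r1 := cmod_circle u.
have W0 : 0 <= W by apply: sumr_ge0 => h _; apply: sqr_ge0.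
suff main f : represents mu 2 f (dirichlet_poly x) -> forall B : R,
    L2sq mu f = B%:E -> W <= 9 / 4 * (2 ^ k)%N%:R * B.
  have c0 : 0 < 9 / 4 * (2 ^ k)%N%:R :> R by rewrite mulr_gt0 // divr_gt0.
  have : Num.sqrt (W / (9 / 4 * (2 ^ k)%N%:R)) <= hp mu x.
    apply: (hp_ge mu_haar (sqrtr_ge0 _)) => f rf B fB.
    rewrite sqr_sqrtr ?divr_ge0 ?(ltW c0) // ler_pdivrMr // mulrC.
    exact: main rf B fB.
  rewrite -ler_sqr ?nnegrE ?sqrtr_ge0 ?hp_ge0 //.
  by rewrite sqr_sqrtr ?divr_ge0 ?(ltW c0) // ler_pdivrMr // mulrC.
move=> [[[mf _] f0] fc] B fB.
pose an (a : S') : 'I_N -> nat := fun i => a i; pose bn (b : S) : 'I_N -> nat := fun i => b i.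
pose al (p : S' * S) : multi_index :=
  mindex N (fun i => if insub i is Some j then (an p.1 j)%:Z - (bn p.2 j)%:Z else 0).
have alE p (i : 'I_N) : al p i = (an p.1 i)%:Z - (bn p.2 i)%:Z.
  by rewrite mindexE ltn_ord insubT //= => lt; congr (_%:Z - _%:Z); congr (_ _); apply: val_inj.
have monE p z : monomial (al p) z = bmon (an p.1) z / bmon (bn p.2) z.
  rewrite monomial_mindex /bmon -prodf_div; apply: eq_bigr => i _.
  have -> : (if insub (val i) is Some j then (an p.1 j)%:Z - (bn p.2 j)%:Z else 0)
     = (an p.1 i)%:Z - (bn p.2 i)%:Z by rewrite valK.
  by rewrite expfzDr ?circle_neq0 // -invr_expz.
pose v (p : S' * S) := \sum_(n < N) if nat_index n.+1 == al p then x n else 0.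
have fv p : is_fourier_coef mu f (al p) (v p).
  have [na|na] := pselect (nonneg_index (al p)).
    have := fc _ na; rewrite /dirichlet_poly big_mkcond /=.
    rewrite (eq_bigr (fun i : 'I_N => if nat_index i.+1 == al p then x i else 0)) // => i _.
    congr (if _ then _ else _); apply/eqP/eqP => [->|<-].
      exact: index_natK.
    by rewrite nat_indexK.
  have := f0 _ na; rewrite /v big1 // => i _.
  by case: eqP => // e; case: na; rewrite -e; apply: nat_index_nonneg.
pose c (h : 'I_(2 ^ k)) (p : S' * S) : R[i] :=
  (bmon (an p.1) (kpoint u q h))^-1 * bmon (bn p.2) (kpoint u q h).
pose g (z : torus R) : R :=
  2^-1 * (cmod (\sum_a bmon (an a) z) ^+ 2 + cmod (\sum_b bmon (bn b) z) ^+ 2).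
pose G : R := 3 / 2 * #|S|%:R * (2 ^ k)%N%:R.
have S0 : 0 < #|S|%:R :> R by rewrite ltr0n card_ffun card_ord expn_gt0.
have G0 : 0 < G by rewrite !mulr_gt0 // invr_gt0.
have cg h z : cmod (\sum_p c h p * (monomial (al p) z)^-1) <= g (torus_mul (kpoint u q h) z).
  have -> : \sum_p c h p * (monomial (al p) z)^-1 =
     (\sum_a (bmon (an a) (torus_mul (kpoint u q h) z))^-1) *
     (\sum_b bmon (bn b) (torus_mul (kpoint u q h) z)).
    rewrite big_distrlr /= pair_bigA /=; apply: eq_bigr => p _.
    by rewrite /c monE !bmon_mul invf_div !invfM; ring.
  rewrite cmodM cmod_sum_inv; last by move=> a; apply: cmod_bmon.
  rewrite /g; set s := cmod _; set t := cmod _.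
  by have := sqr_ge0 (s - t); lra.
have gG z : \sum_(h < 2 ^ k) g (torus_mul (kpoint u q h) z) <= G.
  rewrite -mulr_sumr big_split /=.
  have P (T : finType) (e : T -> 'I_N -> nat) : (forall t i, e t i < q)%N ->
      (forall t t', e t =1 e t' -> t = t') ->
      \sum_(h < 2 ^ k) cmod (\sum_t bmon (e t) (torus_mul (kpoint u q h) z)) ^+ 2 =
      (2 ^ k)%N%:R * #|T|%:R.
    move=> eq eI; rewrite (eq_bigr (fun h : 'I_(2 ^ k) => cmod (\sum_t
        (u : R[i]) ^+ (h * bcode q (e t)) * bmon (e t) z) ^+ 2)); last first.
      move=> h _; congr (cmod _ ^+ 2); apply: eq_bigr => t _.
      by rewrite bmon_mul bmon_kpoint.
    rewrite (parseval_chars (fun t => bmon (e t) z) pr r1).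
    - congr (_ * _); under eq_bigr => t _ do rewrite cmod_bmon expr1n.
      by rewrite sumr_const.
    - by move=> t; apply: ltn_trans (bcode_lt (eq t)) q_lt2k.
    - by move=> t t' /(bcode_inj (eq t) (eq t'))/eI.
  rewrite (P _ an); last 2 first.
  - by move=> a i; apply: ltn_ord.
  - by move=> a a' e; apply/ffunP => i; apply/val_inj/e.
  rewrite (P _ bn); last 2 first.
  - by move=> b i; apply: leq_trans (ltn_ord _) _; rewrite leq_addr.
  - by move=> b b' e; apply/ffunP => i; apply/val_inj/e.
  by rewrite /G; have := card_S'; nra.
have V h : \sum_p c h p *: v p =
    #|S|%:R%:C *: \sum_n (u : R[i])^-1 ^+ (h * freq n) *: x n.
  have a_lt (n : 'I_N) (b : S) (i : 'I_N) : (expo n i + b i < q)%N.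
    by rewrite /kron_base addnC -addnS leq_add // ?ltn_ord // ltnW ?ltn_ord.
  pose a0 n b : S' := [ffun i => Ordinal (a_lt n b i)].
  have alP (n : 'I_N) a b : (nat_index n.+1 == al (a, b)) = (a == a0 n b).
    apply/eqP/eqP => [e|->].
      apply/ffunP => i; apply/val_inj; rewrite ffunE /=.
      have := congr1 (fun m : multi_index => m i) e; rewrite alE nat_indexE /an /bn /expo /=.
      lia.
    apply/fsfunP => i; have [iN|Ni] := ltnP i N.
      have := alE (a0 n b, b) (Ordinal iN); rewrite nat_indexE /an /bn /= ffunE /= => ->.
      by rewrite /expo /=; lia.
    by rewrite nat_indexE mindexE ltnNge Ni /= logn_nth_prime_ge // (leq_trans (ltn_ord _) Ni).
  transitivity (\sum_(b : S) \sum_n \sum_(a : S')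
      if a == a0 n b then c h (a, b) *: x n else 0).
    rewrite (eq_bigr (fun p : S' * S => \sum_n
      if p.1 == a0 n p.2 then c h p *: x n else 0)); last first.
      move=> [a b] _; rewrite /v scaler_sumr; apply: eq_bigr => n _.
      by rewrite alP /=; case: eqP => // _; rewrite scaler0.
    rewrite -(pair_bigA _ (fun a b => \sum_n if a == a0 n b then c h (a, b) *: x n else 0)) /=.
    by rewrite exchange_big; apply: eq_bigr => b _; rewrite exchange_big.
  rewrite (eq_bigr (fun=> \sum_n (u : R[i])^-1 ^+ (h * freq n) *: x n)); last first.
    move=> b _; apply: eq_bigr => n _; rewrite -big_mkcond big_pred1_eq /c /=.
    have -> : bmon (an (a0 n b)) (kpoint u q h) = chi n.+1 (kpoint u q h) * bmon (bn b) (kpoint u q h).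
      rewrite chi_bmon /bmon -big_split; apply: eq_bigr => i _.
      by rewrite /= -exprD /an /bn ffunE.
    by rewrite invfM -mulrA mulVf ?bmon_neq0 // mulr1 chi_kpoint exprVn.
  by rewrite sumr_const rmorph_nat scaler_nat.
have mg : measurable_fun setT g.
  apply: measurable_funM => //; apply: measurable_funD; apply: measurable_cmod;
    apply: cmeasurable_sum => a; exact: cmeasurable_bmon.
have g0 z : 0 <= g z by rewrite mulr_ge0 ?addr_ge0 ?sqr_ge0 ?invr_ge0.
have hH : (0 < #|'I_(2 ^ k)|)%N by rewrite card_ord expn_gt0.
have := schur_test mu_haar fv mf fB hH G0 mg g0 cg gG.
under eq_bigr => h _ do rewrite V cnormZr exprMn.
rewrite -mulr_sumr -/W card_ord /G ger0_norm ?(ltW S0) // => h.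
have S2 : 0 < #|S|%:R ^+ 2 :> R by rewrite exprn_gt0.
rewrite -(ler_pM2l S2); apply: (le_trans h); rewrite le_eqVlt; apply/orP; left; apply/eqP.
by field; rewrite lt0r_neq0.
Qed.

End LowerBound.

(** * Type 2 and cotype 2 give the random properties *)

Section RandomNorm.
Context {R : realType} {X : normedModType R[i]}.
Variables (mu : probability (torus R) R) (mu_haar : is_haar mu).

Definition mean_hp N (x : 'I_N -> X) : R := avg (fun e : sign_seq N => hp mu (esign e x)).

Lemma mean_hpE N (x : 'I_N -> X) : dirichlet_poly_rad_norm mu 2 x = (mean_hp x)%:E.
Proof.
rewrite /dirichlet_poly_rad_norm /expect_signs_ereal.
rewrite (eq_bigr (fun e => (hp mu (esign e x))%:E)); last by move=> e _; apply: hpE.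
by rewrite sumEFin -EFinM /mean_hp /avg card_ffun card_bool card_ord natrX.
Qed.

Lemma dyadic_circle k : exists u : circle R, dyadic_root k (u : R[i]).
Proof.
by have [r hr] := @dyadic_root_exists R k; exists (circle_of (dyadic_root_cmod hr)).
Qed.

Lemma Rad_unimodular_le (I : finType) (a : I -> R[i]) (x : I -> X) :
  (forall i, cmod (a i) = 1) -> Rad (fun i => a i *: x i) <= 2 * Rad x.
Proof.
move=> a1; apply: le_trans (Rad_contr_c x (b := fun=> 1) _) _.
  by move=> i; rewrite a1.
by rewrite (eq_Rad (y := x)) // => i; rewrite scale1r.
Qed.

Lemma Rad_unimodular_ge (I : finType) (a : I -> R[i]) (x : I -> X) :
  (forall i, cmod (a i) = 1) -> Rad x <= 2 * Rad (fun i => a i *: x i).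
Proof.
move=> a1; have a0 i : a i != 0.
  by apply/eqP => e; have /eqP := a1 i; rewrite e cmod0 eq_sym oner_eq0.
rewrite (@eq_Rad _ _ _ x (fun i => (a i)^-1 *: (a i *: x i))); last first.
  by move=> i; rewrite scalerA mulVf ?scale1r.
by apply: Rad_unimodular_le => i; rewrite cmodV a1 invr1.
Qed.

(** For every choice of signs the mean value of the norm over the points
    [kpoint u _ h] is controlled by the norm of the signed polynomial, and at each
    of these points the coefficients are only rotated. *)
Lemma Rad_le_mean_hp N (x : 'I_N -> X) : Rad x <= 3 * mean_hp x.
Proof.
have [u ru] := dyadic_circle (kron_exp N).
pose a (h : 'I_(2 ^ kron_exp N)) (n : 'I_N) := (u : R[i])^-1 ^+ (h * freq n).
have a1 h n : cmod (a h n) = 1 by rewrite cmodX cmodV cmod_circle invr1 expr1n.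
have h0 : 'I_(2 ^ kron_exp N) by apply: (@Ordinal _ 0); rewrite expn_gt0.
have M0 : 0 < (2 ^ kron_exp N)%N%:R :> R by rewrite ltr0n expn_gt0.
have step (e : sign_seq N) :
    avg (fun h => cnorm (rsum (fun n => a h n *: x n) e)) <= 3 / 2 * hp mu (esign e x).
  have l0 : 0 <= avg (fun h => cnorm (rsum (fun n => a h n *: x n) e)).
    by apply: avg_ge0 => h; apply: cnorm_ge0.
  have r0 : 0 <= 3 / 2 * hp mu (esign e x) by rewrite mulr_ge0 ?hp_ge0.
  rewrite -ler_sqr //.
  apply: le_trans (avg_sqr_le h0 _) _; rewrite /avg card_ord ler_pdivrMl //.
  apply: le_trans (_ : 9 / 4 * (2 ^ kron_exp N)%N%:R * hp mu (esign e x) ^+ 2 <= _).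
    apply: le_trans (sum_dft_le mu_haar (esign e x) ru); apply: ler_sum => h _.
    rewrite le_eqVlt; apply/orP; left; apply/eqP; congr (cnorm _ ^+ 2).
    by apply: eq_bigr => n _; rewrite /esign !scalerA mulrC.
  by rewrite le_eqVlt; apply/orP; left; apply/eqP; field.
have : avg (fun e : sign_seq N => avg (fun h => cnorm (rsum (fun n => a h n *: x n) e)))
    <= 3 / 2 * mean_hp x by rewrite /mean_hp -avgZ; apply: avg_le.
rewrite avg_exchange => le1.
have : avg (fun h : 'I_(2 ^ kron_exp N) => 2^-1 * Rad x) <= 3 / 2 * mean_hp x.
  apply: le_trans le1; apply: avg_le => h.
  by rewrite -/(Rad (fun n => a h n *: x n)) ler_pdivrMl // Rad_unimodular_ge.
by rewrite avg_const //; lra.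
Qed.

(** At each point of the torus the coefficients are only rotated, and Kahane's
    inequality bounds the quadratic mean over the signs. *)
Lemma mean_hp_le_Rad N (x : 'I_N -> X) : mean_hp x <= 3 * Rad x.
Proof.
have e0 : sign_seq N := [ffun=> false].
have S0 : 0 < #|sign_seq N|%:R :> R by rewrite ltr0n; apply/card_gt0P; exists e0.
have mean_hp0 : 0 <= mean_hp x by apply: avg_ge0 => e; apply: hp_ge0.
have Rad0 : 0 <= 3 * Rad x by rewrite mulr_ge0 ?Rad_ge0.
rewrite -ler_sqr //.
apply: le_trans (avg_sqr_le e0 _) _; rewrite /avg ler_pdivrMl //.
pose t (h : 'I_1) : torus R := point.
have H1 : (0 < #|'I_1|)%N by rewrite card_ord.
apply: (sum_sqr_hp_le mu_haar (x := fun e : sign_seq N => esign e x) (t := t) H1) => z.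
rewrite card_ord mul1r; set w := torus_mul point z.
rewrite (eq_bigr (fun e : sign_seq N =>
    cnorm (rsum (fun n : 'I_N => chi n.+1 w *: x n) e) ^+ 2)); last first.
  move=> e _; rewrite big_ord1 -/w; congr (cnorm _ ^+ 2).
  by apply: eq_bigr => n _; rewrite /esign !scalerA mulrC.
rewrite -(ler_pdivrMl _ _ S0); apply: le_trans (kahane _) _.
have := Rad_unimodular_le x (fun n : 'I_N => cmod_chi n.+1 w).
set r := Rad _; have r0 : 0 <= r by apply: Rad_ge0.
move=> h; have : r ^+ 2 <= (2 * Rad x) ^+ 2.
  by rewrite ler_sqr ?nnegrE ?Rad_ge0 1?mulr_ge0 ?Rad_ge0.
by have := sqr_ge0 (Rad x); rewrite (exprMn _ 2) (exprMn _ 3); lra.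
Qed.

Definition transport (I J : finType) (s : J -> I) (x : J -> X) (i : I) : X :=
  \sum_(j | s j == i) x j.

Lemma transportE (I J : finType) (s : J -> I) (x : J -> X) j :
  injective s -> transport s x (s j) = x j.
Proof. by move=> sI; rewrite /transport (big_pred1 j) // => i; rewrite (inj_eq sI). Qed.

Lemma transport0 (I J : finType) (s : J -> I) (x : J -> X) i :
  (forall j, s j != i) -> transport s x i = 0.
Proof. by move=> h; rewrite /transport big1 // => j /eqP ji; have := h j; rewrite ji eqxx. Qed.

Lemma Rad_transport (I J : finType) (s : J -> I) (x : J -> X) :
  injective s -> Rad (transport s x) = Rad x.
Proof.
move=> sI; apply: (Rad_inj sI) => [j|i]; [exact: transportE|exact: transport0].
Qed.

Lemma sqsum_transport (I J : finType) (s : J -> I) (x : J -> X) :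
  injective s -> sqsum (transport s x) = sqsum x.
Proof.
move=> sI; apply: (sqsum_inj sI) => [j|i]; [exact: transportE|exact: transport0].
Qed.

Lemma sum_transport (I J : finType) (s : J -> I) (x : J -> X) (F : I -> R[i]) :
  \sum_i F i *: transport s x i = \sum_j F (s j) *: x j.
Proof.
rewrite /transport; under eq_bigr => i _ do rewrite scaler_sumr big_mkcond.
rewrite exchange_big; apply: eq_bigr => j _; rewrite -big_mkcond.
by rewrite (big_pred1 (s j)) // => i; rewrite eq_sym.
Qed.

(** The coefficients of a Dirichlet polynomial, placed at the frequencies that
    they have along the points [kpoint]. *)
Definition spread N (x : 'I_N -> X) : 'I_(2 ^ kron_exp N) -> X := transport (@freq N) x.

Lemma Rad_spread N (x : 'I_N -> X) : Rad (spread x) = Rad x.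
Proof. by apply: Rad_transport; apply: freq_inj. Qed.

Lemma dft_spread N (x : 'I_N -> X) r h :
  dft r (spread x) h = \sum_n r ^+ (h * freq n) *: x n.
Proof. exact: sum_transport. Qed.

(** The values [sum_n u^-(h freq n) x_n] that [sum_dft_le] controls are the Fourier
    transform of [spread x], so that type 2 bounds [Rad x] by the norm. *)
Lemma type2_RCP : has_type2 X -> Hp_RCP mu 2 X.
Proof.
move=> /type2_Rad[C C0 hC]; exists (Num.max 1 (18 * C)); first by rewrite le_max lexx.
move=> N x; rewrite mean_hpE hpE // -EFinM lee_fin.
apply: le_trans (_ : 18 * C * hp mu x <= _); last first.
  by rewrite ler_wpM2r ?hp_ge0 // le_max lexx orbT.
apply: le_trans (mean_hp_le_Rad x) _.
have [u ru] := dyadic_circle (kron_exp N).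
have := type2_dft hC (spread x) C0 (dyadic_rootV ru).
set s := Num.sqrt _; have s0 : 0 < s by rewrite sqrtr_gt0 exprn_gt0.
have s2 : s ^+ 2 = (2 ^ kron_exp N)%N%:R by rewrite sqr_sqrtr ?exprn_ge0 // natrX.
have le1 : sqsum (dft (u : R[i])^-1 (spread x)) <= 3 / 2 * s * hp mu x.
  rewrite -ler_sqr ?nnegrE ?sqsum_ge0 ?mulr_ge0 ?hp_ge0 ?divr_ge0 ?(ltW s0) //.
  rewrite sqr_sqsum (eq_bigr (fun h : 'I_(2 ^ kron_exp N) =>
    cnorm (\sum_n (u : R[i])^-1 ^+ (h * freq n) *: x n) ^+ 2)); last first.
    by move=> h _; rewrite dft_spread.
  apply: le_trans (sum_dft_le mu_haar x ru) _; rewrite !exprMn s2.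
  by rewrite le_eqVlt; apply/orP; left; apply/eqP; field.
rewrite Rad_spread => le2.
have : s * Rad x <= s * (6 * C * hp mu x).
  apply: le_trans le2 _; apply: le_trans (_ : 4 * C * (3 / 2 * s * hp mu x) <= _).
    by rewrite ler_wpM2l ?mulr_ge0.
  by rewrite le_eqVlt; apply/orP; left; apply/eqP; field.
by rewrite ler_pM2l // => ?; lra.
Qed.

(** The values of a polynomial at the translates of [z] by the points [kpoint] are
    the Fourier transform of its coefficients rotated by [z], so that cotype 2
    bounds their quadratic mean. *)
Lemma cotype2_RDP : has_cotype2 X -> Hp_RDP mu 2 X.
Proof.
move=> /cotype2_Rad[C C0 hC]; set C' := C * (4 + 16 * C).
have C'0 : 0 <= C' by rewrite mulr_ge0 // addr_ge0 ?mulr_ge0.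
exists (Num.max 1 (6 * C')); first by rewrite le_max lexx.
move=> N x; rewrite mean_hpE hpE // -EFinM lee_fin.
have mean_hp0 : 0 <= mean_hp x by apply: avg_ge0 => e; apply: hp_ge0.
apply: le_trans (_ : 6 * C' * mean_hp x <= _); last first.
  by rewrite ler_wpM2r // le_max lexx orbT.
have [u ru] := dyadic_circle (kron_exp N).
have bound0 (c : R) : 0 <= c -> 0 <= c * Rad x by move=> c0; rewrite mulr_ge0 ?Rad_ge0.
have C''0 : 0 <= 2 * C' by rewrite mulr_ge0.
suff : hp mu x ^+ 2 <= (2 * C' * Rad x) ^+ 2.
  rewrite ler_sqr ?nnegrE ?hp_ge0 ?bound0 // => le1.
  have := ler_wpM2l C'0 (Rad_le_mean_hp x); lra.
pose t (h : 'I_(2 ^ kron_exp N)) := kpoint u (kron_base N) h.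
have H0 : (0 < #|'I_(2 ^ kron_exp N)|)%N by rewrite card_ord expn_gt0.
have := sum_sqr_hp_le mu_haar (x := fun _ : 'I_1 => x) (t := t)
  (A := (2 * C' * Rad x) ^+ 2) H0; rewrite big_ord1; apply => z.
rewrite big_ord1 card_ord.
pose y (n : 'I_N) := chi n.+1 z *: x n.
rewrite (eq_bigr (fun h => cnorm (dft (u : R[i]) (spread y) h) ^+ 2)); last first.
  move=> h _; congr (cnorm _ ^+ 2); rewrite dft_spread; apply: eq_bigr => n _.
  by rewrite /y chi_mul chi_kpoint scalerA.
rewrite -sqr_sqsum; have := cotype2_dft hC (spread y) C0 ru; rewrite Rad_spread.
set S := sqsum _; set s := Num.sqrt _.
have s0 : 0 < s by rewrite sqrtr_gt0 exprn_gt0.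
have s2 : s ^+ 2 = (2 ^ kron_exp N)%N%:R by rewrite sqr_sqrtr ?exprn_ge0 // natrX.
rewrite -natrX -s2 -/C' => le1.
have le2 : S <= C' * s * (2 * Rad x).
  rewrite -(ler_pM2l s0); apply: le_trans le1 _.
  have := Rad_unimodular_le x (fun n : 'I_N => cmod_chi n.+1 z); rewrite -/(Rad y) => le3.
  rewrite (_ : s * (C' * s * (2 * Rad x)) = C' * s ^+ 2 * (2 * Rad x)); last by ring.
  by rewrite ler_wpM2l // mulr_ge0 ?sqr_ge0.
rewrite (_ : s ^+ 2 * _ = (C' * s * (2 * Rad x)) ^+ 2); last by ring.
have rhs0 : 0 <= C' * s * (2 * Rad x).
  by rewrite (mulr_ge0 (mulr_ge0 C'0 (ltW s0))) // mulr_ge0 // Rad_ge0.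
by rewrite ler_sqr // nnegrE sqsum_ge0.
Qed.

End RandomNorm.

(** * The random properties give type 2 and cotype 2 *)

Section TestPolynomials.
Context {R : realType}.

Lemma weighted_cauchy (I : finType) (w t : I -> R) (W : R) : 0 < W ->
  (forall i, 0 <= w i) -> \sum_i w i = W ->
  (\sum_i w i * t i) ^+ 2 <= W * \sum_i w i * t i ^+ 2.
Proof.
move=> W0 w0 wW; set S := \sum_i w i * t i; rewrite mulrC -ler_pdivrMr //.
set c := S / W; have cE : S = c * W by rewrite /c divfK // lt0r_neq0.
have : 0 <= \sum_i w i * (t i - c) ^+ 2.
  by apply: sumr_ge0 => i _; rewrite mulr_ge0 ?sqr_ge0.
rewrite (eq_bigr (fun i => w i * t i ^+ 2 - 2 * c * (w i * t i) + c ^+ 2 * w i)); last first.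
  by move=> i _; ring.
rewrite big_split sumrB -!mulr_sumr wW -/S /= => h.
have -> : S ^+ 2 / W = c * S by rewrite /c; ring.
have -> : c * S = 2 * c * S - c ^+ 2 * W by rewrite cE; ring.
by lra.
Qed.

Variable k : nat.
Local Notation M := (2 ^ k)%N.

Let M0 : 0 < M%:R :> R. Proof. by rewrite ltr0n expn_gt0. Qed.

(** The coefficients of the square of the geometric sum [1 + v + ... + v^(M-1)]. *)
Definition gsquare_coef (j : nat) : nat := (\sum_(p : 'I_M * 'I_M) (p.1 + p.2 == j :> nat))%N.

Lemma sum_gsquare_coef (A : nzRingType) (F : nat -> A) :
  \sum_(j < 2 * M) (gsquare_coef j)%:R * F j = \sum_(p : 'I_M * 'I_M) F (p.1 + p.2)%N.
Proof.
under eq_bigr => j _ do rewrite /gsquare_coef natr_sum mulr_suml.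
rewrite exchange_big; apply: eq_bigr => -[a b] _ /=.
have lt : (a + b < 2 * M)%N by have := ltn_ord a; have := ltn_ord b; lia.
rewrite (bigD1 (Ordinal lt)) //= eqxx mul1r big1 ?addr0 // => j ne.
by rewrite (_ : (a + b == j)%N = false) ?mul0r //; apply: contraNF ne => /eqP e; apply/eqP/val_inj.
Qed.

Lemma gsquareE (A : comNzRingType) (v : A) :
  \sum_(j < 2 * M) (gsquare_coef j)%:R * v ^+ j = (\sum_(a < M) v ^+ a) ^+ 2.
Proof.
rewrite sum_gsquare_coef expr2 big_distrlr /= pair_bigA /=.
by apply: eq_bigr => p _; rewrite exprD.
Qed.

Lemma gsquare_coef_le j : (gsquare_coef j <= M)%N.
Proof.
rewrite /gsquare_coef -(pair_bigA _ (fun a b : 'I_M => nat_of_bool (a + b == j)%N)) /=.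
rewrite -[leqRHS]card_ord -sum1_card; apply: leq_sum => a _.
have [/existsP[b /eqP ab]|] := boolP [exists b : 'I_M, (a + b == j)%N]; last first.
  by rewrite negb_exists => /forallP h; rewrite big1 // => b _; rewrite (negbTE (h b)).
rewrite (bigD1 b) //= big1 => [|i ib]; first by rewrite addn0 leq_b1.
rewrite (_ : (a + i == j)%N = false) //; apply: contraNF ib => /eqP ai.
by apply/eqP/val_inj/eqP; rewrite -(eqn_add2l a) /= ai ab.
Qed.

Lemma sum_gsquare_coef1 : \sum_(j < 2 * M) (gsquare_coef j)%:R = M%:R ^+ 2 :> R.
Proof.
have := gsquareE (1 : R); under eq_bigr => j _ do rewrite expr1n mulr1.
by move=> ->; rewrite (eq_bigr (fun=> 1)) ?sumr_const ?card_ord // => a _; rewrite expr1n.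
Qed.

Lemma sum_sqr_gsquare_le : \sum_(j < 2 * M) (gsquare_coef j)%:R ^+ 2 <= M%:R ^+ 3 :> R.
Proof.
rewrite [leRHS]exprS -sum_gsquare_coef1 mulr_sumr; apply: ler_sum => j _.
by rewrite expr2 ler_wpM2r // ler_nat gsquare_coef_le.
Qed.

Lemma sum_sqr_gsquare_ge : M%:R ^+ 3 <= 2 * \sum_(j < 2 * M) (gsquare_coef j)%:R ^+ 2 :> R.
Proof.
have W0 : 0 < 2 * M%:R :> R by rewrite mulr_gt0.
have := @weighted_cauchy _ (fun=> 1) (fun j : 'I_(2 * M) => (gsquare_coef j)%:R) _ W0 (fun=> ler01).
rewrite sumr_const card_ord natrM; move=> /(_ erefl).
under eq_bigr => j _ do rewrite mul1r.
under [X in _ * X]eq_bigr => j _ do rewrite mul1r.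
rewrite sum_gsquare_coef1; set S := \sum_j _ => h; rewrite -(ler_pM2l M0).
have -> : M%:R * M%:R ^+ 3 = M%:R ^+ 2 ^+ 2 :> R by ring.
by lra.
Qed.

Variable u : circle R.
Hypothesis ru : dyadic_root k (u : R[i]).

Definition geom (v : R[i]) : R[i] := \sum_(a < M) v ^+ a.

Lemma sum_sqr_geom (r v : R[i]) : dyadic_root k r -> cmod v = 1 ->
  \sum_(h < M) cmod (geom (r ^+ h * v)) ^+ 2 = M%:R ^+ 2.
Proof.
move=> rr v1; rewrite (eq_bigr (fun h : 'I_M =>
    cmod (\sum_(a < M) r ^+ (h * a) * v ^+ a) ^+ 2)); last first.
  move=> h _; congr (cmod _ ^+ 2); apply: eq_bigr => a _.
  by rewrite exprMn exprM.
rewrite (parseval_chars _ (dyadic_root_prim rr) (dyadic_root_cmod rr)) //; last first.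
  exact: val_inj.
by rewrite (eq_bigr (fun=> 1)) ?sumr_const ?card_ord // => a _; rewrite cmodX v1 !expr1n.
Qed.

Lemma cmod_geomV (v : R[i]) : cmod v = 1 -> cmod (geom v^-1) = cmod (geom v).
Proof.
move=> v1; rewrite -[RHS]cmod_sum_inv; last by move=> a; rewrite cmodX v1 expr1n.
by congr cmod; apply: eq_bigr => a _; rewrite exprVn.
Qed.

Definition tcoef (h j : nat) : R[i] := (gsquare_coef j)%:R * (u : R[i])^-1 ^+ (h * j).

Lemma cmod_tcoef h j : cmod (tcoef h j) = (gsquare_coef j)%:R.
Proof.
rewrite cmodM cmodX cmodV cmod_circle invr1 expr1n mulr1.
by rewrite -(rmorph_nat (real_complex R)) cmodr normr_nat.
Qed.

Definition texp (p : 'I_M * 'I_(2 * M)) : nat := (2 * M * p.1 + p.2)%N.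

Lemma texp_inj : injective texp.
Proof.
move=> [a b] [a' b']; rewrite /texp /= => e.
have M2 : (0 < 2 * M)%N by rewrite muln_gt0 expn_gt0.
have eb : b = b' :> nat.
  by have := congr1 (modn^~ (2 * M)%N) e; rewrite /= ![(2 * M * _)%N]mulnC !modnMDl !modn_small.
have ea : a = a' :> nat.
  by move: e; rewrite eb => /addIn /eqP; rewrite eqn_pmul2l // => /eqP.
by rewrite (val_inj ea) (val_inj eb).
Qed.

Lemma texp_lt p : (2 ^ texp p - 1 < 2 ^ (2 * M * M))%N.
Proof.
apply: leq_ltn_trans (leq_subr _ _) _; rewrite ltn_exp2l //.
case: p => a b; rewrite /texp /=; have := ltn_ord a; have := ltn_ord b; nia.
Qed.

Definition slot p : 'I_(2 ^ (2 * M * M)) := Ordinal (texp_lt p).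

Lemma slotE p : (slot p).+1 = (2 ^ texp p)%N.
Proof. by rewrite /= subn1 prednK // expn_gt0. Qed.

Lemma slot_inj : injective slot.
Proof.
move=> p p' /(congr1 (fun i : 'I__ => i.+1)); rewrite !slotE => /eqP.
by rewrite eqn_exp2l // => /eqP /texp_inj.
Qed.

Context {X : normedModType R[i]}.
Variables (mu : probability (torus R) R) (mu_haar : is_haar mu).

Definition copies_of (x : 'I_M -> X) (p : 'I_M * 'I_(2 * M)) : X := tcoef p.1 p.2 *: x p.1.

(** The Dirichlet polynomial that is [sum_h x_h phi_h] on the torus, where
    [phi_h(z) = z_0^(2 M h) (geom (z_0 u^-h))^2]. The [|phi_h|] are
    translates of a multiple of a Fejer kernel, so their sum over [h] is constant,
    while the spectra of the [phi_h] are disjoint. *)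
Definition tpoly (x : 'I_M -> X) : 'I_(2 ^ (2 * M * M)) -> X :=
  transport slot (copies_of x).

Lemma Rad_tpoly x : Rad (tpoly x) = Rad (copies_of x).
Proof. exact/Rad_transport/slot_inj. Qed.

Lemma dpoly_tpoly x z : dpoly (tpoly x) z =
  \sum_(h < M) ((z 0%N : R[i]) ^+ (2 * M * h) * geom ((u : R[i])^-1 ^+ h * (z 0%N : R[i])) ^+ 2) *: x h.
Proof.
rewrite /dpoly (sum_transport slot _ (fun i => chi i.+1 z)).
rewrite -(pair_bigA _ (fun h j => chi (slot (h, j)).+1 z *: copies_of x (h, j))) /=.
apply: eq_bigr => h _; rewrite -gsquareE mulr_sumr scaler_suml.
apply: eq_bigr => j _; rewrite -[X in chi X]/((slot (h, j)).+1) slotE chi_pow2 /texp /=.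
by rewrite /copies_of /tcoef scalerA /= exprMn exprD [_ ^+ (h * j)]exprM; congr (_ *: _); ring.
Qed.

Let s : R := Num.sqrt (M%:R ^+ 3).
Let s0 : 0 < s. Proof. by rewrite sqrtr_gt0 exprn_gt0. Qed.
Let s2 : s ^+ 2 = M%:R ^+ 3. Proof. by rewrite sqr_sqrtr // exprn_ge0 // ltW. Qed.

(** At each point the square of the norm is estimated by the Cauchy-Schwarz
    inequality with weights [|phi_h|]; their sum over [h], and their sum over the
    translates of the point, are constant. *)
Lemma hp_tpoly_le x : hp mu (tpoly x) <= s * sqsum x.
Proof.
rewrite -ler_sqr ?nnegrE ?hp_ge0 ?mulr_ge0 ?(ltW s0) ?sqsum_ge0 //.
pose t (h : 'I_M) : torus R := fun=> circle_exp u h.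
have H0 : (0 < #|'I_M|)%N by rewrite card_ord expn_gt0.
have := sum_sqr_hp_le mu_haar (x := fun _ : 'I_1 => tpoly x) (t := t)
  (A := (s * sqsum x) ^+ 2) H0; rewrite big_ord1; apply => z.
rewrite big_ord1 card_ord exprMn s2 sqr_sqsum.
pose w (h i : 'I_M) : R := cmod (geom ((u : R[i])^-1 ^+ i * ((u : R[i]) ^+ h * (z 0%N : R[i])))) ^+ 2.
have wi h : \sum_i w h i = M%:R ^+ 2.
  apply: sum_sqr_geom; first exact: dyadic_rootV.
  by rewrite cmodM cmodX !cmod_circle expr1n mulr1.
have wh i : \sum_h w h i = M%:R ^+ 2.
  rewrite -(@sum_sqr_geom (u : R[i]) ((u : R[i])^-1 ^+ i * (z 0%N : R[i])) ru).
    by apply: eq_bigr => h _; rewrite /w mulrCA.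
  by rewrite cmodM cmodX cmodV !cmod_circle invr1 expr1n mulr1.
apply: le_trans (_ : \sum_h (M%:R ^+ 2 * \sum_i w h i * cnorm (x i) ^+ 2) <= _).
  apply: ler_sum => h _.
  apply: le_trans (weighted_cauchy _ (exprn_gt0 2 M0) _ (wi h)); last first.
    by move=> i; apply: sqr_ge0.
  rewrite ler_sqr ?nnegrE ?cnorm_ge0 //; last first.
    by apply: sumr_ge0 => i _; rewrite mulr_ge0 ?sqr_ge0 ?cnorm_ge0.
  rewrite dpoly_tpoly; apply: le_trans (ler_cnorm_sum _ _ _) _; apply: ler_sum => i _.
  by rewrite cnormZ cmodM !cmodX cmod_circle expr1n mul1r.
rewrite -mulr_sumr exchange_big /=; under eq_bigr => i _ do rewrite -mulr_suml wh.
by rewrite -mulr_sumr le_eqVlt; apply/orP; left; apply/eqP; ring.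
Qed.

(** The conjugates of the [phi_h] recover the [x h] from the polynomial, and the
    sum of their absolute values is constant. *)
Lemma hp_tpoly_ge x : s * sqsum x <= 2 * hp mu (tpoly x).
Proof.
rewrite -ler_pdivrMl //; apply: (hp_ge mu_haar) => [|f [[[mf _] _] fc] B fB].
  by rewrite !mulr_ge0 ?sqsum_ge0 ?invr_ge0 // ltW.
pose al p := nat_index (2 ^ texp p).
have fv p : is_fourier_coef mu f (al p) (copies_of x p).
  have := fc _ (nat_index_nonneg (2 ^ texp p)); rewrite nat_indexK ?expn_gt0 //.
  rewrite /dirichlet_poly (big_pred1 (slot p)) ?[tpoly _ _]transportE //; first exact: slot_inj.
  by move=> i; rewrite /= -slotE eqSS.
pose c (h : 'I_M) (p : 'I_M * 'I_(2 * M)) : R[i] :=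
  if p.1 == h then (gsquare_coef p.2)%:R * (u : R[i]) ^+ (h * p.2) else 0.
pose t (h : 'I_M) : torus R := fun=> circle_exp (circle_of (dyadic_root_cmod (dyadic_rootV ru))) h.
pose g (z : torus R) : R := cmod (geom (z 0%N : R[i])) ^+ 2.
have sumc (V : lmodType R[i]) h (F : 'I_M * 'I_(2 * M) -> V) :
    \sum_p c h p *: F p = \sum_(j < 2 * M) ((gsquare_coef j)%:R * (u : R[i]) ^+ (h * j)) *: F (h, j).
  rewrite (eq_bigr (fun p => c h (p.1, p.2) *: F (p.1, p.2))); last by case.
  rewrite -(pair_bigA _ (fun i j => c h (i, j) *: F (i, j))) /= (bigD1 h) //= [X in _ + X]big1 ?addr0.
    by apply: eq_bigr => j _; rewrite /c eqxx.
  by move=> i ih; rewrite big1 // => j _; rewrite /c /= (negbTE ih) scale0r.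
have cg h z : cmod (\sum_p c h p * (monomial (al p) z)^-1) <= g (torus_mul (t h) z).
  rewrite (sumc R[i]^o h (fun p => (monomial (al p) z)^-1)).
  rewrite (eq_bigr (fun j : 'I_(2 * M) => (z 0%N : R[i])^-1 ^+ (2 * M * h) *
     ((gsquare_coef j)%:R * ((u : R[i]) ^+ h * (z 0%N : R[i])^-1) ^+ j))); last first.
    move=> j _; rewrite -[monomial _ _]/(chi _ z) chi_pow2 /texp /= exprMn -exprM.
    by rewrite -[_ *: _]/(_ * _) -exprVn exprD; ring.
  rewrite -mulr_sumr gsquareE cmodM !cmodX cmodV cmod_circle invr1 expr1n mul1r.
  rewrite /g -cmod_geomV; last exact: cmod_circle.
  by rewrite /= invfM -exprVn invrK.
have gG z : \sum_h g (torus_mul (t h) z) <= M%:R ^+ 2.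
  rewrite /g /= sum_sqr_geom //; first exact: dyadic_rootV.
  exact: cmod_circle.
have mg : measurable_fun setT g.
  by apply: measurable_cmod; apply: cmeasurable_sum => a; apply: cmeasurableX; apply: cmeasurable_coord.
have H0 : (0 < #|'I_M|)%N by rewrite card_ord expn_gt0.
have := schur_test mu_haar fv mf fB H0 (exprn_gt0 2 M0) mg (fun z => sqr_ge0 _) cg gG.
set K : R := \sum_(j < 2 * M) (gsquare_coef j)%:R ^+ 2.
rewrite (eq_bigr (fun h => K ^+ 2 * cnorm (x h) ^+ 2)); last first.
  move=> h _; rewrite (sumc X h (copies_of x)) -exprMn; congr (_ ^+ 2).
  rewrite -[K]ger0_norm; last by apply: sumr_ge0 => j _; apply: sqr_ge0.
  rewrite -cnormZr /K rmorph_sum scaler_suml; congr cnorm; apply: eq_bigr => j _.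
  rewrite /copies_of /tcoef scalerA rmorphXn rmorph_nat /= exprVn; congr (_ *: _).
  by rewrite mulrACA divff ?mulr1 // expf_neq0 // circle_neq0.
rewrite -mulr_sumr card_ord -sqr_sqsum; set Q := sqsum x ^+ 2.
have Q0 : 0 <= Q by apply: sqr_ge0.
have K0 : s ^+ 2 <= 2 * K by rewrite s2; apply: sum_sqr_gsquare_ge.
have -> : M%:R ^+ 2 ^+ 2 / M%:R = s ^+ 2 :> R by rewrite s2; field; rewrite lt0r_neq0.
move=> h; have ss : 0 < s ^+ 2 by rewrite exprn_gt0.
rewrite -(ler_pM2l ss); apply: le_trans h.
have KK : (s ^+ 2) ^+ 2 <= (2 * K) ^+ 2.
  by rewrite ler_sqr ?nnegrE ?(ltW ss) // (le_trans (ltW ss)).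
rewrite (_ : s ^+ 2 * _ = (s ^+ 2) ^+ 2 / 4 * Q); last by rewrite /Q; field.
by apply: ler_wpM2r => //; move: KK; rewrite (exprMn _ 2); lra.
Qed.

Lemma Rad_tpoly_ge x : s * Rad x <= 8 * Rad (tpoly x).
Proof.
have b0 : 0 <= s / 2 by rewrite divr_ge0 // ltW.
have hb (h : 'I_M) : (s / 2) ^+ 2 <= \sum_(j < 2 * M) cmod (tcoef h j) ^+ 2.
  rewrite exprMn s2; under eq_bigr => j _ do rewrite cmod_tcoef.
  have := sum_sqr_gsquare_ge; have := exprn_gt0 3 M0; lra.
have := Rad_copies_ge x b0 hb; rewrite -/(copies_of x) -Rad_tpoly; lra.
Qed.

Lemma sum_sqr_tcoef_le h : \sum_(j < 2 * M) cmod (tcoef h j) ^+ 2 <= s ^+ 2.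
Proof.
by under eq_bigr => j _ do rewrite cmod_tcoef; rewrite s2 sum_sqr_gsquare_le.
Qed.

Lemma Rad_tpoly_le A x : weak_cotype X A -> 0 <= A -> Rad (tpoly x) <= s * (4 + 16 * A) * Rad x.
Proof.
move=> hA A0; rewrite Rad_tpoly.
exact: (Rad_copies_le hA (c := fun (h : 'I_M) (j : 'I_(2 * M)) => tcoef h j) x A0 s0
  (fun h => sum_sqr_tcoef_le h)).
Qed.

Lemma Rad_tpoly_le_max m x : M = (64 ^ m)%N -> Rad (tpoly x) <= s * (32 * 2 ^+ m) * Rad x.
Proof.
move=> Mm; rewrite Rad_tpoly.
have cM : #|'I_M| = (64 ^ m)%N by rewrite card_ord.
exact: (Rad_copies_le_max (c := fun (h : 'I_M) (j : 'I_(2 * M)) => tcoef h j) x cM s0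
  (fun h => sum_sqr_tcoef_le h)).
Qed.

Lemma RCP_Rad_le (C : R) (x : 'I_M -> X) : 0 <= C ->
  (forall N (y : 'I_N -> X), mean_hp mu y <= C * hp mu y) -> Rad x <= 24 * C * sqsum x.
Proof.
move=> C0 hC; rewrite -(ler_pM2l s0); apply: le_trans (Rad_tpoly_ge x) _.
have h1 := Rad_le_mean_hp mu_haar (tpoly x); have h2 := hC _ (tpoly x).
have h3 := ler_wpM2l C0 (hp_tpoly_le x).
by rewrite (_ : s * _ = 24 * (C * (s * sqsum x))); [lra|ring].
Qed.

Lemma RDP_sqsum_le (C : R) (x : 'I_M -> X) : 0 <= C ->
  (forall N (y : 'I_N -> X), hp mu y <= C * mean_hp mu y) -> s * sqsum x <= 6 * C * Rad (tpoly x).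
Proof.
move=> C0 hC; apply: le_trans (hp_tpoly_ge x) _.
have h1 := ler_wpM2l C0 (mean_hp_le_Rad mu_haar (tpoly x)); have h2 := hC _ (tpoly x); lra.
Qed.

End TestPolynomials.

Section Converses.
Context {R : realType} {X : normedModType R[i]}.
Variables (mu : probability (torus R) R) (mu_haar : is_haar mu).

Lemma RCP_type2 : Hp_RCP mu 2 X -> has_type2 X.
Proof.
move=> [C C1 hC]; have C0 : 0 <= C by apply: le_trans C1.
apply: type2P; exists (24 * C) => N x.
have wI : injective (widen_ord (ltnW (ltn_expl N (ltnSn 1)))).
  by move=> i j /(congr1 val) /= /val_inj.
rewrite -(Rad_transport x wI) -(sqsum_transport x wI).
have [u ru] := @dyadic_circle R N.
apply: (RCP_Rad_le ru mu_haar _ C0) => K y; have := hC K y.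
by rewrite (mean_hpE mu_haar) (hpE mu_haar) -EFinM lee_fin.
Qed.

(** The bound for the copies without assumption on the space gives weak cotype;
    then the bound under weak cotype applies. *)
Lemma RDP_cotype2 : Hp_RDP mu 2 X -> has_cotype2 X.
Proof.
move=> [C C1 hC]; have C0 : 0 <= C by apply: le_trans C1.
have {}hC N (y : 'I_N -> X) : hp mu y <= C * mean_hp mu y.
  by have := hC N y; rewrite (mean_hpE mu_haar) (hpE mu_haar) -EFinM lee_fin.
pose A : R := 192 * C; have A0 : 0 <= A by rewrite mulr_ge0.
have hA : weak_cotype X A.
  apply: sqsum_weak_cotype => // m.
  have E : (64 ^ m = 2 ^ (6 * m))%N by rewrite expnM.
  rewrite E => x; have [u ru] := @dyadic_circle R (6 * m).
  have := RDP_sqsum_le ru mu_haar x C0 hC.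
  have := ler_wpM2l C0 (Rad_tpoly_le_max u x (esym E)).
  set s := Num.sqrt _ => h1 h2.
  have s0 : 0 < s by rewrite sqrtr_gt0 exprn_gt0 // ltr0n expn_gt0.
  by rewrite -(ler_pM2l s0) /A; lra.
apply: cotype2P; exists (6 * C * (4 + 16 * A)).
  by rewrite !mulr_ge0 // addr_ge0 // mulr_ge0.
move=> k x; have [u ru] := @dyadic_circle R k.
have := RDP_sqsum_le ru mu_haar x C0 hC.
have := ler_wpM2l C0 (Rad_tpoly_le u x hA A0).
set s := Num.sqrt _ => h1 h2.
have s0 : 0 < s by rewrite sqrtr_gt0 exprn_gt0 // ltr0n expn_gt0.
by rewrite -(ler_pM2l s0); lra.
Qed.

End Converses.

Theorem theorem4p1 (R : realType) (X : completeNormedModType R[i])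
    (mu : probability (torus R) R) (mu_haar : is_haar mu) :
  (has_type2 X <-> Hp_RCP mu 2 X) /\ (has_cotype2 X <-> Hp_RDP mu 2 X).
Proof.
split; split.
- exact: type2_RCP.
- exact: RCP_type2.
- exact: cotype2_RDP.
- exact: RDP_cotype2.
Qed.
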